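(* Let $K$ be a field of characteristic $0$, $V=K^m$ with a non-degenerate bilinear form that is symmetric ($\epsilon=1$, $G=\mathrm{O}(V)$) or skew symmetric ($\epsilon=-1$, $G=\mathrm{Sp}(V)$). Put $d=m$ if $G=\mathrm{O}(V)$ and $d=m/2$ if $G=\mathrm{Sp}(V)$. Let $F:\mathcal{B}(\epsilon m)\to\mathcal{T}_G(V)$ be the functor from the Brauer category to the category of tensor representations of $G$, and let $F_k^\ell: B_k^\ell(\epsilon m)\to\mathrm{Hom}_G(V^{\otimes k},V^{\otimes\ell})$ be the linear map it induces. (1) The functor $F$ is full, i.e. every $F_k^\ell$ is surjective. (2) The map $F_k^\ell$ is injective if $k+\ell\le 2d$, and $\mathrm{Ker}\,F_k^\ell=\langle\Sigma_\epsilon(m+1)\rangle_k^\ell$ if $k+\ell>2d$.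
   Context: Brauer category. For $k,\ell\in\mathbb{N}$, a $(k,\ell)$ Brauer diagram is a partition into pairs (arcs) of $k$ lower nodes and $\ell$ upper nodes (each row numbered left to right); only the pairing matters. For $\delta\in K$, $B_k^\ell(\delta)$ is the $K$-vector space with basis the $(k,\ell)$ diagrams. Composition $B_\ell^p(\delta)\times B_k^\ell(\delta)\to B_k^p(\delta)$ is bilinear with $D_1\circ D_2=\delta^f D$, obtained by placing $D_1$ above $D_2$, identifying middle nodes, and deleting the $f$ closed loops. Tensor product is juxtaposition, $D\otimes D'$ having $D'$ on the right. $\mathcal{B}(\delta)$ is the category with objects $\mathbb{N}$, $\mathrm{Hom}(k,\ell)=B_k^\ell(\delta)$, and $k\otimes\ell=k+\ell$. $I$ is the $(1,1)$ diagram; $X$ the $(2,2)$ diagram joining lower $1$ to upper $2$ and lower $2$ to upper $1$; $A$ the $(2,0)$ diagram; $U$ the $(0,2)$ diagram. $K\mathrm{Sym}_r\subset B_r^r(\delta)$ via permutation diagrams (the transposition $(i,i+1)$ being $I^{\otimes(i-1)}\otimes X\otimes I^{\otimes (r-i-1)}$), and $\Sigma_\epsilon(r)=\sum_{\sigma\in\mathrm{Sym}_r}(-\epsilon)^{|\sigma|}\sigma\in B_r^r(\delta)$, $|\sigma|$ the length of $\sigma$. $\langle\Sigma_\epsilon(m+1)\rangle$ denotes the subspace of $\bigoplus_{k,\ell}B_k^\ell(\epsilon m)$ spanned by the morphisms obtained from $\Sigma_\epsilon(m+1)$ by composition and tensor product (with arbitrary morphisms of $\mathcal{B}(\epsilon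 m)$), and $\langle\Sigma_\epsilon(m+1)\rangle_k^\ell=\langle\Sigma_\epsilon(m+1)\rangle\cap B_k^\ell(\epsilon m)$. Representations. $G$ is the isometry group of the form $(-,-)$. $\mathcal{T}_G(V)$ is the full subcategory of $G$-modules with objects $V^{\otimes r}$, $r\in\mathbb{N}$ ($V^{\otimes0}=K$). For a basis $b_i$ of $V$ with dual basis $\bar b_i$, $(\bar b_i,b_j)=\delta_{ij}$, put $c_0=\sum_i b_i\otimes\bar b_i$; $P(v\otimes w)=w\otimes v$, $\check C:K\to V\otimes V$, $1\mapsto c_0$, $\hat C:V\otimes V\to K$, $v\otimes w\mapsto(v,w)$. $F$ is the unique $K$-linear functor $\mathcal{B}(\epsilon m)\to\mathcal{T}_G(V)$ with $F(r)=V^{\otimes r}$, $F(D\otimes D')=F(D)\otimes F(D')$, $F(I)=\mathrm{id}_V$, $F(X)=\epsilon P$, $F(U)=\check C$, $F(A)=\hat C$. *)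

(* Defs.v *)
From HB Require Import structures.
From mathcomp Require Import all_boot all_order all_fingroup all_algebra zify.
Set Implicit Arguments.
Unset Strict Implicit.
Unset Printing Implicit Defensive.
Import GRing.Theory.

Lemma connect_ind (T : finType) (e : rel T) (P : T -> Prop) x :
  P x -> (forall u v, P u -> e u v -> P v) -> forall y, connect e x y -> P y.
Proof.
move=> Px IH y /connectP[p]; elim: p x Px => [|z p IHp] x Px /=; first by move=> _ ->.
by case/andP=> exz pzp; apply: IHp => //; apply: IH Px exz.
Qed.

(* The two involutions encode two perfect matchings glued along some nodes: the
   components of the graph they generate are cycles or paths with two ends. *)
Lemma card_fixed_component (T : finType) (a b : T -> T) (e : rel T) x :
    involutive a -> involutive b -> (forall y, (a y == y) && (b y == y) = false) ->
    (forall u v, e u v -> v \in [:: u; a u; b u]) ->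
    (forall u, connect e u (a u)) -> (forall u, connect e u (b u)) ->
    a x = x ->
  #|[set y | connect e x y & (a y == y) || (b y == y)]| = 2.
Proof.
move=> aK bK nofix eab ea eb ax; pose c y := b (a y).
have injc : injective c by move=> u v /(inv_inj bK) /(inv_inj aK).
set n := fingraph.order c x; pose z i := iter i c x.
have zn : z n = x by exact: (fingraph.iter_order injc).
have zI i j : i < n -> j < n -> z i = z j -> i = j.
  by move=> lti ltj /(congr1 (findex c x)); rewrite !findex_iter.
have az i : i <= n -> a (z i) = z (n - i).
  elim: i => [_|i IHi lti]; first by rewrite subn0 zn.
  apply: injc; rewrite -[RHS]/(z (n - i.+1).+1) -subSn // subSS -IHi ?(ltnW lti) //.
  by rewrite /c aK /z /= bK.
have bz i : i <= n -> b (z i.+1) = z (n - i) by move=> /az <-; rewrite /z /= bK.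
have bz0 : b (z 0) = z 1 by rewrite /z /= /c ax.
have n_gt0 : 0 < n by exact: fingraph.order_gt0.
have n_gt1 : 1 < n.
  rewrite ltn_neqAle n_gt0 andbT; apply/negP=> /eqP n1.
  by have := nofix x; rewrite ax eqxx; move: zn; rewrite -n1 -bz0 /z /= => ->; rewrite eqxx.
have zE y : connect e x y -> exists2 i, i < n & y = z i.
  move: y; apply: connect_ind; first by exists 0.
  have red i : i <= n -> exists2 j, j < n & z i = z j.
    rewrite leq_eqVlt => /predU1P[->|lti]; last by exists i.
    by exists 0; rewrite ?zn.
  move=> u v [i lti ->] /eab; rewrite !inE => /or3P[] /eqP ->; first by exists i.
    by rewrite az ?(ltnW lti) //; apply: red; rewrite leq_subr.
  case: i lti => [|i] lti; first by rewrite bz0; exists 1.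
  by rewrite bz ?(ltnW (ltnW lti)) //; apply: red; rewrite leq_subr.
have cz i : connect e x (z i).
  elim: i => [|i IHi]; first exact: connect0.
  exact: connect_trans IHi (connect_trans (ea _) (eb _)).
have [h hn] : exists h, n = h + h \/ n.+1 = h + h.
  exists (uphalf n); have := odd_double_half n; rewrite uphalf_half -addnn.
  by case: (odd n) => /= En; [right|left]; move: En; clear; lia.
have h_gt0 : 0 < h by case: (h) hn n_gt1 => [[->|]|].
have h_ltn : h < n by move: hn n_gt1; clear; lia.
have -> : [set y | connect e x y & (a y == y) || (b y == y)] = [set z 0; z h].
  apply/setP=> y; rewrite !inE; apply/andP/orP; last first.
    case=> /eqP ->; rewrite cz; split=> //; first by rewrite /z /= ax eqxx.
    case: hn => hn.
      have nh : n - h = h by move: hn; clear; lia.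
      by rewrite az ?(ltnW h_ltn) // nh eqxx.
    have nh : n - h.-1 = h by move: hn h_gt0 h_ltn; clear; lia.
    have := @bz h.-1; rewrite nh prednK // => -> //; first by rewrite eqxx orbT.
    by move: h_ltn; clear; lia.
  case=> /zE[i lti ->{y}]; case: i lti => [|i] lti; first by left.
  case/orP=> /eqP.
    rewrite az 1?ltnW // => /zI Ei; right; apply/eqP; congr z.
    by move: Ei lti hn; clear; lia.
  rewrite bz; last by move: lti; clear; lia.
  case: i lti => [|i] lti.
    by rewrite subn0 zn => /(zI 0 1 n_gt0 n_gt1).
  move=> /zI Ei; right; apply/eqP; congr z.
  by move: Ei lti hn; clear; lia.
by rewrite cards2; case: eqP => // /(zI _ _ n_gt0 h_ltn) h0; rewrite -h0 in h_gt0.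
Qed.

Definition pairing (T : finType) (P : {set {set T}}) : bool :=
  partition P [set: T] && [forall B in P, #|B| == 2].

Lemma pairing_partner (T : finType) (P : {set {set T}}) : pairing P ->
  exists f : T -> T, [/\ involutive f, forall x, f x != x,
    forall x, [set x; f x] \in P &
    forall B x y, B \in P -> x \in B -> y \in B -> y \in [:: x; f x]].
Proof.
case/andP=> partP /forall_inP card2.
have [/eqP covP triv _] := and3P partP.
have covx x : x \in cover P by rewrite covP inE.
have sz2 x : #|pblock P x| = 2 by apply/eqP/card2; rewrite pblock_mem.
pose f x := odflt x [pick y in pblock P x :\ x].
have fP x : f x != x /\ pblock P x = [set x; f x].
  rewrite /f; case: pickP => [y|no] /=.
    rewrite !inE => /andP[yx yB]; split=> //; apply/esym/eqP.
    rewrite eqEcard sz2 cards2 eq_sym yx andbT.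
    by apply/subsetP=> u; rewrite !inE => /pred2P[] ->; rewrite ?mem_pblock.
  have := cardsD1 x (pblock P x); rewrite sz2 mem_pblock covx.
  by rewrite (eq_card0 no).
have inP x : [set x; f x] \in P by rewrite -(fP x).2 pblock_mem.
have blk B x y : B \in P -> x \in B -> y \in B -> y \in [:: x; f x].
  move=> BP xB; rewrite -(def_pblock triv BP xB) (fP x).2.
  by rewrite !inE.
exists f; split=> // [x|x]; last exact: (fP x).1.
have := blk _ (f x) x (inP x); rewrite !inE !eqxx orbT => /(_ isT isT).
by rewrite eq_sym (negPf (fP x).1) => /eqP/esym.
Qed.

(* The k lower nodes are [inl i], the l upper nodes are [inr j]. *)
Record diagram (k l : nat) := Diagram {
  arcs :> {set {set 'I_k + 'I_l}};
  arcs_pairing : pairing arcs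
}.
HB.instance Definition _ k l := [isSub for @arcs k l].
HB.instance Definition _ k l := [Finite of diagram k l by <:].

(* D1 is placed above D2; the l upper nodes of D2 are identified with the lower
   nodes of D1, so the glued picture has the nodes 'I_k, 'I_l, 'I_p from bottom
   to top. *)
Section Composition.
Variables (k l p : nat) (D1 : diagram l p) (D2 : diagram k l).

Notation glued := ('I_k + 'I_l + 'I_p)%type.

Definition glue_low (u : 'I_k + 'I_l) : glued := inl u.
Definition glue_up (u : 'I_l + 'I_p) : glued :=
  match u with inl j => inl (inr j) | inr q => inr q end.
Definition glue_outer (u : 'I_k + 'I_p) : glued :=
  match u with inl i => inl (inl i) | inr q => inr q end.

Definition glue_adj : rel glued := fun x y =>
  [exists B in D2, (x \in glue_low @: B) && (y \in glue_low @: B)] ||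
  [exists B in D1, (x \in glue_up @: B) && (y \in glue_up @: B)].

Definition comp_arcs : {set {set 'I_k + 'I_p}} :=
  equivalence_partition
    (fun u v => connect glue_adj (glue_outer u) (glue_outer v)) setT.

(* The connected components without outer node are the closed loops. *)
Definition closed_loops : nat :=
  #|[set C in equivalence_partition (connect glue_adj) setT
       | glue_outer @^-1: C == set0]|.

Lemma glue_connect_equiv : equivalence_rel (connect glue_adj).
Proof.
have sym : connect_sym glue_adj.
  move=> x y; have -> : connect glue_adj x y = connect [rel u v | glue_adj v u] x y.
    apply: eq_connect => u v; rewrite /= /glue_adj.
    by congr orb; apply: eq_existsb => B; congr andb; rewrite andbC.
  exact: connect_rev.
by move=> x y z; split=> [|/(same_connect sym)->].
Qed.

Lemma comp_arcs_pairing : pairing comp_arcs.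
Proof.
apply/andP; split.
  by apply/equivalence_partitionP=> u v w _ _ _; apply: glue_connect_equiv.
apply/forall_inP=> _ /imsetP[x _ ->].
have [f2 [f2K f2n f2in f2bl]] := pairing_partner (arcs_pairing D2).
have [f1 [f1K f1n f1in f1bl]] := pairing_partner (arcs_pairing D1).
pose a (u : glued) : glued := match u with inl v => inl (f2 v) | inr _ => u end.
pose b (u : glued) : glued :=
  match u with
  | inl (inl _) => u
  | inl (inr j) => glue_up (f1 (inl j))
  | inr q => glue_up (f1 (inr q))
  end.
have bup v : b (glue_up v) = glue_up (f1 v) by case: v.
have up_inj : injective glue_up by move=> [j|q] [j'|q'] //= [->].
have out_inj : injective glue_outer by move=> [j|q] [j'|q'] //= [->].
have aK : involutive a by case=> [v|q] //=; rewrite f2K.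
have bK : involutive b by case=> [[i|j]|q] //=; rewrite bup f1K.
have eab u v : glue_adj u v -> v \in [:: u; a u; b u].
  case/orP=> /exists_inP[B BD /andP[/imsetP[s sB ->] /imsetP[t tB ->]]].
    have := f2bl _ _ _ BD sB tB; rewrite !inE => /pred2P[] ->;
    by rewrite ?eqxx ?orbT.
  have := f1bl _ _ _ BD sB tB; rewrite !inE bup => /pred2P[] ->;
  by rewrite ?eqxx ?orbT.
have ea u : connect glue_adj u (a u).
  case: u => [v|q] /=; last exact: connect0.
  apply/connect1/orP; left; apply/exists_inP; exists [set v; f2 v] => //.
  by rewrite !imset_f ?inE ?eqxx ?orbT.
have eb u : connect glue_adj u (b u).
  have up v : connect glue_adj (glue_up v) (glue_up (f1 v)).
    apply/connect1/orP; right; apply/exists_inP; exists [set v; f1 v] => //.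
    by rewrite !imset_f ?inE ?eqxx ?orbT.
  by case: u => [[i|j]|q]; [exact: connect0 | exact: (up (inl j)) | exact: (up (inr q))].
have fa u : (a u == u) = (if u is inr _ then true else false).
  case: u => [v|q] /=; last exact: eqxx.
  by apply/negbTE; rewrite (inj_eq inl_inj) f2n.
have fb u : (b u == u) = (if u is inl (inl _) then true else false).
  have up v : (b (glue_up v) == glue_up v) = false.
    by rewrite bup (inj_eq up_inj) (negPf (f1n v)).
  by case: u => [[i|j]|q]; [exact: eqxx | exact: (up (inl j)) | exact: (up (inr q))].
have nofix u : (a u == u) && (b u == u) = false by rewrite fa fb; case: u => [[]|].
pose y := glue_outer x.
rewrite -(card_imset _ out_inj).
have -> : glue_outer @: [set u in setT | connect glue_adj y (glue_outer u)] =
    [set u | connect glue_adj y u & (a u == u) || (b u == u)].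
  apply/setP=> u; rewrite inE fa fb; apply/imsetP/andP.
    by case=> v /[!inE] cv ->; split=> //; case: (v).
  case: u => [[i|j]|q] [cu //] _; [exists (inl i)|exists (inr q)] => //; by rewrite !inE.
have [ay|by_] : a y = y \/ b y = y by rewrite /y; case: (x) => ?; [right|left].
  by apply/eqP; apply: card_fixed_component.
have nofix' u : (b u == u) && (a u == u) = false by rewrite andbC.
have eab' u v : glue_adj u v -> v \in [:: u; b u; a u].
  by move=> /eab; rewrite !inE; case/or3P=> ->; rewrite ?orbT.
rewrite -(card_fixed_component bK aK nofix' eab' eb ea by_).
by apply/eqP/eq_card => u; rewrite !inE orbC.
Qed.

Definition diagram_comp : diagram k p := Diagram comp_arcs_pairing.

End Composition.

Definition tensor_left k l k' l' (u : 'I_k + 'I_l) : 'I_(k + k') + 'I_(l + l') :=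
  match u with inl i => inl (lshift k' i) | inr j => inr (lshift l' j) end.
Definition tensor_right k l k' l' (u : 'I_k' + 'I_l') :
    'I_(k + k') + 'I_(l + l') :=
  match u with inl i => inl (rshift k i) | inr j => inr (rshift l j) end.
Arguments tensor_right k l {k' l'} u.

Definition tensor_arcs k l k' l' (D : diagram k l) (D' : diagram k' l') :
    {set {set 'I_(k + k') + 'I_(l + l')}} :=
  [set tensor_left k' l' @: (B : {set _}) | B in arcs D] :|:
  [set tensor_right k l @: (B : {set _}) | B in arcs D'].

Lemma tensor_arcs_pairing k l k' l' (D : diagram k l) (D' : diagram k' l') :
  pairing (tensor_arcs D D').
Proof.
have lI : injective (@tensor_left k l k' l').
  by move=> [i|j] [i'|j'] //= [/val_inj->].
have rI : injective (@tensor_right k l k' l').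
  by move=> [i|j] [i'|j'] //= [/addnI/val_inj->].
have /andP[pD /forall_inP cD] := arcs_pairing D.
have /andP[pD' /forall_inP cD'] := arcs_pairing D'.
apply/andP; split; last first.
  apply/forall_inP=> _ /setUP[] /imsetP[B BD ->]; rewrite card_imset //.
    exact: cD.
  exact: cD'.
have := imset_partition D setT lI; rewrite pD => /and3P[/eqP cl tl nl].
have := imset_partition D' setT rI; rewrite pD' => /and3P[/eqP cr tr nr].
have lr : tensor_left k' l' @: [set: 'I_k + 'I_l] =
    ~: (tensor_right k l @: [set: 'I_k' + 'I_l']).
  apply/setP=> u; rewrite !inE; apply/imsetP/negP.
    move=> [v _ ->] /imsetP[v' _]; case: v v' => [i|j] [i'|j'] //= [ij].
      by have := ltn_ord i; rewrite ij ltnNge leq_addr.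
    by have := ltn_ord j; rewrite ij ltnNge leq_addr.
  move=> nu; case: u nu => [i|j] nu.
    case: (split_ordP i) nu => v -> nu; first by exists (inl v).
    by case: nu; apply/imsetP; exists (inl v).
  case: (split_ordP j) nu => v -> nu; first by exists (inr v).
  by case: nu; apply/imsetP; exists (inr v).
apply/and3P; split; last by rewrite inE negb_or nl nr.
  by rewrite /cover bigcup_setU -!/(cover _) cl cr lr setUC setUCr.
apply: trivIsetU => //; rewrite cl cr lr disjoints_subset; exact: subxx.
Qed.

Definition diagram_tensor k l k' l' (D : diagram k l) (D' : diagram k' l') :
  diagram (k + k') (l + l') := Diagram (tensor_arcs_pairing D D').

Definition perm_arcs r (s : 'S_r) : {set {set 'I_r + 'I_r}} :=
  [set [set inl i; inr (s i)] | i : 'I_r].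

Lemma perm_arcs_pairing r (s : 'S_r) : pairing (perm_arcs s).
Proof.
apply/andP; split; last first.
  by apply/forall_inP=> _ /imsetP[i _ ->]; rewrite cards2.
have [||/= + _] := @indexed_partition _ _ predT
  (fun i : 'I_r => [set inl i; inr (s i)] : {set 'I_r + 'I_r}).
- move=> i j _ _ nij; rewrite -setI_eq0; apply/eqP/setP=> u; rewrite !inE.
  case: u => u; rewrite ?orbF /= ?(inj_eq inl_inj) ?(inj_eq inr_inj).
    by apply/andP=> -[/eqP-> /eqP ij]; rewrite ij eqxx in nij.
  by apply/andP=> -[/eqP-> /eqP/perm_inj ij]; rewrite ij eqxx in nij.
- by move=> i _; apply/set0Pn; exists (inl i); rewrite !inE eqxx.
rewrite -/(perm_arcs s) (_ : cover _ = setT) //.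
apply/setP=> u; rewrite inE; apply/bigcupP; case: u => i.
  exists [set inl i; inr (s i)]; first by apply/imsetP; exists i.
  by rewrite !inE eqxx.
exists [set inl (s^-1%g i); inr (s (s^-1%g i))].
  by apply/imsetP; exists (s^-1%g i).
by rewrite !inE permKV eqxx orbT.
Qed.

Definition perm_diagram r (s : 'S_r) : diagram r r :=
  Diagram (perm_arcs_pairing s).

Lemma one_arc_pairing k l : k + l = 2 ->
  pairing [set [set: 'I_k + 'I_l]].
Proof.
move=> kl; have c2 : #|[set: 'I_k + 'I_l]| = 2 by rewrite cardsT card_sum !card_ord.
apply/andP; split; last by apply/forall_inP=> B /set1P->; rewrite c2.
rewrite /partition /cover big_set1 eqxx trivIset1 inE eq_sym -cards_eq0.
by rewrite c2.
Qed.

Definition id_diagram r : diagram r r := perm_diagram 1%g.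
Definition cross_diagram : diagram 2 2 := perm_diagram (tperm ord0 ord_max). (* X *)
Definition cap_diagram : diagram 2 0 := Diagram (@one_arc_pairing 2 0 erefl). (* A *)
Definition cup_diagram : diagram 0 2 := Diagram (@one_arc_pairing 0 2 erefl). (* U *)

Local Open Scope ring_scope.

Notation brauer_hom K k l := {ffun diagram k l -> K^o}.

Section BrauerCategory.
Variable K : fieldType.

Definition diag k l (D : diagram k l) : brauer_hom K k l :=
  [ffun D' => (D' == D)%:R].

Definition brauer_comp (delta : K) k l p
    (x : brauer_hom K l p) (y : brauer_hom K k l) : brauer_hom K k p :=
  \sum_(D1 : diagram l p) \sum_(D2 : diagram k l)
    (x D1 * y D2 * delta ^+ closed_loops D1 D2) *: diag (diagram_comp D1 D2).

Definition brauer_tensor k l k' l'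
    (x : brauer_hom K k l) (y : brauer_hom K k' l') :
    brauer_hom K (k + k') (l + l') :=
  \sum_(D : diagram k l) \sum_(D' : diagram k' l')
    (x D * y D') *: diag (diagram_tensor D D').

(* The morphisms obtained from s by composition and tensor product with
   arbitrary morphisms. *)
Inductive generated (delta : K) r (s : brauer_hom K r r) :
    forall k l, brauer_hom K k l -> Prop :=
| gen_self : generated delta s s
| gen_compl k l p (x : brauer_hom K l p) (y : brauer_hom K k l) :
    generated delta s y -> generated delta s (brauer_comp delta x y)
| gen_compr k l p (x : brauer_hom K l p) (y : brauer_hom K k l) :
    generated delta s x -> generated delta s (brauer_comp delta x y)
| gen_tensorl k l k' l' (x : brauer_hom K k l) (y : brauer_hom K k' l') :
    generated delta s y -> generated delta s (brauer_tensor x y)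
| gen_tensorr k l k' l' (x : brauer_hom K k l) (y : brauer_hom K k' l') :
    generated delta s x -> generated delta s (brauer_tensor x y).

(* The span of the generated morphisms in the direct sum of all Hom spaces is
   spanned by homogeneous elements, so its intersection with the (k, l) summand
   is the span of the generated morphisms lying in that summand. *)
Definition in_ideal (delta : K) r (s : brauer_hom K r r) k l
    (x : brauer_hom K k l) : Prop :=
  exists2 S : seq (brauer_hom K k l),
    (forall y, y \in S -> generated delta s y) & x \in <<S>>%VS.

(* Length in the Coxeter group Sym_r, as the number of inversions. *)
Definition perm_length r (s : 'S_r) : nat :=
  #|[set ij : 'I_r * 'I_r | (ij.1 < ij.2)%N && (s ij.2 < s ij.1)%N]|.

Definition Sigma (eps : K) r : brauer_hom K r r :=
  \sum_(s : 'S_r) (- eps) ^+ perm_length s *: diag (perm_diagram s).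

End BrauerCategory.

(* The r-th tensor power of K^m in coordinates: [t w] is the coefficient of
   e_(w 0) (x) ... (x) e_(w (r-1)). *)
Notation tensor_power K m r := {ffun {ffun 'I_r -> 'I_m} -> K^o}.

Section TensorRepresentations.
Variables (K : fieldType) (m : nat).
Notation V := 'rV[K]_m.
Notation T r := (tensor_power K m r).

Definition pure r (v : 'I_r -> V) : T r :=
  [ffun w : {ffun 'I_r -> 'I_m} => \prod_i v i 0 (w i)].

Definition tensor k l (s : T k) (t : T l) : T (k + l) :=
  [ffun w : {ffun 'I_(k + l) -> 'I_m} =>
     s [ffun i => w (lshift l i)] * t [ffun j => w (rshift k j)]].

(* The element 1 of K = V^(x)0. *)
Definition tensor1 : T 0 := pure (fun=> 0).

Definition tensor2 (v v' : V) : T 2 := pure (tnth [tuple v; v']).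

Definition group_act (g : 'End(V)) r (t : T r) : T r :=
  \sum_(w : {ffun 'I_r -> 'I_m}) t w *: pure (fun i => g 'e_(w i)).

Lemma group_act_pure g r (v : 'I_r -> V) :
  group_act g (pure v) = pure (fun i => g (v i)).
Proof.
apply/ffunP=> u; rewrite ffunE sum_ffunE.
have gv i : g (v i) 0 (u i) = \sum_j v i 0 j * g 'e_j 0 (u i).
  rewrite {1}[v i]row_sum_delta linear_sum summxE.
  by apply: eq_bigr => j _; rewrite linearZ mxE.
rewrite (eq_bigr _ (fun i _ => gv i)) bigA_distr_bigA.
by apply: eq_bigr => w _; rewrite [RHS]big_split !ffunE.
Qed.

Variables (sp : bool) (form : {hermitian V for sp & idfun}).

Definition isometry_group (g : 'End(V)) : Prop :=
  lker g == 0%VS /\ isometry form form g.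

Definition equivariant k l (f : 'Hom(T k, T l)) : Prop :=
  forall g, isometry_group g ->
  forall t, f (group_act g t) = group_act g (f t).

(* c_0, for a basis b with dual basis b'. *)
Definition coevaluation (b b' : m.-tuple V) : T 2 :=
  \sum_(i < m) tensor2 (tnth b i) (tnth b' i).

(* [sp = false] is the symmetric case and [sp = true] the skew-symmetric one. *)
Notation eps := ((-1) ^+ sp : K).

(* K-linearity is part of the type of F, whose values are linear maps required
   to be G-equivariant. The equation F(I) = id_V is the case r = 1 of
   [functor_id], and [functor_tensor] says F(x (x) y) = F(x) (x) F(y). *)
Record is_brauer_functor (b b' : m.-tuple V)
    (F : forall k l, {linear brauer_hom K k l -> 'Hom(T k, T l)}) : Prop := {
  functor_equivariant k l (x : brauer_hom K k l) : equivariant (F k l x);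
  functor_id r : F r r (diag K (id_diagram r)) = \1%VF;
  functor_comp k l p (x : brauer_hom K l p) (y : brauer_hom K k l) :
    F k p (brauer_comp (eps * m%:R) x y) = (F l p x \o F k l y)%VF;
  functor_tensor k l k' l' (x : brauer_hom K k l) (y : brauer_hom K k' l') s t :
    F (k + k')%N (l + l')%N (brauer_tensor x y) (tensor s t) =
      tensor (F k l x s) (F k' l' y t);
  functor_cross v v' :
    F 2 2 (diag K cross_diagram) (tensor2 v v') = eps *: tensor2 v' v;
  functor_cup : F 0 2 (diag K cup_diagram) tensor1 = coevaluation b b';
  functor_cap v v' :
    F 2 0 (diag K cap_diagram) (tensor2 v v') = form v v' *: tensor1
}.

End TensorRepresentations.

(* Main.v *)
Require Import Defs.
From HB Require Import structures.
From mathcomp Require Import all_boot all_order all_fingroup all_algebra.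
From mathcomp Require Import zify ring.
Set Implicit Arguments.
Unset Strict Implicit.
Unset Printing Implicit Defensive.
Import GRing.Theory.
Local Open Scope ring_scope.

(** The upper nodes of a diagram can be bent down, so it is enough to study
    diagrams with n lower nodes and no upper ones, that is, fixed-point-free
    involutions of the n nodes (bendK, brauer_comp_bend, brauer_comp_unbend).
    Permuting nodes and juxtaposing caps produces all of them, so the functor
    sends such a diagram to the functional which pairs the two vectors at the
    ends of every arc, up to a sign (functor_matching).

    Fullness (functional_full, functor_full). The form need not be split and K
    is an arbitrary field of characteristic 0; still, Cayley transforms give
    enough isometries to see that an invariant functional phi is killed by the
    Lie algebra of the isometry group (lie_invariance). For the Lie algebra
    elements attached to two vectors this says that the operator

      C phi = n (m - eps) phi + the sum over k <> i of phi o (swap of slots k, i)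

    takes phi to a sum of contractions of phi times the form
    (casimir_functional_contraction), which by induction on n is in the image of
    the functor. It remains to see that C is injective on invariants, for then a
    comparison of dimensions puts phi itself into the image. Now C does not
    depend on the form, and its matrix on words is integral. Over the rational
    numbers and for eps = 1, the quadratic form of C is a sum of squares: the
    sum of the squares of the off-diagonal matrix units of gl_m and of the terms
    c (c - 1) h(w)^2, where c counts the occurrences of a letter in the word w.
    So the kernel consists of antisymmetric functionals; for eps = -1 there is
    an additional 2 n h(w)^2 and the kernel vanishes. These facts are rational
    linear consequences of C h = 0, so they carry over to K
    (integral_consequence). In the symmetric case an antisymmetric invariant
    functional vanishes because reflections change its sign
    (antisymmetric_invariant_eq0).

    Kernel (functor_kernel, functor_inj). The functor maps the signed sum of the
    permutations of m + 1 nodes to an antisymmetrizer, which is 0. Conversely,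
    order the involutions lexicographically, in opposite directions for the two
    signs. Call a diagram good if it has no chain of d + 1 arcs, where a chain
    consists of arcs whose left and right ends both increase (symmetric case) or
    which are nested (skew-symmetric case). Permuting m + 1 nodes of such a chain
    rewrites a diagram modulo the ideal by smaller ones (straightening_step), so
    good diagrams span modulo the ideal. Their images are linearly independent:
    give each node of a good diagram D the depth of its arc in the poset of
    arcs, and in the skew-symmetric case also its side, and put at the nodes the
    corresponding vectors of an orthogonal or symplectic basis. The functional
    of a diagram E does not vanish there only if E joins nodes of matching
    labels, and among these D is the smallest one (label_minimal). A chain of
    d + 1 arcs needs 2 d + 2 nodes, so for at most 2 d nodes all diagrams are
    good and the functor is injective. *)

Lemma linear_sumZ (K : fieldType) (U W : lmodType K) (f : U -> W) : linear f ->
  forall I (r : seq I) (c : I -> K) (x : I -> U),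
  f (\sum_(i <- r) c i *: x i) = \sum_(i <- r) c i *: f (x i).
Proof.
move=> lf I r c x; pose g : {linear U -> W} :=
  HB.pack f (GRing.isLinear.Build K U W *:%R f lf).
rewrite -[f]/(g : U -> W) linear_sum.
by apply: eq_bigr => i _; rewrite linearZ_LR.
Qed.

(** * Diagrams as fixed-point-free involutions *)

Section InvolutionPairing.
Variables (T : finType) (f : T -> T).
Hypotheses (fK : involutive f) (f_neq : forall x, f x != x).

Definition involution_arcs : {set {set T}} := [set [set x; f x] | x : T].

Lemma involution_arcs_pairing : pairing involution_arcs.
Proof.
apply/andP; split; last first.
  by apply/forall_inP=> _ /imsetP[x _ ->]; rewrite cards2 (eq_sym x) f_neq.
have arcE x y : y \in [set x; f x] -> [set y; f y] = [set x; f x].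
  by rewrite !inE => /orP[] /eqP ->; rewrite ?fK // setUC.
apply/and3P; split.
- apply/eqP/setP=> x; rewrite inE; apply/bigcupP.
  by exists [set x; f x]; [apply: imset_f | rewrite !inE eqxx].
- apply/trivIsetP=> _ _ /imsetP[x _ ->] /imsetP[y _ ->] neq.
  rewrite -setI_eq0; apply/eqP/setP=> z; rewrite in_set0; apply/negP=> /setIP[zx zy].
  by rewrite -(arcE _ _ zx) -(arcE _ _ zy) eqxx in neq.
apply/negP=> /imsetP[x _ /setP/(_ x)]; by rewrite !inE eqxx.
Qed.

End InvolutionPairing.

Definition involution_diagram k l (f : 'I_k + 'I_l -> 'I_k + 'I_l)
    (fK : involutive f) (f_neq : forall x, f x != x) : diagram k l :=
  Diagram (involution_arcs_pairing fK f_neq).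

Section Partner.
Variables (k l : nat) (D : diagram k l).

Definition partner (x : 'I_k + 'I_l) : 'I_k + 'I_l :=
  odflt x [pick y | (y != x) && ([set x; y] \in arcs D)].

Lemma partner_spec : exists f : 'I_k + 'I_l -> 'I_k + 'I_l,
  [/\ involutive f, forall x, f x != x, partner =1 f &
      arcs D = involution_arcs f].
Proof.
have [f [fK f_neq f_arc f_blk]] := pairing_partner (arcs_pairing D).
have pf : partner =1 f.
  move=> x; rewrite /partner; case: pickP => [y /andP[yx yD]|no] /=.
    have := f_blk _ x y yD; rewrite !inE !eqxx orbT => /(_ isT isT).
    by rewrite (negPf yx) => /eqP.
  by have := no (f x); rewrite f_neq f_arc.
exists f; split=> //; apply/setP=> B; apply/idP/imsetP=> [BD|[x _ ->]] //.
have /andP[_ /forall_inP/(_ _ BD)/eqP cB] := arcs_pairing D.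
have /card_gt0P[x xB] : (0 < #|B|)%N by rewrite cB.
exists x => //; apply/eqP; rewrite eqEcard cB cards2 (eq_sym x) f_neq andbT.
by apply/subsetP=> y /(f_blk _ _ _ BD xB); rewrite !inE.
Qed.

Lemma partnerK : involutive partner.
Proof. by have [f [fK _ pf _]] := partner_spec; move=> x; rewrite !pf fK. Qed.

Lemma partner_neq x : partner x != x.
Proof. by have [f [_ fn pf _]] := partner_spec; rewrite pf fn. Qed.

Lemma partner_arc x : [set x; partner x] \in arcs D.
Proof. by have [f [_ _ pf ->]] := partner_spec; rewrite pf; apply: imset_f. Qed.

Lemma arcs_partner : arcs D = involution_arcs partner.
Proof.
have [f [_ _ pf ->]] := partner_spec.
by apply: eq_imset => x; rewrite pf.
Qed.

Lemma partnerP x y : [set x; y] \in arcs D -> y != x -> partner x = y.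
Proof.
rewrite arcs_partner => /imsetP[z _ E] yx.
have : x \in [set z; partner z] by rewrite -E !inE eqxx.
have : y \in [set z; partner z] by rewrite -E !inE eqxx orbT.
rewrite !inE => /orP[] /eqP yz /orP[] /eqP xz; subst => //.
- by rewrite eqxx in yx.
- by rewrite partnerK.
- by rewrite eqxx in yx.
Qed.

End Partner.

Lemma diagram_eq k l (D D' : diagram k l) : partner D =1 partner D' -> D = D'.
Proof.
move=> E; apply: val_inj; rewrite /= !arcs_partner.
by apply: eq_imset => x; rewrite E.
Qed.

Lemma partner_involution_diagram k l (f : 'I_k + 'I_l -> 'I_k + 'I_l)
    (fK : involutive f) (f_neq : forall x, f x != x) :
  partner (involution_diagram fK f_neq) =1 f.
Proof. by move=> x; apply: partnerP => //; apply: imset_f. Qed.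

Section Relabel.
Variables (k l k' l' : nat) (D : diagram k l).
Variables (h : 'I_k' + 'I_l' -> 'I_k + 'I_l) (g : 'I_k + 'I_l -> 'I_k' + 'I_l').
Hypotheses (hK : cancel h g) (gK : cancel g h).

Definition relabel_partner x := g (partner D (h x)).

Lemma relabel_partnerK : involutive relabel_partner.
Proof. by move=> x; rewrite /relabel_partner gK partnerK hK. Qed.

Lemma relabel_partner_neq x : relabel_partner x != x.
Proof. by rewrite -{2}[x]hK (can_eq gK) partner_neq. Qed.

Definition relabel : diagram k' l' :=
  involution_diagram relabel_partnerK relabel_partner_neq.

Lemma partner_relabel x : partner relabel x = g (partner D (h x)).
Proof. exact: partner_involution_diagram. Qed.

End Relabel.

Lemma partner_tensor_left k l k' l' (D : diagram k l) (D' : diagram k' l') x :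
  partner (diagram_tensor D D') (tensor_left k' l' x) =
    tensor_left k' l' (partner D x).
Proof.
have lI : injective (@tensor_left k l k' l').
  by move=> [i|j] [i'|j'] //= [/val_inj->].
apply: partnerP; last by rewrite (inj_eq lI) partner_neq.
rewrite inE; apply/orP; left; apply/imsetP.
by exists [set x; partner D x]; rewrite ?partner_arc // imsetU1 imset_set1.
Qed.

Lemma partner_tensor_right k l k' l' (D : diagram k l) (D' : diagram k' l') x :
  partner (diagram_tensor D D') (tensor_right k l x) =
    tensor_right k l (partner D' x).
Proof.
have rI : injective (@tensor_right k l k' l').
  by move=> [i|j] [i'|j'] //= [/addnI/val_inj->].
apply: partnerP; last by rewrite (inj_eq rI) partner_neq.
rewrite inE; apply/orP; right; apply/imsetP.
by exists [set x; partner D' x]; rewrite ?partner_arc // imsetU1 imset_set1.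
Qed.

Lemma partner_perm_low r (s : 'S_r) i : partner (perm_diagram s) (inl i) = inr (s i).
Proof. by apply: partnerP => //; apply: imset_f. Qed.

Lemma partner_perm_up r (s : 'S_r) i :
  partner (perm_diagram s) (inr (s i)) = inl i.
Proof. by rewrite -partner_perm_low partnerK. Qed.

(** * Composition of diagrams by connectivity *)

Section ComposeByConnectivity.
Variables (k l p : nat) (D1 : diagram l p) (D2 : diagram k l).
Notation adj := (glue_adj D1 D2).
Notation conn := (connect adj).

Lemma conn_sym x y : conn x y = conn y x.
Proof.
have E := glue_connect_equiv D1 D2.
apply/idP/idP=> H; first by rewrite -(E x y x).2 // connect0.
by rewrite -(E y x y).2 // connect0.
Qed.

Lemma conn_low u : conn (glue_low p u) (glue_low p (partner D2 u)).
Proof.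
apply/connect1/orP; left; apply/exists_inP.
by exists [set u; partner D2 u]; rewrite ?partner_arc // !imset_f // !inE eqxx ?orbT.
Qed.

Lemma conn_up u : conn (glue_up k u) (glue_up k (partner D1 u)).
Proof.
apply/connect1/orP; right; apply/exists_inP.
by exists [set u; partner D1 u]; rewrite ?partner_arc // !imset_f // !inE eqxx ?orbT.
Qed.

(** The blocks of the composite have two elements, so one connection per node
    determines them and nothing has to be shown to be disconnected. *)
Lemma diagram_comp_eq (D : diagram k p) :
  (forall u, conn (glue_outer l u) (glue_outer l (partner D u))) ->
  diagram_comp D1 D2 = D.
Proof.
move=> cD; apply: diagram_eq => x.
set C := diagram_comp D1 D2.
have : [set x; partner C x] \in comp_arcs D1 D2 by exact: partner_arc C x.
have /andP[/and3P[_ triv _] _] := comp_arcs_pairing D1 D2.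
pose B := [set v in setT | conn (glue_outer l x) (glue_outer l v)].
have BC : B \in comp_arcs D1 D2 by apply/imsetP; exists x.
move=> AC.
have BE : B = [set x; partner C x].
  rewrite -(def_pblock triv BC (_ : x \in B)); last by rewrite !inE connect0.
  by rewrite -(def_pblock triv AC (_ : x \in _)) // !inE eqxx.
have : partner D x \in B by rewrite !inE cD.
by rewrite BE !inE (negPf (partner_neq _ _)) => /eqP.
Qed.

Lemma closed_loops_eq0 :
  (forall j : 'I_l, exists u, conn (inl (inr j)) (glue_outer l u)) ->
  closed_loops D1 D2 = 0%N.
Proof.
move=> H; apply/eqP; rewrite cards_eq0; apply/eqP/setP=> C; rewrite !inE.
apply/negP=> /andP[/imsetP[x _ ->] /eqP/setP E].
have [u xu] : exists u, conn x (glue_outer l u).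
  case: x {E} => [[i|j]|q]; first by exists (inl i); apply: connect0.
    exact: H.
  by exists (inr q); apply: connect0.
by have := E u; rewrite !inE xu.
Qed.

End ComposeByConnectivity.

Section BrauerBilinear.
Variables (K : fieldType) (delta : K).
Notation hom k l := {ffun diagram k l -> K^o}.

Lemma hom_diag_sum k l (x : hom k l) : x = \sum_D x D *: diag K D.
Proof.
apply/ffunP=> D; rewrite sum_ffunE (bigD1 D) //= big1 => [|D' /negPf DD'].
  by rewrite !ffunE eqxx addr0 [RHS]mulr1.
by rewrite !ffunE eq_sym DD' scaler0.
Qed.

Lemma diag_self k l (D : diagram k l) : diag K D D = 1.
Proof. by rewrite ffunE eqxx. Qed.

Lemma diag_other k l (D D' : diagram k l) : D' != D -> diag K D D' = 0.
Proof. by rewrite ffunE => /negPf ->. Qed.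

Lemma diag_neq0 k l (D E : diagram k l) : diag K D E != 0 -> E = D.
Proof. by move=> ne; apply/eqP; apply: contraNT ne => /diag_other ->. Qed.

Lemma brauer_comp_diag k l p (D1 : diagram l p) (D2 : diagram k l) :
  brauer_comp delta (diag K D1) (diag K D2) =
    delta ^+ closed_loops D1 D2 *: diag K (diagram_comp D1 D2).
Proof.
rewrite /brauer_comp (bigD1 D1) //= [X in _ + X]big1 => [|D D1D]; last first.
  by rewrite big1 // => D' _; rewrite diag_other // !mul0r scale0r.
rewrite addr0 (bigD1 D2) //= [X in _ + X]big1 => [|D D2D]; last first.
  by rewrite (diag_other D2D) mulr0 mul0r scale0r.
by rewrite addr0 !diag_self !mul1r.
Qed.

Lemma brauer_tensor_diag k l k' l' (D : diagram k l) (D' : diagram k' l') :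
  brauer_tensor (diag K D) (diag K D') = diag K (diagram_tensor D D').
Proof.
rewrite /brauer_tensor (bigD1 D) //= [X in _ + X]big1 => [|D1 D1D]; last first.
  by rewrite big1 // => D2 _; rewrite diag_other // !mul0r scale0r.
rewrite addr0 (bigD1 D') //= [X in _ + X]big1 => [|D1 D1D]; last first.
  by rewrite (diag_other D1D) mulr0 scale0r.
by rewrite addr0 !diag_self !mul1r scale1r.
Qed.

Lemma brauer_comp_linearl k l p (y : hom k l) :
  linear (fun x : hom l p => brauer_comp delta x y).
Proof.
move=> a x x'; rewrite /brauer_comp scaler_sumr -big_split /=.
apply: eq_bigr => D1 _; rewrite scaler_sumr -big_split /=.
apply: eq_bigr => D2 _; rewrite scalerA -scalerDl; congr (_ *: _).
by rewrite !ffunE /= !mulrDl !mulrA.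
Qed.

Lemma brauer_comp_linearr k l p (x : hom l p) :
  linear (fun y : hom k l => brauer_comp delta x y).
Proof.
move=> a y y'; rewrite /brauer_comp scaler_sumr -big_split /=.
apply: eq_bigr => D1 _; rewrite scaler_sumr -big_split /=.
apply: eq_bigr => D2 _; rewrite scalerA -scalerDl; congr (_ *: _).
rewrite !ffunE /= mulrDr mulrDl; congr (_ + _).
by rewrite -[_ *: _]/(a * y D2) !mulrA (mulrC (x D1)).
Qed.

Lemma brauer_tensor_linearl k l k' l' (y : hom k' l') :
  linear (fun x : hom k l => brauer_tensor x y).
Proof.
move=> a x x'; rewrite /brauer_tensor scaler_sumr -big_split /=.
apply: eq_bigr => D1 _; rewrite scaler_sumr -big_split /=.
apply: eq_bigr => D2 _; rewrite scalerA -scalerDl; congr (_ *: _).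
by rewrite !ffunE /= !mulrDl !mulrA.
Qed.

Lemma brauer_comp_diag_eq k l p (D1 : diagram l p) (D2 : diagram k l) D :
  (forall u, connect (glue_adj D1 D2) (glue_outer l u) (glue_outer l (partner D u))) ->
  (forall j : 'I_l, exists u, connect (glue_adj D1 D2) (inl (inr j)) (glue_outer l u)) ->
  brauer_comp delta (diag K D1) (diag K D2) = diag K D.
Proof.
move=> cD noloop; rewrite brauer_comp_diag (diagram_comp_eq cD).
by rewrite (closed_loops_eq0 noloop) expr0 scale1r.
Qed.

End BrauerBilinear.

Section Precompose.
Variables (n p : nat).

Definition low_map (s : 'S_n) (x : 'I_n + 'I_p) : 'I_n + 'I_p :=
  match x with inl i => inl (s i) | inr j => inr j end.

Lemma low_mapK s : cancel (low_map s) (low_map s^-1).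
Proof. by case=> i //=; rewrite permK. Qed.

Lemma low_mapVK s : cancel (low_map s^-1) (low_map s).
Proof. by case=> i //=; rewrite permKV. Qed.

Definition precompose (D : diagram n p) (s : 'S_n) : diagram n p :=
  relabel D (low_mapK s) (low_mapVK s).

Lemma precomposeM D s t : precompose (precompose D s) t = precompose D (t * s).
Proof.
apply: diagram_eq => x; rewrite !partner_relabel.
have -> y : low_map (t * s) y = low_map s (low_map t y).
  by case: y => i //=; rewrite permM.
by case: (partner D _) => i //=; rewrite invMg permM.
Qed.

Lemma precompose1 D : precompose D 1 = D.
Proof.
apply: diagram_eq => x; rewrite !partner_relabel invg1.
have E y : low_map 1 y = y by case: y => i //=; rewrite perm1.
by rewrite !E.
Qed.

End Precompose.

Section BrauerPermutations.
Variables (K : fieldType) (delta : K).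

Lemma brauer_comp_perm n p (D : diagram n p) (s : 'S_n) :
  brauer_comp delta (diag K D) (diag K (perm_diagram s)) = diag K (precompose D s).
Proof.
have strand i : connect (glue_adj D (perm_diagram s))
    (inl (inl i)) (glue_up n (inl (s i) : _ + 'I_p)).
  by have := conn_low D (perm_diagram s) (inl i); rewrite partner_perm_low.
have via u : connect (glue_adj D (perm_diagram s))
    (glue_outer n u) (glue_up n (low_map s u)).
  by case: u => i /=; [apply: strand | apply: connect0].
apply: brauer_comp_diag_eq => [u|j]; last first.
  by exists (inl (s^-1%g j)); rewrite conn_sym -{2}[j](permKV s); apply: strand.
apply: connect_trans (via u) _; rewrite partner_relabel conn_sym.
apply: connect_trans (via _) _; rewrite low_mapVK conn_sym; exact: conn_up.
Qed.

Lemma precompose_perm r (s t : 'S_r) :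
  precompose (perm_diagram s) t = perm_diagram (t * s).
Proof.
apply: diagram_eq => -[i|i]; rewrite partner_relabel /=.
  by rewrite !partner_perm_low /= permM.
rewrite -[i](permKV (t * s)) partner_perm_up.
by rewrite permM partner_perm_up /= permK.
Qed.

Lemma brauer_comp_perms r (s t : 'S_r) :
  brauer_comp delta (diag K (perm_diagram s)) (diag K (perm_diagram t)) =
    diag K (perm_diagram (t * s)).
Proof. by rewrite brauer_comp_perm precompose_perm. Qed.

End BrauerPermutations.

(** * Juxtaposition of permutations *)

Lemma split_lshift m n (i : 'I_m) : split (lshift n i) = inl i.
Proof. exact: (unsplitK (inl i)). Qed.

Lemma split_rshift m n (i : 'I_n) : split (rshift m i) = inr i.
Proof. exact: (unsplitK (inr i)). Qed.

Section PermSum.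
Variables (k l : nat) (s : 'S_k) (t : 'S_l).

Definition perm_sum_fun (x : 'I_(k + l)) : 'I_(k + l) :=
  match split x with inl i => lshift l (s i) | inr j => rshift k (t j) end.

Lemma perm_sum_fun_inj : injective perm_sum_fun.
Proof.
move=> x y; rewrite /perm_sum_fun.
case: (split_ordP x) => i ->; case: (split_ordP y) => j ->.
- by move/lshift_inj/perm_inj->.
- by move/eqP; rewrite eq_lrshift.
- by move/eqP; rewrite eq_rlshift.
- by move/rshift_inj/perm_inj->.
Qed.

Definition perm_sum : 'S_(k + l) := perm perm_sum_fun_inj.

Lemma perm_sum_lshift i : perm_sum (lshift l i) = lshift l (s i).
Proof. by rewrite permE /perm_sum_fun split_lshift. Qed.

Lemma perm_sum_rshift i : perm_sum (rshift k i) = rshift k (t i).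
Proof. by rewrite permE /perm_sum_fun split_rshift. Qed.

Lemma diagram_tensor_perm :
  diagram_tensor (perm_diagram s) (perm_diagram t) = perm_diagram perm_sum.
Proof.
have low i : partner (diagram_tensor (perm_diagram s) (perm_diagram t)) (inl i) =
    inr (perm_sum i).
  case: (split_ordP i) => j ->.
    by rewrite (partner_tensor_left _ _ (inl j)) partner_perm_low perm_sum_lshift.
  by rewrite (partner_tensor_right _ _ (inl j)) partner_perm_low perm_sum_rshift.
apply: diagram_eq => -[i|i]; first by rewrite low partner_perm_low.
by rewrite -[i](permKV perm_sum) partner_perm_up -low partnerK.
Qed.

End PermSum.

(** * Diagrams without upper nodes *)

Section Mate.
Variable n : nat.

Definition mate (D : diagram n 0) (i : 'I_n) : 'I_n :=
  if partner D (inl i) is inl j then j else i.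

Lemma partner_mate D i : partner D (inl i) = inl (mate D i).
Proof. by rewrite /mate; case: (partner D _) => // -[]. Qed.

Lemma mateK D : involutive (mate D).
Proof.
by move=> i; apply: (@inl_inj _ 'I_0); rewrite -!partner_mate partnerK.
Qed.

Lemma mate_neq D i : mate D i != i.
Proof. by rewrite -(inj_eq (@inl_inj _ 'I_0)) -partner_mate partner_neq. Qed.

Lemma mate_inj D D' : mate D =1 mate D' -> D = D'.
Proof.
by move=> E; apply: diagram_eq => -[i|[]//]; rewrite !partner_mate E.
Qed.

Section OfMate.
Variable f : 'I_n -> 'I_n.
Hypotheses (fK : involutive f) (f_neq : forall i, f i != i).

Definition mate_partner (x : 'I_n + 'I_0) : 'I_n + 'I_0 :=
  if x is inl i then inl (f i) else x.

Lemma mate_partnerK : involutive mate_partner.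
Proof. by case=> i //=; rewrite fK. Qed.

Lemma mate_partner_neq x : mate_partner x != x.
Proof. by case: x => [i|[]//] /=; rewrite (inj_eq inl_inj) f_neq. Qed.

Definition mate_diagram : diagram n 0 :=
  involution_diagram mate_partnerK mate_partner_neq.

Lemma mate_mate_diagram : mate mate_diagram =1 f.
Proof.
move=> i; apply: (@inl_inj _ 'I_0).
by rewrite -partner_mate partner_involution_diagram.
Qed.

End OfMate.

Lemma mate_precompose D (s : 'S_n) i :
  mate (precompose D s) i = s^-1%g (mate D (s i)).
Proof.
apply: (@inl_inj _ 'I_0); rewrite -partner_mate partner_relabel /=.
by rewrite partner_mate.
Qed.

End Mate.

Lemma mate_cap (i : 'I_2) : mate cap_diagram i = rev_ord i.
Proof.
have : mate cap_diagram i != i by exact: mate_neq.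
rewrite -!val_eqE /=; move: (mate _ _) => j.
case: i j => [[|[|i]] //= ?] [[|[|j]] //= ?] _; exact: val_inj.
Qed.

Lemma mate_tensor_lshift k l (D : diagram k 0) (D' : diagram l 0) i :
  mate (diagram_tensor D D' : diagram (k + l) 0) (lshift l i) = lshift l (mate D i).
Proof.
apply: (@inl_inj _ 'I_0); rewrite -partner_mate.
by have := partner_tensor_left D D' (inl i); rewrite (partner_mate D).
Qed.

Lemma mate_tensor_rshift k l (D : diagram k 0) (D' : diagram l 0) i :
  mate (diagram_tensor D D' : diagram (k + l) 0) (rshift k i) = rshift k (mate D' i).
Proof.
apply: (@inl_inj _ 'I_0); rewrite -partner_mate.
by have := partner_tensor_right D D' (inl i); rewrite (partner_mate D').
Qed.

(** * Bending upper nodes down *)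

Definition fold_ord l (i : 'I_(l + l)) : 'I_(l + l) :=
  match split i with inl j => rshift l j | inr j => lshift l j end.

Lemma fold_ordK l : involutive (@fold_ord l).
Proof.
move=> i; rewrite /fold_ord; case: (split_ordP i) => j ->.
  by rewrite split_rshift.
by rewrite split_lshift.
Qed.

Lemma fold_ord_neq l (i : 'I_(l + l)) : fold_ord i != i.
Proof.
rewrite /fold_ord; case: (split_ordP i) => j ->; first by rewrite eq_rlshift.
by rewrite eq_lrshift.
Qed.

Definition caps l : diagram (l + l) 0 := mate_diagram (@fold_ordK l) (@fold_ord_neq l).

Lemma mate_caps_lshift l (i : 'I_l) : mate (caps l) (lshift l i) = rshift l i.
Proof. by rewrite mate_mate_diagram /fold_ord split_lshift. Qed.

Definition ord0_absurd T (i : 'I_0) : T.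
Proof. by case: i. Defined.

Section Bend.
Variables k l : nat.

Definition bend_node (x : 'I_k + 'I_l) : 'I_(k + l) + 'I_0 := inl (unsplit x).
Definition unbend_node (x : 'I_(k + l) + 'I_0) : 'I_k + 'I_l :=
  match x with inl i => split i | inr j => ord0_absurd _ j end.

Lemma bend_nodeK : cancel bend_node unbend_node.
Proof. exact: unsplitK. Qed.

Lemma unbend_nodeK : cancel unbend_node bend_node.
Proof. by case=> [i|[]//]; rewrite /bend_node splitK. Qed.

Definition bend (D : diagram k l) : diagram (k + l) 0 :=
  relabel D unbend_nodeK bend_nodeK.
Definition unbend (D : diagram (k + l) 0) : diagram k l :=
  relabel D bend_nodeK unbend_nodeK.

Lemma bendK : cancel bend unbend.
Proof.
by move=> D; apply: diagram_eq => x; rewrite !partner_relabel !bend_nodeK.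
Qed.

Lemma unbendK : cancel unbend bend.
Proof.
by move=> D; apply: diagram_eq => x; rewrite !partner_relabel !unbend_nodeK.
Qed.

(** The node map of k through strands next to l interleaved cups, the second
    half of the zigzag which undoes bending. *)
Definition straighten_node (x : 'I_k + 'I_(k + l + l)) : 'I_k + 'I_(k + l + l) :=
  match x with
  | inl i => inr (lshift l (lshift l i))
  | inr q =>
    match split q with
    | inl q' =>
      match split q' with
      | inl i => inl i
      | inr j => inr (rshift (k + l) j)
      end
    | inr j => inr (lshift l (rshift k j))
    end
  end.

Lemma straighten_nodeK : involutive straighten_node.
Proof.
case=> [i|q] /=; first by rewrite !split_lshift.
case: (split_ordP q) => q' ->; last by rewrite /= split_lshift split_rshift.
case: (split_ordP q') => j -> //=; by rewrite split_rshift.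
Qed.

Lemma straighten_node_neq x : straighten_node x != x.
Proof.
case: x => [i|q] //=.
case: (split_ordP q) => q' ->; last by rewrite (inj_eq inr_inj) eq_lrshift.
by case: (split_ordP q') => j -> //=; rewrite (inj_eq inr_inj) eq_rlshift.
Qed.

Definition straighten : diagram k (k + l + l) :=
  involution_diagram straighten_nodeK straighten_node_neq.

Lemma partner_straighten x : partner straighten x = straighten_node x.
Proof. exact: partner_involution_diagram. Qed.

Variables (K : fieldType) (delta : K).
Notation hom k l := {ffun diagram k l -> K^o}.

(** An upper node j of D runs through its strand and its cap to the new lower
    node k + j. *)
Lemma brauer_comp_bend (D : diagram k l) :
  brauer_comp delta (diag K (caps l))
    (brauer_tensor (diag K D) (diag K (id_diagram l))) = diag K (bend D).
Proof.
rewrite brauer_tensor_diag; set D' := diagram_tensor _ _.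
pose c := connect (glue_adj (caps l) D').
have zag j : c (inl (inl (rshift k j))) (inl (inr (lshift l j))).
  have := conn_low (caps l) D' (inl (rshift k j)).
  rewrite (partner_tensor_right _ _ (inl j)) partner_perm_low perm1 /=.
  move/connect_trans; apply; rewrite conn_sym.
  by have := conn_up (caps l) D' (inl (lshift l j)); rewrite partner_mate mate_caps_lshift.
have via x : c (glue_outer (l + l) (bend_node x)) (glue_low 0 (tensor_left l l x)).
  by case: x => [i|j]; [exact: connect0 | exact: zag].
apply: brauer_comp_diag_eq => [u|j].
  rewrite partner_relabel -{1}[u]unbend_nodeK; apply: connect_trans (via _) _.
  rewrite conn_sym; apply: connect_trans (via _) _.
  by rewrite -(partner_tensor_left _ (id_diagram l)) conn_sym; apply: conn_low.
case: (split_ordP j) => i ->.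
  by exists (bend_node (inr i)); rewrite conn_sym; apply: (via (inr i)).
exists (bend_node (inr i)).
have := conn_up (caps l) D' (inl (lshift l i)).
rewrite partner_mate mate_caps_lshift conn_sym => /connect_trans; apply.
by rewrite conn_sym; apply: (via (inr i)).
Qed.

Lemma brauer_comp_unbend (D : diagram (k + l) 0) :
  brauer_comp delta (brauer_tensor (diag K D) (diag K (id_diagram l)) : hom _ l)
    (diag K straighten) = diag K (unbend D).
Proof.
rewrite brauer_tensor_diag.
set D' : diagram (k + l + l) l := diagram_tensor D (id_diagram l).
pose c := connect (glue_adj D' straighten).
have zig j : c (inr j) (inl (inr (rshift (k + l) j))).
  have := conn_up D' straighten (inl (rshift (k + l) j)).
  have := partner_tensor_right D (id_diagram l) (inl j).
  rewrite partner_perm_low perm1 /= => ->; rewrite conn_sym.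
  by rewrite /c; congr (connect _ _ _); congr inr; apply: val_inj.
have via x : c (glue_outer (k + l + l) x) (inl (inr (lshift l (unsplit x)))).
  case: x => [i|j] /=.
    by have := conn_low D' straighten (inl i); rewrite partner_straighten.
  apply: connect_trans (zig j) _.
  have := conn_low D' straighten (inr (rshift (k + l) j)).
  by rewrite partner_straighten /= split_rshift.
apply: brauer_comp_diag_eq => [u|j].
  rewrite partner_relabel; apply: connect_trans (via _) _.
  rewrite conn_sym; apply: connect_trans (via _) _.
  have := conn_up D' straighten (inl (lshift l (unsplit u))).
  have := partner_tensor_left D (id_diagram l) (inl (unsplit u)).
  rewrite partner_mate /= => ->; rewrite splitK conn_sym.
  by [].
case: (split_ordP j) => i ->.
  by exists (split i); rewrite conn_sym -{2}[i]splitK; apply: (via (split i)).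
by exists (inr i); rewrite conn_sym; apply: zig.
Qed.

End Bend.

(** Moving the two ends of one arc to the first two nodes splits off a cap. *)
Lemma diagram_cap_decomposition n (D : diagram (2 + n) 0) :
  exists (D' : diagram n 0) (s : 'S_(2 + n)),
    D = precompose (diagram_tensor cap_diagram D' : diagram (2 + n) 0) s.
Proof.
pose x0 : 'I_(2 + n) := lshift n ord0; pose x1 : 'I_(2 + n) := lshift n ord_max.
pose t := tperm x1 (mate D x0); pose E := precompose D t.
have t0 : t x0 = x0 by rewrite tpermD // ?mate_neq // -val_eqE.
have E0 : mate E x0 = x1 by rewrite mate_precompose t0 tpermV tpermR.
have E1 : mate E x1 = x0 by rewrite -E0 mateK.
have Er i : exists j, mate E (rshift 2 i) = rshift 2 j.
  case: (split_ordP (mate E (rshift 2 i))) => j Ej; last by exists j.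
  have : mate E (lshift n j) = rshift 2 i by rewrite -Ej mateK.
  have [->|->] : j = ord0 \/ j = ord_max.
  - by case: j {Ej} => [[|[|j]] lt] //; [left | right]; apply: val_inj.
  - by rewrite -/x0 E0 => /eqP; rewrite eq_lrshift.
  by rewrite -/x1 E1 => /eqP; rewrite eq_lrshift.
pose f i := if split (mate E (rshift 2 i)) is inr j then j else i.
have Ef i : mate E (rshift 2 i) = rshift 2 (f i).
  by rewrite /f; have [j ->] := Er i; rewrite split_rshift.
have fK : involutive f by move=> i; apply: (@rshift_inj 2); rewrite -!Ef mateK.
have f_neq i : f i != i.
  by apply/eqP=> fi; have := mate_neq E (rshift 2 i); rewrite Ef fi eqxx.
exists (mate_diagram fK f_neq), t^-1%g.
suff <- : E = diagram_tensor cap_diagram (mate_diagram fK f_neq).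
  by rewrite precomposeM mulVg precompose1.
apply: mate_inj => i; case: (split_ordP i) => j ->.
  rewrite mate_tensor_lshift mate_cap.
  have [->|->] : j = ord0 \/ j = ord_max.
  - by case: j => [[|[|j]] lt] //; [left | right]; apply: val_inj.
  - by rewrite -/x0 E0; congr lshift; apply: val_inj.
  by rewrite -/x1 E1; congr lshift; apply: val_inj.
by rewrite mate_tensor_rshift mate_mate_diagram Ef.
Qed.

Section BendHom.
Variables (K : fieldType) (delta : K).

Definition bend_hom k l (x : brauer_hom K k l) : brauer_hom K (k + l) 0 :=
  brauer_comp delta (diag K (caps l)) (brauer_tensor x (diag K (id_diagram l))).

Definition unbend_hom k l (y : brauer_hom K (k + l) 0) : brauer_hom K k l :=
  brauer_comp delta (brauer_tensor y (diag K (id_diagram l)) : brauer_hom K _ l)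
    (diag K (straighten k l)).

Lemma bend_hom_sum k l (x : brauer_hom K k l) :
  bend_hom x = \sum_D x D *: diag K (bend D).
Proof.
rewrite {1}[x]hom_diag_sum /bend_hom (linear_sumZ (brauer_tensor_linearl _)).
rewrite (linear_sumZ (brauer_comp_linearr _ _)).
by apply: eq_bigr => D _; rewrite brauer_comp_bend.
Qed.

Lemma unbend_hom_sum k l (y : brauer_hom K (k + l) 0) :
  unbend_hom y = \sum_D y D *: diag K (unbend D).
Proof.
rewrite {1}[y]hom_diag_sum /unbend_hom (linear_sumZ (brauer_tensor_linearl _)).
rewrite (linear_sumZ (@brauer_comp_linearl _ _ _ _ _ _)).
by apply: eq_bigr => D _; rewrite brauer_comp_unbend.
Qed.

Lemma unbend_hom_linear k l : linear (@unbend_hom k l).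
Proof.
move=> a x y; rewrite !unbend_hom_sum scaler_sumr -big_split /=.
by apply: eq_bigr => D _; rewrite !ffunE scalerDl scalerA.
Qed.

Lemma bend_hom_linear k l : linear (@bend_hom k l).
Proof.
move=> a x y; rewrite !bend_hom_sum scaler_sumr -big_split /=.
by apply: eq_bigr => D _; rewrite !ffunE scalerDl scalerA.
Qed.

Lemma unbend_hom_diag k l D : unbend_hom (diag K D) = diag K (@unbend k l D).
Proof. exact: brauer_comp_unbend. Qed.

Lemma bend_hom_diag k l D : bend_hom (diag K D) = diag K (@bend k l D).
Proof. exact: brauer_comp_bend. Qed.

Lemma bend_homK k l : cancel (@bend_hom k l) (@unbend_hom k l).
Proof.
move=> x; rewrite bend_hom_sum (linear_sumZ (@unbend_hom_linear _ _)) [RHS]hom_diag_sum.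
by apply: eq_bigr => D _; rewrite unbend_hom_diag bendK.
Qed.

Lemma unbend_homK k l : cancel (@unbend_hom k l) (@bend_hom k l).
Proof.
move=> x; rewrite unbend_hom_sum (linear_sumZ (@bend_hom_linear _ _)) [RHS]hom_diag_sum.
by apply: eq_bigr => D _; rewrite bend_hom_diag unbendK.
Qed.

End BendHom.

(** * The lexicographic order on matchings *)

(** Left and right ends of arcs are compared in opposite directions for the two
    symmetry types, so that straightening always leads to smaller diagrams. *)
Definition cmp (sp : bool) (a b : nat) : bool := if sp then (a < b)%N else (b < a)%N.

Lemma cmp_trans sp : transitive (cmp sp).
Proof. by rewrite /cmp => b a c; case: sp; lia. Qed.

Lemma cmp_irr sp a : cmp sp a a = false.
Proof. by rewrite /cmp ltnn if_same. Qed.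

Section Lex.
Variables (n : nat) (sp : bool).
Implicit Types f g : 'I_n -> 'I_n.

Definition lexlt f g : bool :=
  [exists x : 'I_n, [forall (y : 'I_n | (y < x)%N), f y == g y] && cmp sp (f x) (g x)].

Lemma lexltP f g :
  reflect (exists2 x : 'I_n, forall y : 'I_n, (y < x)%N -> f y = g y &
             cmp sp (f x) (g x)) (lexlt f g).
Proof.
apply: (iffP existsP) => -[x].
  by case/andP=> /forall_inP E c; exists x => // y /E /eqP.
by move=> E c; exists x; rewrite c andbT; apply/forall_inP=> y /E ->.
Qed.

Lemma lexlt_trans : transitive lexlt.
Proof.
move=> g f h /lexltP[x Ex cx] /lexltP[y Ey cy]; apply/lexltP.
case: (ltngtP x y) => [xy|yx|/val_inj xy].
- by exists x => [z zx|]; [rewrite Ex ?Ey // (ltn_trans zx) | rewrite -Ey].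
- by exists y => [z zy|]; [rewrite Ex ?Ey // (ltn_trans zy) | rewrite Ex].
subst y; exists x => [z zx|]; first by rewrite Ex ?Ey.
exact: cmp_trans cx cy.
Qed.

Lemma lexlt_irr f : lexlt f f = false.
Proof. by apply/lexltP=> -[x _]; rewrite cmp_irr. Qed.

(** At the first place x where f and g differ, the node y = f (g x), which f
    sends to g x, cannot precede x: otherwise g would send both x and y to g x.
    So it is enough to compare the values of f at x < y. *)
Lemma first_difference f g (r : rel nat) : involutive f -> injective g ->
    (exists x, f x != g x) ->
    (forall x, f x != g x -> (x < f (g x))%N -> r (f x) (f (f (g x)))) ->
  exists2 x : 'I_n, forall y : 'I_n, (y < x)%N -> f y = g y & r (f x) (g x).
Proof.
move=> fK gI [x0 ne0] H.
case: (@arg_minnP _ x0 (fun x => f x != g x) (fun x : 'I_n => x : nat) ne0).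
move=> x ne min.
have E (y : 'I_n) : (y < x)%N -> f y = g y.
  by move=> yx; apply/eqP; apply: contraTT yx => /min; rewrite -leqNgt.
exists x => //; rewrite -[g x]fK; apply: H => //.
rewrite ltnNge leq_eqVlt; apply/negP=> /orP[/eqP/val_inj yx|/E].
  by rewrite -{1}yx fK eqxx in ne.
by rewrite fK => /gI yx; rewrite {1}yx fK eqxx in ne.
Qed.

End Lex.

Section DiagramOrder.
Variables (n : nat) (sp : bool).
Implicit Types D E : diagram n 0.

Definition diagram_lt D E := lexlt sp (mate D) (mate E).

Definition height D := #|[set E | diagram_lt E D]|.

Lemma ltn_height D E : diagram_lt D E -> (height D < height E)%N.
Proof.
move=> lt; apply/proper_card/properP; split.
  by apply/subsetP=> C; rewrite !inE => /lexlt_trans/(_ lt).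
by exists D; rewrite inE ?lt // /diagram_lt lexlt_irr.
Qed.

(** * Chains of arcs *)

Variable D : diagram n 0.
Notation f := (mate D).

Definition opener (x : 'I_n) := (x < f x)%N.

Lemma opener_mate x : opener (f x) = ~~ opener x.
Proof.
rewrite /opener mateK -leqNgt [RHS]leq_eqVlt.
by have := mate_neq D x; rewrite -val_eqE /= => /negPf ->.
Qed.

(** The poset of arcs, given by their left ends: a chain consists of nested arcs
    if the form is skew-symmetric; otherwise left and right ends both increase
    along the chain. *)
Definition chain (S : {set 'I_n}) : bool :=
  [forall x in S, opener x] &&
  [forall x in S, forall y in S, (x < y)%N ==> cmp sp (f y) (f x)].

Lemma chainP (S : {set 'I_n}) : reflect
  ((forall x : 'I_n, x \in S -> (x < f x)%N) /\
   (forall x y : 'I_n, x \in S -> y \in S -> (x < y)%N -> cmp sp (f y) (f x))) (chain S).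
Proof.
apply: (iffP andP) => -[o c]; split.
- exact/forall_inP.
- move=> x y xS yS xy.
  by have /forall_inP/(_ y yS)/implyP := forall_inP c x xS; apply.
- exact/forall_inP.
by apply/forall_inP=> x xS; apply/forall_inP=> y yS; apply/implyP; apply: c.
Qed.

Definition rank (x : 'I_n) : nat :=
  \max_(S : {set 'I_n} | [&& chain S, x \in S & [forall y in S, (y <= x)%N]]) #|S|.

Lemma rank_lt x y : opener x -> opener y -> (x < y)%N -> cmp sp (f y) (f x) ->
  (rank x < rank y)%N.
Proof.
move=> ox oy xy cxy.
have [|S] := @eq_bigmax_cond _ (fun S : {set 'I_n} =>
  [&& chain S, x \in S & [forall y in S, (y <= x)%N]]) (fun S => #|S|).
  apply/card_gt0P; exists [set x]; rewrite unfold_in /=; apply/and3P; split.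
    apply/chainP; split=> [z|z w]; rewrite !inE; first by move/eqP->.
    by move=> /eqP -> /eqP ->; rewrite ltnn.
  - by rewrite inE.
  by apply/forall_inP=> z; rewrite inE => /eqP ->.
rewrite unfold_in /= => /and3P[/chainP[oS cS] xS /forall_inP leS] rE.
have yS : y \notin S by apply: contraL xy => /leS; rewrite -leqNgt.
rewrite /rank rE; apply: (@leq_trans #|y |: S|); first by rewrite cardsU1 yS.
apply: (@leq_bigmax_cond _ _ (fun S : {set 'I_n} => #|S|)); apply/and3P; split.
- apply/chainP; split=> [z|z w].
    by rewrite !inE => /predU1P[->|/oS].
  have cy u : u \in S -> cmp sp (f y) (f u).
    move=> uS; have := leS u uS; rewrite leq_eqVlt => /orP[/eqP/val_inj->//|ux].
    exact: cmp_trans cxy (cS _ _ uS xS ux).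
  rewrite !inE => /predU1P[->|zS] /predU1P[->|wS]; rewrite ?ltnn //.
  + by move=> yw; have := leS w wS; rewrite leqNgt (ltn_trans xy yw).
  + by move=> _; apply: cy.
  by apply: cS.
- by rewrite !inE eqxx.
apply/forall_inP=> z; rewrite !inE => /predU1P[->|/leS zx] //.
exact: leq_trans zx (ltnW xy).
Qed.

Lemma rank_gt0 x : opener x -> (0 < rank x)%N.
Proof.
move=> ox; apply: (@leq_trans #|[set x]|); first by rewrite cards1.
apply: (@leq_bigmax_cond _ _ (fun S : {set 'I_n} => #|S|)); apply/and3P; split.
- apply/chainP; split=> [z|z w]; rewrite !inE; first by move/eqP->.
  by move=> /eqP -> /eqP ->; rewrite ltnn.
- by rewrite inE.
by apply/forall_inP=> z; rewrite inE => /eqP ->.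
Qed.

Lemma chain_of_rank x r : (r <= rank x)%N -> exists2 S, chain S & #|S| = r.
Proof.
move=> le_r.
have [S cS leS] : exists2 S, chain S & (r <= #|S|)%N.
  apply/exists_inP; apply: contraLR le_r => /exists_inPn H; rewrite -ltnNge.
  have := H set0; have c0 : chain set0.
    by apply/chainP; split=> [z|z w]; rewrite inE.
  move/(_ c0); rewrite cards0 -ltnNge => r0.
  rewrite /rank; elim/big_rec: _ => // S w /and3P[/H + _ _] wr.
  by rewrite -ltnNge gtn_max wr andbT.
have : (0 < #|[set B : {set 'I_n} | B \subset S & #|B| == r]|)%N.
  by rewrite cards_draws bin_gt0.
case/card_gt0P=> T; rewrite inE => /andP[TS /eqP cT]; exists T => //.
have [oS cmpS] := chainP _ cS.
by apply/chainP; split=> [z /(subsetP TS)/oS|z w /(subsetP TS) zS /(subsetP TS) wS] //; apply: cmpS.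
Qed.

End DiagramOrder.

Section GoodDiagrams.
Variables (n : nat) (sp : bool) (d : nat).
Implicit Types D E : diagram n 0.

Definition good D := [forall x, opener D x ==> (rank sp D x <= d)%N].

(** The ends of d + 1 arcs are 2 d + 2 nodes. *)
Lemma good_small D : (n <= 2 * d)%N -> good D.
Proof.
move=> nd; apply/forall_inP=> x ox; rewrite leqNgt; apply/negP=> /chain_of_rank[S cS sz].
have [oS _] := chainP _ _ _ cS.
have dis : [disjoint S & mate D @: S].
  apply/pred0P=> z /=; apply/negP=> /andP[zS /imsetP[w wS zE]].
  have := oS _ zS; have := oS _ wS; rewrite zE mateK; lia.
have := max_card (mem (S :|: mate D @: S)).
rewrite card_ord cardsU (disjoint_setI0 dis) cards0 card_imset ?sz; last first.
  exact: can_inj (mateK D).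
lia.
Qed.

Definition first_node D (x : 'I_n) := if opener D x then x else mate D x.

Lemma first_node_opener D x : opener D (first_node D x).
Proof.
by rewrite /first_node; case: ifP => // /negbT; rewrite opener_mate.
Qed.

Lemma first_node_mate D x : first_node D (mate D x) = first_node D x.
Proof.
rewrite /first_node /opener mateK; case: ltngtP => // /val_inj xx.
by have := mate_neq D x; rewrite xx eqxx.
Qed.

(** The depth of the arc at x in the poset of arcs, counted from 0, and in the
    skew-symmetric case whether x is the right end of this arc: the vectors of a
    symplectic basis come in two families, which are placed at left and at right
    ends. *)
Definition label D x : nat * bool :=
  ((rank sp D (first_node D x)).-1, sp && ~~ opener D x).

Lemma label_lt D x : good D -> ((label D x).1 < d)%N.
Proof.
move=> /forall_inP gD; have := gD _ (first_node_opener D x).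
by rewrite /label /=; case: (rank _ _ _) (rank_gt0 sp (first_node_opener D x)).
Qed.

Lemma label_mate D x : label D (mate D x) = ((label D x).1, sp && ~~ (label D x).2).
Proof.
by rewrite /label first_node_mate opener_mate; congr (_, _) => /=; case: sp.
Qed.

(** Arcs of equal depth are incomparable in the poset of arcs. *)
Lemma label_antichain D x y : label D x = label D y -> (x < y)%N ->
  cmp sp (mate D x) (mate D y).
Proof.
case=> rE oE xy.
have fxy : mate D x != mate D y.
  by rewrite (inj_eq (can_inj (mateK D))) -val_eqE neq_ltn xy.
have {}rE : rank sp D (first_node D x) = rank sp D (first_node D y).
  by have := rank_gt0 sp (first_node_opener D x);
     have := rank_gt0 sp (first_node_opener D y); move: rE; lia.
have anti u v : opener D u -> opener D v -> rank sp D u = rank sp D v ->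
    (u < v)%N -> ~~ cmp sp (mate D v) (mate D u).
  move=> ou ov E uv; apply/negP=> /(rank_lt ou ov uv); by rewrite E ltnn.
have {}anti := anti _ _ (first_node_opener D _) (first_node_opener D _).
have := anti _ _ rE; have := anti _ _ (esym rE); clear anti rE.
move: fxy oE xy; rewrite /first_node /opener /cmp -val_eqE /=.
have nx : (x : nat) != mate D x by rewrite eq_sym; apply: mate_neq D x.
have ny : (y : nat) != mate D y by rewrite eq_sym; apply: mate_neq D y.
case: sp => /=; case: ifP; case: ifP; rewrite ?mateK; move: nx ny;
  rewrite ?[_ < _](ltnNge) /=; lia.
Qed.

(** If E joins only nodes whose labels match, then at the first difference x the
    nodes x and mate D (mate E x) have the same label, so D is monotone on them
    and first_difference applies. *)
Lemma label_minimal D E :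
    (forall x, label D (mate E x) = label D (mate D x)) ->
  E = D \/ diagram_lt sp D E.
Proof.
move=> H; have [/existsP ne|/existsPn eq] := boolP [exists x, mate D x != mate E x].
  right; apply/lexltP.
  apply: (first_difference (r := cmp sp) (mateK D)) => //.
    exact: can_inj (mateK E).
  move=> x _ lt; apply: label_antichain => //.
  rewrite label_mate H label_mate /=; rewrite /label /=; congr (_, _).
  by case: sp; rewrite //= negbK.
by left; apply: mate_inj => x; apply/esym/eqP; have := eq x; rewrite negbK.
Qed.

End GoodDiagrams.

(** * Straightening modulo the ideal *)

Section Ideal.
Variables (K : fieldType) (delta : K) (r : nat).
Notation hom k l := {ffun diagram k l -> K^o}.
Variable s : hom r r.
Notation ideal x := (in_ideal delta s x).

Lemma ideal_generated k l (x : hom k l) : Defs.generated delta s x -> ideal x.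
Proof.
move=> gx; exists [:: x]; first by move=> y; rewrite inE => /eqP ->.
by apply: memv_span; rewrite inE.
Qed.

Lemma ideal0 k l : ideal (0 : hom k l).
Proof. by exists [::] => //; rewrite mem0v. Qed.

Lemma idealD k l (x y : hom k l) : ideal x -> ideal y -> ideal (x + y).
Proof.
move=> [S gS xS] [T gT yT]; exists (S ++ T).
  by move=> z; rewrite mem_cat => /orP[/gS|/gT].
by rewrite span_cat memv_add.
Qed.

Lemma idealZ k l a (x : hom k l) : ideal x -> ideal (a *: x).
Proof. by move=> [S gS xS]; exists S => //; rewrite memvZ. Qed.

Lemma ideal_sum k l I (e : seq I) (P : pred I) (x : I -> hom k l) :
  (forall i, P i -> ideal (x i)) -> ideal (\sum_(i <- e | P i) x i).
Proof. by move=> H; apply: big_ind => //; [apply: ideal0 | apply: idealD]. Qed.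

Lemma ideal_linear k l k' l' (f : hom k l -> hom k' l') : linear f ->
    (forall x, Defs.generated delta s x -> Defs.generated delta s (f x)) ->
  forall x, ideal x -> ideal (f x).
Proof.
move=> lf gf x [S gS xS].
rewrite (coord_span (X := in_tuple S) xS) (linear_sumZ lf).
apply: ideal_sum => i _; apply/idealZ/ideal_generated/gf/gS.
exact: mem_nth.
Qed.

Lemma ideal_compl k l p (x : hom l p) (y : hom k l) :
  ideal y -> ideal (brauer_comp delta x y).
Proof.
by apply: ideal_linear => [|z]; [apply: brauer_comp_linearr | apply: gen_compl].
Qed.

Lemma ideal_compr k l p (x : hom l p) (y : hom k l) :
  ideal x -> ideal (brauer_comp delta x y).
Proof.
apply: (@ideal_linear _ _ _ _ (fun x => brauer_comp delta x y)) => [|z].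
  exact: brauer_comp_linearl.
exact: gen_compr.
Qed.

Lemma ideal_tensorr k l k' l' (x : hom k l) (y : hom k' l') :
  ideal x -> ideal (brauer_tensor x y).
Proof.
apply: (@ideal_linear _ _ _ _ (fun x => brauer_tensor x y)) => [|z].
  exact: brauer_tensor_linearl.
exact: gen_tensorr.
Qed.

End Ideal.

Lemma exists_perm_onto_set a b (S : {set 'I_(a + b)}) : #|S| = a ->
  exists s : 'S_(a + b), forall i, (s i \in S) = (i < a)%N.
Proof.
move=> cS; have cC : #|~: S| = b.
  by have := cardsC S; rewrite cS card_ord; lia.
pose e := enum S ++ enum (~: S).
have se : size e = (a + b)%N by rewrite size_cat -!cardE cardsC card_ord.
have ue : uniq e.
  rewrite cat_uniq !enum_uniq andbT /=; apply/hasPn=> x.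
  by rewrite !mem_enum inE.
pose h (i : 'I_(a + b)) := nth i e i.
have hI : injective h.
  move=> i j; rewrite /h (set_nth_default j) ?se // => /eqP.
  by rewrite nth_uniq ?se // => /eqP/val_inj.
exists (perm hI) => i; rewrite permE /h nth_cat -cardE cS.
case: ltnP => ia; first by rewrite -mem_enum mem_nth // -cardE cS.
apply/negbTE; rewrite -in_setC -mem_enum mem_nth // -cardE cC.
by rewrite ltn_subLR // ltn_addr.
Qed.

Section Reduction.
Variables (K : fieldType) (charK : [pchar K] =i pred0).
Variables (sp : bool) (m d : nat) (md : m = if sp then d.*2 else d).
Let eps : K := (-1) ^+ sp.
Variable delta : K.
Notation hom k l := {ffun diagram k l -> K^o}.
Notation ideal x := (in_ideal delta (Sigma eps m.+1) x).

Section Antisymmetrize.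
Variables (b : nat).
Notation n := (m.+1 + b)%N.
Variables (D : diagram n 0) (s : 'S_n).

(** If s carries the first m + 1 nodes onto S, then t acts on the nodes as a
    permutation of S. *)
Definition conj_sum (t : 'S_m.+1) : 'S_n := ((perm_sum t (1 : 'S_b)) ^ s)%g.

Lemma antisymmetrizer_ideal :
  ideal (\sum_t (- eps) ^+ perm_length t *: diag K (precompose D (conj_sum t))).
Proof.
pose p (u : 'S_n) := diag K (perm_diagram u) : hom n n.
pose y := brauer_comp delta (diag K D) (brauer_comp delta
    (brauer_comp delta (p s) (brauer_tensor (Sigma eps m.+1) (diag K (id_diagram b))))
    (p s^-1%g)).
have gen : ideal y.
  apply: ideal_compl; apply: ideal_compr; apply: ideal_compl.
  apply: ideal_tensorr.
  apply: ideal_generated.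
  exact: gen_self.
suff <- : y = \sum_t (- eps) ^+ perm_length t *: diag K (precompose D (conj_sum t)).
  exact: gen.
rewrite /y /Sigma (linear_sumZ (brauer_tensor_linearl _)).
rewrite (linear_sumZ (brauer_comp_linearr _ _)).
rewrite (linear_sumZ (@brauer_comp_linearl _ _ _ _ _ _)).
rewrite (linear_sumZ (brauer_comp_linearr _ _)).
apply: eq_bigr => t _; congr (_ *: _).
rewrite brauer_tensor_diag diagram_tensor_perm !brauer_comp_perms brauer_comp_perm.
by rewrite /conj_sum conjgE.
Qed.

End Antisymmetrize.

(** S consists of the m + 1 nodes to be permuted and B is a set of nodes on which
    D is monotone. In the symmetric case both are the set of left ends of a chain
    of d + 1 = m + 1 arcs. In the skew-symmetric case B consists of the
    2 d + 2 = m + 2 ends of d + 1 nested arcs; any m + 1 of them will do for S. *)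
Lemma long_chain n (D : diagram n 0) : ~~ good sp d D ->
  exists B S : {set 'I_n}, [/\ #|S| = m.+1, S \subset B,
    forall x y : 'I_n, x \in B -> y \in B -> (x < y)%N -> cmp sp (mate D y) (mate D x) &
    if sp then (forall x, (mate D x \in B) = (x \in B))
    else B = S /\ [disjoint S & mate D @: S]].
Proof.
case/forall_inPn=> x ox; rewrite -ltnNge => /chain_of_rank[T cT sz].
have [oT cmpT] := chainP _ _ _ cT.
have dis : [disjoint T & mate D @: T].
  apply/pred0P=> z /=; apply/negP=> /andP[zS /imsetP[w wS zE]].
  have := oT _ zS; have := oT _ wS; rewrite zE mateK; lia.
move: md; case: sp cmpT {cT} => cmpT mE; last first.
  by exists T, T; split=> //; rewrite ?mE.
set B := T :|: mate D @: T.
have cB : #|B| = d.*2.+2.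
  rewrite cardsU (disjoint_setI0 dis) cards0 card_imset ?sz; last first.
    exact: can_inj (mateK D).
  by rewrite subn0 addnn.
have : (0 < #|[set S : {set 'I_n} | S \subset B & #|S| == m.+1]|)%N.
  by rewrite cards_draws bin_gt0 cB mE.
case/card_gt0P=> S; rewrite inE => /andP[SB /eqP cS]; exists B, S; split=> //.
  have inB z : z \in B -> z \in T \/ exists2 w, w \in T & z = mate D w.
    by rewrite inE => /orP[|/imsetP[w]]; [left | right; exists w].
  have mono u v : u \in T -> v \in T -> (mate D u < mate D v)%N -> (v < u)%N.
    move=> uT vT uv; rewrite ltnNge leq_eqVlt; apply/negP=> /orP[/eqP/val_inj E|].
      by rewrite E ltnn in uv.
    by move/(cmpT _ _ uT vT); rewrite /cmp => /ltnW; rewrite leqNgt uv.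
  have cross u v : u \in T -> v \in T -> (u < mate D v)%N.
    move=> uT vT; have [uv|vu|/val_inj ->] := ltngtP u v; last exact: oT.
      exact: ltn_trans uv (oT _ vT).
    exact: ltn_trans (oT _ uT) (cmpT _ _ vT uT vu).
  move=> y z /inB[yT|[u uT ->]] /inB[zT|[v vT ->]]; rewrite /cmp ?mateK.
  - exact: cmpT.
  - by move=> _; apply: cross.
  - by move=> lt; have := cross _ _ zT uT; rewrite ltnNge ltnW.
  exact: mono.
move=> y; rewrite !inE orbC; congr orb.
  exact: (mem_imset _ _ (can_inj (mateK D))).
by rewrite -{2}[y](mateK D) (mem_imset _ _ (can_inj (mateK D))).
Qed.

(** The signed sum of the diagrams obtained from D by permuting S lies in the
    ideal. By first_difference and the monotonicity of D all of them precede D,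
    except for D itself, which occurs with a nonzero coefficient. *)
Lemma straightening_step n (D : diagram n 0) : ~~ good sp d D ->
  exists2 y : hom n 0, ideal (diag K D - y) & forall E, y E != 0 -> diagram_lt sp E D.
Proof.
case/long_chain=> B [S [cS SB cmpB BS]].
have [b nE] : exists b, n = (m.+1 + b)%N.
  exists (n - m.+1)%N; rewrite subnKC // -cS -[X in (_ <= X)%N]card_ord.
  exact: max_card.
move: D B S cS SB cmpB BS; rewrite nE => {n nE} D B S cS SB cmpB BS.
have [s sS] := exists_perm_onto_set cS.
pose u := @conj_sum b s; pose Dt t := precompose D (u t).
have u_out t x : x \notin S -> u t x = x.
  rewrite /u /conj_sum conjgE !permM -{1}[x](permKV s) sS -leqNgt.
  case: (split_ordP (s^-1%g x)) => j E; rewrite E /= => lt.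
    by have := ltn_ord j; rewrite ltnNge lt.
  by rewrite perm_sum_rshift perm1 -E permKV.
have u_in t x : (u t x \in S) = (x \in S).
  have [xS|xS] := boolP (x \in S); last by rewrite u_out // (negPf xS).
  by apply: contraTT xS => xS; rewrite -(perm_inj (u_out t _ xS)).
have mDt t x : mate (Dt t) x = (u t)^-1%g (mate D (u t x)) by exact: mate_precompose.
have uV_out t x : x \notin S -> (u t)^-1%g x = x.
  by move=> xS; rewrite -{1}(u_out t x xS) permK.
have uV_in t x : ((u t)^-1%g x \in S) = (x \in S) by rewrite -(u_in t) permKV.
have Dt_lt t : Dt t != D -> diagram_lt sp (Dt t) D.
  move=> ne; have exx : exists x, mate D x != mate (Dt t) x.
    apply/existsP; apply: contraNT ne => /existsPn H; apply/eqP/mate_inj => x.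
    by apply/esym/eqP; have := H x; rewrite negbK.
  apply/lexltP.
  have [|x Ex cx] := @first_difference _ (mate D) (mate (Dt t)) (fun a c => cmp sp c a)
    (mateK D) (can_inj (mateK _)) exx; last first.
    by exists x => // y yx; rewrite Ex.
  move=> x; rewrite mateK => nex lt.
  have both : x \in B -> mate D (mate (Dt t) x) \in B ->
      cmp sp (mate (Dt t) x) (mate D x).
    by move=> xB yB; have := cmpB _ _ xB yB lt; rewrite mateK.
  (* Nested arcs: D and Dt t both preserve B and agree outside of B. *)
  move: BS both; rewrite /is_true; case: sp lt nex cmpB => lt nex cmpB.
    move=> BS; apply.
      apply: contraNT nex => xB; rewrite mDt u_out ?uV_out //.
      + by apply: contraNN xB => /(subsetP SB); rewrite BS.
      + by apply: contraNN xB => /(subsetP SB).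
    rewrite BS mDt; have xB : x \in B.
      apply: contraNT nex => xB; rewrite mDt u_out ?uV_out //.
      + by apply: contraNN xB => /(subsetP SB); rewrite BS.
      + by apply: contraNN xB => /(subsetP SB).
    have uB v : v \in B -> u t v \in B.
      move=> vB; have [vS|vS] := boolP (v \in S); last by rewrite u_out.
      by apply: (subsetP SB); rewrite u_in.
    have [vS|vS] := boolP (mate D (u t x) \in S).
      by apply: (subsetP SB); rewrite uV_in.
    by rewrite uV_out // BS uB.
  (* Otherwise they differ at nodes of S, treated by monotonicity of D on S, or
     at partners of such nodes, where the inverse of D is monotone. *)
  case=> BS dis both; subst B.
  have disj v : v \in S -> mate D v \notin S.
    move=> vS; apply/negP=> wS; move/pred0P: dis => /(_ (mate D v)) /=.
    by rewrite wS imset_f.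
  have [xS|xS] := boolP (x \in S).
    by apply: both => //; rewrite mDt uV_out ?mateK ?u_in // disj // u_in.
  have [yS|yS] := boolP (mate D x \in S); last first.
    by move: nex; rewrite mDt u_out // uV_out // eqxx.
  move: lt nex; rewrite mDt u_out // => lt nex.
  rewrite /cmp ltnNge leq_eqVlt; apply/negP=> /orP[/eqP/val_inj E|lt'].
    by rewrite E eqxx in nex.
  have wS : (u t)^-1%g (mate D x) \in S by rewrite uV_in.
  by have := cmpB _ _ wS yS lt'; rewrite /cmp mateK => /ltnW; rewrite leqNgt lt.
pose c := \sum_(t | Dt t == D) (- eps) ^+ perm_length t.
have c_neq0 : c != 0.
  have len1 : perm_length (1 : 'S_m.+1) = 0%N.
    apply: eq_card0 => -[i j]; rewrite !inE !perm1 /=.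
    by case: ltngtP.
  have u1 : u 1%g = 1%g.
    rewrite /u /conj_sum; suff -> : perm_sum (1 : 'S_m.+1) (1 : 'S_b) = 1%g by rewrite conj1g.
    apply/permP=> x; rewrite perm1; case: (split_ordP x) => j ->.
      by rewrite perm_sum_lshift perm1.
    by rewrite perm_sum_rshift perm1.
  have D1 : Dt 1%g == D by rewrite /Dt u1 precompose1.
  (* If eps = -1 all signs are 1, so c counts the t fixing D; if eps = 1 only
     t = 1 fixes D, as S does not meet its image under D. *)
  rewrite /c /eps; case: sp BS => BS.
    rewrite (eq_bigr (fun=> 1)); last by move=> t _; rewrite expr1 opprK expr1n.
    rewrite sumr_const; move/pcharf0P: charK => ->; rewrite -lt0n.
    by apply/card_gt0P; exists 1%g.
  case: BS => BS dis; rewrite (big_pred1 1%g) ?len1 ?oner_neq0 // => t.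
  apply/eqP/eqP=> [DE|->]; last exact/eqP.
  apply/permP=> i; rewrite perm1; apply: (@lshift_inj _ b).
  have fixS x : x \in S -> u t x = x.
    move=> xS; have := mDt t x; rewrite DE uV_out ?(inj_eq (can_inj (mateK D))).
      by move/(can_inj (mateK D)).
    apply/negP=> wS; move/pred0P: dis => /(_ (mate D (u t x))) /=.
    by rewrite wS imset_f // u_in.
  have := fixS (s (lshift b i)); rewrite sS /= ltn_ord => /(_ isT).
  rewrite /u /conj_sum conjgE !permM permK perm_sum_lshift.
  exact: perm_inj.
exists (- (c^-1 *: \sum_(t | Dt t != D) (- eps) ^+ perm_length t *: diag K (Dt t))).
  have := idealZ c^-1 (antisymmetrizer_ideal D s).
  rewrite (bigID (fun t => Dt t == D)) /= -/u opprK scalerDr.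
  have -> : \sum_(t | Dt t == D) (- eps) ^+ perm_length t *: diag K (Dt t) =
      c *: diag K D.
    by rewrite /c scaler_suml; apply: eq_bigr => t /eqP E; congr (_ *: diag _ _).
  by rewrite scalerA mulVf // scale1r.
move=> E; rewrite ffunE oppr_eq0 ffunE sum_ffunE => ne.
have [t tD tE] : exists2 t, Dt t != D & diag K (Dt t) E != 0.
  apply/exists_inP; apply: contraNT ne => /exists_inPn H.
  rewrite big1 ?scaler0 // => t /H; rewrite negbK => /eqP E0.
  by rewrite ffunE E0 scaler0.
by rewrite (diag_neq0 tE) Dt_lt.
Qed.

Lemma reduce_to_good n (x : hom n 0) :
  exists2 y : hom n 0, ideal (x - y) & forall E, y E != 0 -> good sp d E.
Proof.
pose P (x : hom n 0) := exists2 y : hom n 0, ideal (x - y) &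
  forall E, y E != 0 -> good sp d E.
have P0 : P 0 by exists 0; [rewrite subr0; apply: ideal0 | move=> E; rewrite ffunE eqxx].
have PD x1 x2 : P x1 -> P x2 -> P (x1 + x2).
  case=> y1 i1 g1 [y2 i2 g2]; exists (y1 + y2).
    by rewrite opprD addrACA; apply: idealD.
  move=> E; rewrite ffunE; have [->|/g1 //] := eqVneq (y1 E) 0.
  by rewrite add0r => /g2.
have PZ a x1 : P x1 -> P (a *: x1).
  case=> y1 i1 g1; exists (a *: y1); first by rewrite -scalerBr; apply: idealZ.
  move=> E; rewrite ffunE; have [->|/g1 //] := eqVneq (y1 E) 0.
  by rewrite scaler0 eqxx.
have PI x1 x2 : ideal (x1 - x2) -> P x2 -> P x1.
  move=> i12 [y i2 g]; exists y => //.
  by rewrite -(subrK x2 x1) -addrA; apply: idealD.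
have Pdiag N (D : diagram n 0) : (height sp D < N)%N -> P (diag K D).
  elim: N D => [//|N IHN] D ltN; have [gD|/straightening_step[y iy ly]] := boolP (good sp d D).
    exists (diag K D); first by rewrite subrr; apply: ideal0.
    by move=> E /diag_neq0 ->.
  apply: PI iy _; rewrite [y]hom_diag_sum; apply: (big_ind P) => // E _.
  have [->|/ly lt] := eqVneq (y E) 0; first by rewrite scale0r.
  apply: PZ; apply: IHN; have := ltn_height lt; lia.
rewrite [x]hom_diag_sum; apply: (big_ind P) => // E _.
by apply: PZ; apply: (Pdiag (height sp E).+1).
Qed.

End Reduction.

(** * Tensor powers *)

Section TensorPowers.
Variables (K : fieldType) (m : nat).
Notation V := 'rV[K]_m.
Notation T r := {ffun {ffun 'I_r -> 'I_m} -> K^o}.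

Lemma eq_pure r (v v' : 'I_r -> V) : v =1 v' -> pure v = pure v'.
Proof. by move=> E; apply/ffunP=> w; rewrite !ffunE; apply: eq_bigr => i _; rewrite E. Qed.

Definition word_tensor r (w : {ffun 'I_r -> 'I_m}) : T r := pure (fun i => 'e_(w i)).

Lemma word_tensorE r (w u : {ffun 'I_r -> 'I_m}) : word_tensor w u = (u == w)%:R.
Proof.
rewrite ffunE; have [->|/eqP/ffunP ne] := eqVneq u w.
  by rewrite big1 // => i _; rewrite mxE !eqxx.
have [i ui] : exists i, u i != w i.
  apply/existsP; apply: contraT => /existsPn H; case: ne => i.
  by apply/eqP; have := H i; rewrite negbK.
by rewrite (bigD1 i) //= mxE eqxx (negPf ui) mul0r.
Qed.

Lemma tensor_word_sum r (t : T r) : t = \sum_w t w *: word_tensor w.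
Proof.
apply/ffunP=> u; rewrite sum_ffunE (bigD1 u) //= big1 => [|w wu].
  by rewrite ffunE word_tensorE eqxx addr0 [RHS]mulr1.
by rewrite ffunE word_tensorE eq_sym (negPf wu) [LHS]mulr0.
Qed.

Lemma hom_eq_word r (W : vectType K) (f g : 'Hom(T r, W)) :
  (forall w, f (word_tensor w) = g (word_tensor w)) -> f = g.
Proof.
move=> E; apply/lfunP=> t; rewrite [t]tensor_word_sum !linear_sum.
by apply: eq_bigr => w _; rewrite !linearZ /= E.
Qed.

Lemma hom_eq_pure r (W : vectType K) (f g : 'Hom(T r, W)) :
  (forall v, f (pure v) = g (pure v)) -> f = g.
Proof. by move=> E; apply: hom_eq_word => w; apply: E. Qed.

Lemma pure_tensor k l (v : 'I_(k + l) -> V) :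
  pure v = tensor (pure (fun i => v (lshift l i))) (pure (fun j => v (rshift k j))).
Proof.
apply/ffunP=> w; rewrite !ffunE big_split_ord /=.
by congr (_ * _); apply: eq_bigr => i _; rewrite ffunE.
Qed.

Lemma tensor_linearl k l (t : T l) : linear (fun s : T k => tensor s t).
Proof.
by move=> a s s'; apply/ffunP=> w; rewrite !ffunE mulrDl -[_ *: _ in LHS]/(_ * _) -mulrA.
Qed.

Lemma tensor_linearr k l (s : T k) : linear (fun t : T l => tensor s t).
Proof.
move=> a t t'; apply/ffunP=> w; rewrite !ffunE mulrDr; congr (_ + _).
by rewrite -[_ *: _ in LHS]/(_ * _) -[RHS]/(_ * _) mulrCA.
Qed.

Lemma tensorZl k l a (s : T k) (t : T l) : tensor (a *: s) t = a *: tensor s t.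
Proof. by apply/ffunP=> w; rewrite !ffunE -mulrA. Qed.

Lemma tensorZr k l a (s : T k) (t : T l) : tensor s (a *: t) = a *: tensor s t.
Proof.
by apply/ffunP=> w; rewrite !ffunE -[_ *: _ in LHS]/(_ * _) -[RHS]/(_ * _) mulrCA.
Qed.

Lemma tensor2E (v : 'I_2 -> V) : pure v = tensor2 (v ord0) (v ord_max).
Proof.
apply: eq_pure => -[[|[|i]] //= lt]; rewrite (tnth_nth 0) /=; congr v; exact: val_inj.
Qed.

Lemma tensor1E (v : 'I_0 -> V) : pure v = tensor1 K m.
Proof. by apply: eq_pure => -[]. Qed.

Lemma tensor1_neq0 : tensor1 K m != 0.
Proof.
apply/eqP=> /ffunP/(_ [ffun i => match ord0_absurd 'I_m i with j => j end]).
by rewrite !ffunE big_ord0 => /eqP; rewrite oner_eq0.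
Qed.

Lemma T0_tensor1 (t : T 0) : exists a, t = a *: tensor1 K m.
Proof.
pose w0 : {ffun 'I_0 -> 'I_m} := [ffun i => ord0_absurd 'I_m i].
exists (t w0); apply/ffunP=> w; rewrite !ffunE big_ord0 [RHS]mulr1.
by congr (t _); apply/ffunP=> -[].
Qed.

Lemma T0_scale_inj (a b : K) : a *: tensor1 K m = b *: tensor1 K m -> a = b.
Proof.
move/eqP; rewrite -subr_eq0 -scalerBl scaler_eq0 (negPf tensor1_neq0) orbF.
by rewrite subr_eq0 => /eqP.
Qed.

End TensorPowers.

(** * The functor on permutations *)

Section FunctorValues.
Variables (K : fieldType) (m : nat) (sp : bool).
Notation V := 'rV[K]_m.
Notation T r := {ffun {ffun 'I_r -> 'I_m} -> K^o}.
Variable form : {hermitian V for sp & idfun}.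
Variables (b b' : m.-tuple V).
Variable F : forall k l : nat, {linear brauer_hom K k l -> 'Hom(T k, T l)}.
Hypothesis FF : is_brauer_functor form b b' F.
Let eps : K := (-1) ^+ sp.

Lemma functor_tensor_id k l k' (x : brauer_hom K k l) (s : T k) (t : T k') :
  F (k + k') (l + k') (brauer_tensor x (diag K (id_diagram k'))) (tensor s t) =
    tensor (F k l x s) t.
Proof. by rewrite (functor_tensor FF) (functor_id FF) id_lfunE. Qed.

Lemma functor_id_tensor k l k' (x : brauer_hom K k l) (s : T k') (t : T k) :
  F (k' + k) (k' + l) (brauer_tensor (diag K (id_diagram k')) x) (tensor s t) =
    tensor s (F k l x t).
Proof. by rewrite (functor_tensor FF) (functor_id FF) id_lfunE. Qed.

Definition signed_perm_value n (s : 'S_n) : Prop :=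
  forall v : 'I_n -> V, F n n (diag K (perm_diagram s)) (pure v) =
    eps ^+ s *: pure (fun i => v (s^-1%g i)).

Lemma signed_perm_valueM n (s t : 'S_n) :
  signed_perm_value s -> signed_perm_value t -> signed_perm_value (s * t)%g.
Proof.
move=> Hs Ht v.
rewrite -(brauer_comp_perms (eps * m%:R) t s) (functor_comp FF) comp_lfunE.
rewrite Hs linearZ /= Ht scalerA odd_permM; congr (_ *: _); last first.
  by apply: eq_pure => i; rewrite invMg permM.
rewrite -exprD /eps -!exprM; case: sp => /=; last by rewrite !mul0n.
by rewrite !mul1n signr_addb exprD.
Qed.

(** By induction on n: a transposition of two later slots is I tensored with a
    smaller one, that of the first two slots is X tensored with identities, and
    the remaining ones are conjugates of the latter by the former. *)
Lemma signed_perm_value_tperm n (i j : 'I_n) :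
  i != j -> signed_perm_value (tperm i j).
Proof.
elim: n i j => [[]//|n IHn] i j.
have high (x y : 'I_n) : x != y -> signed_perm_value (tperm (rshift 1 x) (rshift 1 y)).
  move=> xy v.
  have E : tperm (rshift 1 x) (rshift 1 y) = perm_sum (1 : 'S_1) (tperm x y).
    apply/permP=> z; case: (split_ordP z) => u ->.
      rewrite perm_sum_lshift perm1 tpermD //; by rewrite eq_sym eq_lrshift.
    by rewrite perm_sum_rshift -inj_tperm //; apply: rshift_inj.
  rewrite odd_tperm {1}E -diagram_tensor_perm -brauer_tensor_diag pure_tensor.
  rewrite functor_id_tensor IHn // tensorZr [in RHS]pure_tensor odd_tperm xy.
  congr (_ *: tensor _ _); apply: eq_pure => z; rewrite !tpermV.
    by rewrite tpermD //; rewrite eq_sym eq_lrshift.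
  by rewrite -inj_tperm //; apply: rshift_inj.
have first (p : nat) :
    signed_perm_value (tperm (lshift p ord0) (lshift p ord_max) : 'S_(2 + p)).
  move=> v; have E : tperm (lshift p ord0) (lshift p ord_max) =
      perm_sum (tperm ord0 ord_max : 'S_2) (1 : 'S_p).
    apply/permP=> z; case: (split_ordP z) => u ->.
      by rewrite perm_sum_lshift -inj_tperm //; apply: lshift_inj.
    by rewrite perm_sum_rshift perm1 tpermD // eq_lrshift.
  rewrite odd_tperm {1}E -diagram_tensor_perm -brauer_tensor_diag pure_tensor.
  rewrite functor_tensor_id tensor2E (functor_cross FF) tensorZl [in RHS]pure_tensor.
  rewrite [in RHS]tensor2E; congr (_ *: tensor (tensor2 _ _) _).
  - by rewrite tpermV tpermL.
  - by rewrite tpermV tpermR.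
  by apply: eq_pure => z; rewrite tpermV tpermD // eq_lrshift.
have {}high (x y : 'I_n.+1) : (0 < x)%N -> (0 < y)%N -> x != y ->
    signed_perm_value (tperm x y).
  have shift (z : 'I_n.+1) : (0 < z)%N -> exists u : 'I_n, z = rshift 1 u.
    case: (split_ordP (z : 'I_(1 + n))) => u ->; first by rewrite [u]ord1.
    by exists u.
  move=> /shift[u ->] /shift[w ->] ne; apply: high.
  by apply: contraNneq ne => ->.
have {}first (x y : 'I_n.+1) : x = 0%N :> nat -> y = 1%N :> nat ->
    signed_perm_value (tperm x y).
  case: n x y {IHn i j high} => [[[]//] ? [[]//]|p x y x0 y1].
  have -> : x = lshift p (ord0 : 'I_2) by apply: val_inj.
  have -> : y = lshift p (ord_max : 'I_2) by apply: val_inj.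
  exact: first.
have {}first (x y : 'I_n.+1) : x = 0%N :> nat -> (0 < y)%N -> signed_perm_value (tperm x y).
  move=> x0 y_gt0; have n_gt0 : (1 < n.+1)%N by rewrite (leq_ltn_trans y_gt0) ?ltn_ord.
  pose k := Ordinal n_gt0; have [<-|ky] := eqVneq k y; first exact: first.
  have hy : signed_perm_value (tperm k y) by exact: high.
  have -> : tperm x y = (tperm x k ^ tperm k y)%g.
    by rewrite tpermJ tpermL tpermD // -val_eqE /= x0 // -lt0n.
  have fk : signed_perm_value (tperm x k) by exact: first.
  rewrite conjgE tpermV; exact: signed_perm_valueM hy (signed_perm_valueM fk hy).
move=> ij; have [i0|i_gt0] := posnP i.
  apply: first; rewrite // lt0n; apply: contraNneq ij => j0.
  by rewrite -val_eqE /= i0 j0.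
have [j0|j_gt0] := posnP j; first by rewrite tpermC; apply: first.
exact: high.
Qed.

Lemma functor_perm n (s : 'S_n) (v : 'I_n -> V) :
  F n n (diag K (perm_diagram s)) (pure v) = eps ^+ s *: pure (fun i => v (s^-1%g i)).
Proof.
rewrite -/(signed_perm_value s); move: v; rewrite -/(signed_perm_value s).
case: (prod_tpermP s) => ts -> /allP all_ts; rewrite big_seq.
apply: big_ind => [v| |t /all_ts]; last exact: signed_perm_value_tperm.
  rewrite -/(id_diagram _) (functor_id FF) id_lfunE odd_perm1 scale1r.
  by apply: eq_pure => x; rewrite invg1 perm1.
exact: signed_perm_valueM.
Qed.

(** * The functor on matchings *)

(** Every arc is read from left to right, which matters if the form is
    skew-symmetric. *)
Definition pairing_value n (D : diagram n 0) (v : 'I_n -> V) : K :=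
  \prod_(i | opener D i) form (v i) (v (mate D i)).

Lemma form_swap u v : form u v = eps * form v u.
Proof. by rewrite hermC. Qed.

(** The values of P select one end of each arc; reading the arcs from there
    instead of from the left end only affects the sign. *)
Lemma pairing_value_choice n (D : diagram n 0) (P : pred 'I_n) :
    (forall i, P (mate D i) = ~~ P i) ->
  exists e : nat, forall v, \prod_(i | P i) form (v i) (v (mate D i)) =
    eps ^+ e * pairing_value D v.
Proof.
move=> PM; exists #|[pred i | opener D i & ~~ P i]| => v.
pose g i := form (v i) (v (mate D i)).
have gM i : g (mate D i) = eps * g i by rewrite /g mateK form_swap.
rewrite /pairing_value (bigID (fun i => opener D i)) /=.
rewrite [X in _ * X](reindex_inj (can_inj (mateK D))) /=.
rewrite [RHS in _ = RHS](_ : _ = eps ^+ #|[pred i | opener D i & ~~ P i]| *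
  (\prod_(i | P i && opener D i) g i * \prod_(i | opener D i && ~~ P i) g i)); last first.
  congr (_ * _); rewrite (bigID P) /=; congr (_ * _).
  by apply: eq_bigl => i; rewrite andbC.
rewrite mulrCA -prodr_const -big_split /=; congr (_ * _).
apply: eq_big => [i|i _]; first by rewrite PM opener_mate negbK andbC.
by rewrite -/(g _) gM.
Qed.

Lemma pairing_value_precompose n (D : diagram n 0) (s : 'S_n) :
  exists e : nat, forall v, pairing_value (precompose D s) v =
    eps ^+ e * pairing_value D (fun i => v (s^-1%g i)).
Proof.
have oM i : ((s^-1%g (mate D i) < s^-1%g (mate D (mate D i)))%N) =
    ~~ (s^-1%g i < s^-1%g (mate D i))%N.
  rewrite mateK -leqNgt [RHS]leq_eqVlt val_eqE (inj_eq perm_inj).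
  by rewrite (negPf (mate_neq D i)).
have [e E] := pairing_value_choice oM.
exists e => v; rewrite -E /pairing_value.
rewrite (reindex_inj (@perm_inj _ s^-1%g)) /=.
apply: eq_big => [i|i _].
  by rewrite /opener mate_precompose permKV.
by rewrite mate_precompose permKV.
Qed.

Lemma pairing_value_cap n (D : diagram n 0) (v : 'I_(2 + n) -> V) :
  pairing_value (diagram_tensor cap_diagram D : diagram (2 + n) 0) v =
    form (v (lshift n ord0)) (v (lshift n ord_max)) *
    pairing_value D (fun i => v (rshift 2 i)).
Proof.
rewrite /pairing_value big_split_ord /=; congr (_ * _).
  rewrite (big_pred1 ord0) => [|i].
    rewrite mate_tensor_lshift mate_cap.
    by congr (form _ (v (lshift _ _))); apply: val_inj.
  rewrite /opener mate_tensor_lshift mate_cap /=.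
  by case: i => [[|[|i]]].
apply: eq_big => [i|i _]; last by rewrite mate_tensor_rshift.
by rewrite /opener mate_tensor_rshift /= ltn_add2l.
Qed.

Lemma functor_cap_tensor n (y : brauer_hom K n 0) (v : 'I_(2 + n) -> V) :
  F (2 + n) 0 (brauer_tensor (diag K cap_diagram) y : brauer_hom K (2 + n) 0) (pure v) =
    form (v (lshift n ord0)) (v (lshift n ord_max)) *:
      F n 0 y (pure (fun i => v (rshift 2 i))).
Proof.
have := functor_tensor FF (diag K cap_diagram) y
  (pure (fun i => v (lshift n i))) (pure (fun i => v (rshift 2 i))).
rewrite -pure_tensor => ->.
rewrite [pure (fun i => v (lshift n i))]tensor2E (functor_cap FF) tensorZl.
congr (_ *: _); have [a ->] := T0_tensor1 (F n 0 y (pure (fun i => v (rshift 2 i)))).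
rewrite tensorZr; congr (_ *: _); rewrite -[RHS](tensor1E (fun=> 0)).
by rewrite (pure_tensor (k := 0) (l := 0)) !tensor1E.
Qed.

(** Every matching comes from a juxtaposition of caps by permuting nodes, and
    the functor turns permuting nodes into permuting vectors up to a sign. *)
Lemma functor_matching n (D : diagram n 0) : exists e : nat, forall v : 'I_n -> V,
  F n 0 (diag K D) (pure v) = (eps ^+ e * pairing_value D v) *: tensor1 K m.
Proof.
elim/ltn_ind: n D => -[|[|n]] IHn D.
- exists 0 => v; have -> : D = id_diagram 0 by apply: diagram_eq => -[[]|[]].
  rewrite (functor_id FF) id_lfunE tensor1E mul1r /pairing_value.
  by rewrite big1 ?scale1r // => -[].
- by have := mate_neq D ord0; rewrite [mate D ord0]ord1 eqxx.
have [D' [s ->]] := diagram_cap_decomposition (D : diagram (2 + n) 0).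
have [e1 E1] := IHn n (ltnW (ltnSn _)) D'.
have [e2 E2] := pairing_value_precompose (diagram_tensor cap_diagram D' : diagram (2 + n) 0) s.
exists (s + e1 + e2)%N => v.
rewrite -(brauer_comp_perm (eps * m%:R)) (functor_comp FF) comp_lfunE functor_perm.
rewrite linearZ /=; have := functor_cap_tensor (diag K D') (fun i => v (s^-1%g i)).
rewrite brauer_tensor_diag => ->; rewrite E1 !scalerA.
have ee : eps ^+ e2 * eps ^+ e2 = 1.
  by rewrite -exprMn /eps -expr2 sqrr_sign expr1n.
congr (_ *: _); rewrite E2 pairing_value_cap [RHS]mulrA exprD -[_ * _ * eps ^+ e2]mulrA ee mulr1.
by rewrite exprD -!mulrA; congr (_ * _); rewrite mulrCA.
Qed.

End FunctorValues.

Import Order.TTheory Num.Theory.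

(** * The ideal lies in the kernel *)

(** The sign of the Vandermonde determinant with rows of powers of s(0), s(1), ...
    is given by the inversions of s, and it is the signature of s because this
    matrix is a column permutation of the one for s = 1. *)
Lemma odd_perm_length r (s : 'S_r) : odd (perm_length s) = s.
Proof.
pose a (u : 'S_r) : 'rV[rat]_r := \row_j (u j)%:R.
have sg_diff (u : 'S_r) (i j : 'I_r) : (i < j)%N ->
    Num.sg (a u 0 j - a u 0 i) = (-1) ^+ (u j < u i)%N.
  move=> ij; rewrite !mxE; case: ltngtP => [lt|lt|/val_inj/perm_inj E].
  - by rewrite expr1 ltr0_sg // subr_lt0 ltr_nat.
  - by rewrite expr0 gtr0_sg // subr_gt0 ltr_nat.
  by rewrite E ltnn in ij.
have sg_det u : Num.sg (\det (Vandermonde r (a u))) = (-1) ^+ perm_length u.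
  rewrite det_Vandermonde (big_morph _ (@sgrM _) (@sgr1 _)).
  under eq_bigr do rewrite (big_morph _ (@sgrM _) (@sgr1 _)).
  rewrite pair_big_dep /= /perm_length -prodr_const.
  rewrite [RHS](eq_bigl (fun p : 'I_r * 'I_r => (p.1 < p.2)%N && (u p.2 < u p.1)%N)).
    rewrite big_mkcondr /=; apply: eq_bigr => -[i j] /= ij.
    by rewrite sg_diff //; case: (_ < _)%N.
  by case=> i j; rewrite inE.
have : Num.sg (\det (Vandermonde r (a s))) =
    (-1) ^+ s * Num.sg (\det (Vandermonde r (a 1%g))).
  have -> : Vandermonde r (a s) = col_perm s (Vandermonde r (a 1%g)).
    by apply/matrixP=> i j; rewrite !mxE perm1.
  rewrite col_permE det_mulmx det_perm sgrM odd_permV mulrC; congr (_ * _).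
  by case: (odd_perm s); rewrite ?expr1 ?expr0 ?sgrN ?sgr1.
rewrite !sg_det.
have -> : perm_length (1 : 'S_r) = 0%N.
  by apply: eq_card0 => -[i j]; rewrite !inE !perm1 /=; case: ltngtP.
rewrite mulr1 -signr_odd => /eqP; rewrite -subr_eq0.
by case: (odd _); case: (odd_perm s).
Qed.

Section Kernel.
Variables (K : fieldType) (charK : [pchar K] =i pred0) (m : nat) (sp : bool).
Notation V := 'rV[K]_m.
Notation T r := {ffun {ffun 'I_r -> 'I_m} -> K^o}.
Variable form : {hermitian V for sp & idfun}.
Variables (b b' : m.-tuple V).
Variable F : forall k l : nat, {linear brauer_hom K k l -> 'Hom(T k, T l)}.
Hypothesis FF : is_brauer_functor form b b' F.
Let eps : K := (-1) ^+ sp.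
Let delta : K := eps * m%:R.

Lemma two_neq0 : (2%:R : K) != 0.
Proof. by move/pcharf0P: charK => ->. Qed.

Lemma eq_opp0 (W : lmodType K) (x : W) : x = - x -> x = 0.
Proof.
move=> E; have : 2%:R *: x = 0 by rewrite scaler_nat mulr2n {1}E addNr.
by move/eqP; rewrite scaler_eq0 (negPf two_neq0) => /eqP.
Qed.

(** The functor maps the signed sum to the antisymmetrizer, which vanishes as
    m vectors of a basis are too few for m + 1 slots. *)
Lemma functor_Sigma : F _ _ (Sigma eps m.+1) = 0.
Proof.
apply: hom_eq_word => w; rewrite zero_lfunE linear_sum sum_lfunE.
have [i [j [ij wij]]] : exists i j, i != j /\ w i = w j.
  have /injectivePn[i [j ij wij]] : ~~ injectiveb w.
    apply/negP=> /injectiveP inj_w.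
    by have := leq_card w inj_w; rewrite !card_ord ltnn.
  by exists i, j.
pose X (s : 'S_m.+1) : T m.+1 := pure (fun x => 'e_(w (s^-1%g x))).
rewrite (eq_bigr (fun s : 'S_m.+1 => (-1) ^+ s *: X s)) => [|s _]; last first.
  rewrite linearZ scale_lfunE (functor_perm FF) scalerA; congr (_ *: _).
  rewrite -odd_perm_length /eps; case: sp.
    by rewrite expr1 opprK expr1n mul1r.
  by rewrite expr0 expr1n mulr1 signr_odd.
apply: eq_opp0; rewrite {1}(reindex_inj (mulgI (tperm i j))) -sumrN.
apply: eq_bigr => s _; rewrite odd_permM odd_tperm ij signr_addb expr1 mulN1r.
rewrite scaleNr; congr (- (_ *: _)); apply: eq_pure => x.
rewrite invMg tpermV permM; congr ('e_ _).
by case: tpermP => [->|->|].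
Qed.

Lemma functor_ideal k l (x : brauer_hom K k l) :
  in_ideal delta (Sigma eps m.+1) x -> F k l x = 0.
Proof.
have gen0 k' l' (y : brauer_hom K k' l') :
    Defs.generated delta (Sigma eps m.+1) y -> F k' l' y = 0.
  elim=> {k' l' y} [|k1 l1 p y z _ E|k1 l1 p y z _ E|k1 l1 k2 l2 y z _ E|k1 l1 k2 l2 y z _ E].
  - exact: functor_Sigma.
  - by rewrite (functor_comp FF) E comp_lfun0r.
  - by rewrite (functor_comp FF) E comp_lfun0l.
  - apply: hom_eq_pure => v; rewrite pure_tensor (functor_tensor FF) E !zero_lfunE.
    by apply/ffunP=> w; rewrite !ffunE mulr0.
  apply: hom_eq_pure => v; rewrite pure_tensor (functor_tensor FF) E !zero_lfunE.
  by apply/ffunP=> w; rewrite !ffunE mul0r.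
case=> S gS xS; rewrite (coord_span (X := in_tuple S) xS) linear_sum big1 // => i _.
by rewrite linearZ /= gen0 ?scaler0 //; apply/gS/mem_nth.
Qed.

(** * The kernel *)

(** Vectors indexed by node labels, such that two of them pair to a nonzero
    scalar exactly if their labels may be joined by an arc. *)
Definition adapted (d : nat) (e : nat * bool -> V) : Prop :=
  forall p q : nat * bool, (p.1 < d)%N -> (q.1 < d)%N ->
    (p.2 -> sp) -> (q.2 -> sp) ->
    (form (e p) (e q) != 0) = (q == (p.1, sp && ~~ p.2)).

Variables (d : nat) (e : nat * bool -> V).
Hypothesis e_adapted : adapted d e.

Lemma pairing_value_label n (D E : diagram n 0) : good sp d D ->
  pairing_value form E (fun x => e (label sp D x)) != 0 ->
  E = D \/ diagram_lt sp D E.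
Proof.
move=> gD ne; apply: (label_minimal (sp := sp)) => x.
have lab2 z : (label sp D z).2 -> sp by case/andP.
have half z : opener E z ->
    label sp D (mate E z) = ((label sp D z).1, sp && ~~ (label sp D z).2).
  move=> oz; apply/eqP; rewrite -e_adapted ?(label_lt _ gD) //; try exact: lab2.
  by apply: contraNneq ne => z0; rewrite /pairing_value (bigD1 z) //= z0 mul0r.
rewrite label_mate; have [ox|ox] := boolP (opener E x); first exact: half.
have oy : opener E (mate E x) by rewrite opener_mate.
move: (half _ oy) (lab2 (mate E x)); rewrite mateK => ->.
by case: (label sp D (mate E x)) => q1 [] /=; case: sp => //= /(_ isT).
Qed.

Lemma pairing_value_label_neq0 n (D : diagram n 0) : good sp d D ->
  pairing_value form D (fun x => e (label sp D x)) != 0.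
Proof.
move=> gD; apply/prodf_neq0 => x _.
by rewrite e_adapted ?(label_lt _ gD) ?label_mate //=; case/andP.
Qed.

(** Evaluated at the labels of a diagram of maximal height in the support of y,
    the functionals of all the other diagrams in the support vanish. *)
Lemma functor_good_inj n (y : brauer_hom K n 0) :
  (forall E, y E != 0 -> good sp d E) -> F n 0 y = 0 -> y = 0.
Proof.
move=> gy Fy; apply/ffunP=> D0; rewrite ffunE; apply/eqP; apply: contraT => y0.
have [D yD maxD] := @arg_maxnP _ D0 (fun E => y E != 0) (height sp) y0.
have gD := gy D yD; pose v x := e (label sp D x).
have : F n 0 y (pure v) = 0 by rewrite Fy zero_lfunE.
rewrite {1}[y]hom_diag_sum linear_sum sum_lfunE (bigD1 D) //= big1 => [|E ED].
  have [c cE] := functor_matching FF D.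
  rewrite addr0 linearZ scale_lfunE cE scalerA => /eqP.
  rewrite scaler_eq0 (negPf (tensor1_neq0 K m)) orbF !mulf_eq0 (negPf yD) /=.
  by rewrite expf_eq0 signr_eq0 andbF (negPf (pairing_value_label_neq0 gD)).
have [->|yE] := eqVneq (y E) 0; first by rewrite scale0r linear0 zero_lfunE.
have [c cE] := functor_matching FF E.
rewrite linearZ scale_lfunE cE; have [->|ne] := eqVneq (pairing_value form E v) 0.
  by rewrite mulr0 scale0r scaler0.
have [ED'|/ltn_height lt] := pairing_value_label gD ne.
  by rewrite ED' eqxx in ED.
by have := leq_trans lt (maxD E yE); rewrite ltnn.
Qed.

Lemma functor_bend k l (x : brauer_hom K k l) (s : T k) (t : T l) :
  F (k + l) 0 (bend_hom delta x) (tensor s t) = F _ _ (diag K (caps l)) (tensor (F k l x s) t).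
Proof. by rewrite /bend_hom (functor_comp FF) comp_lfunE (functor_tensor_id FF). Qed.

Lemma functor_bend_eq0 k l (x : brauer_hom K k l) : F k l x = 0 -> F _ _ (bend_hom delta x) = 0.
Proof.
move=> Fx; apply: hom_eq_pure => v; rewrite pure_tensor functor_bend Fx !zero_lfunE.
rewrite (_ : tensor 0 _ = 0) ?linear0 //.
by apply/ffunP=> w; rewrite !ffunE mul0r.
Qed.

Hypothesis md : m = if sp then d.*2 else d.

(** Bending preserves both sides. The bent morphism is congruent to a combination
    of good diagrams, which is killed by the functor as well, hence is 0. *)
Theorem functor_kernel k l (x : brauer_hom K k l) :
  F k l x = 0 <-> in_ideal delta (Sigma eps m.+1) x.
Proof.
split; last exact: functor_ideal.
move=> /functor_bend_eq0 Fx.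
have [y iy gy] := reduce_to_good charK md delta (bend_hom delta x).
have y0 : y = 0.
  apply: functor_good_inj gy _.
  have := functor_ideal iy; rewrite linearB /= Fx sub0r => /eqP.
  by rewrite oppr_eq0 => /eqP.
rewrite -[x](bend_homK delta) /unbend_hom; apply: ideal_compr.
move: iy; rewrite y0 subr0 => iy.
exact: (ideal_tensorr (diag K (id_diagram l)) iy).
Qed.

Theorem functor_inj k l : (k + l <= d.*2)%N -> injective (F k l).
Proof.
move=> kl x x' Fxx; apply/eqP; rewrite -subr_eq0; apply/eqP.
rewrite -[_ - _](bend_homK delta) (_ : bend_hom delta _ = 0).
  by rewrite unbend_hom_sum big1 // => D _; rewrite ffunE scale0r.
apply: functor_good_inj => [E _|]; first by apply: good_small; rewrite mul2n.
by apply: functor_bend_eq0; rewrite linearB /= Fxx subrr.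
Qed.

End Kernel.

(** * Orthogonal and symplectic bases *)

Section AdaptedBasis.
Variables (K : fieldType) (charK : [pchar K] =i pred0) (m : nat) (sp : bool).
Notation V := 'rV[K]_m.
Variable form : {hermitian V for sp & idfun}.

Definition nondegenerate_on (U : {vspace V}) : Prop :=
  forall u, u \in U -> u != 0 -> exists2 w, w \in U & form u w != 0.

(** In the symmetric case a nonisotropic vector is found among z, w and z + w for
    any z and w with (z, w) nonzero. *)
Lemma exists_pair U : nondegenerate_on U -> (0 < \dim U)%N ->
  exists z w, [/\ z \in U, w \in U, form z w != 0,
    sp -> form z z = 0 /\ form w w = 0 & ~~ sp -> w = z].
Proof.
move=> ndU dimU; have z0 : vpick U != 0 by rewrite vpick0 -dimv_eq0 -lt0n.
have [w wU zw] := ndU _ (memv_pick U) z0; set z := vpick U in z0 zw *.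
have zU : z \in U := memv_pick U.
move: (hermC form); case: sp form zw => f zw hC.
  have iso u : f u u = 0.
    by apply: (@eq_opp0 _ charK K^o); rewrite {1}hC expr1 mulN1r.
  by exists z, w; split.
have [zz|zz] := eqVneq (f z z) 0; last by exists z, z.
have [ww|ww] := eqVneq (f w w) 0; last by exists w, w.
exists (z + w), (z + w); split=> //; try by rewrite memvD.
rewrite linearDl !linearDr /= zz ww (hC w z) expr0 mul1r add0r addr0.
by rewrite -mulr2n -mulr_natl mulf_neq0 ?two_neq0.
Qed.

(** Splitting off an anisotropic line or a hyperbolic plane leaves a
    nondegenerate orthogonal complement. *)
Lemma exists_adapted_on (U : {vspace V}) : nondegenerate_on U ->
  exists d (e : nat * bool -> V),
    [/\ \dim U = if sp then d.*2 else d,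
        forall p : nat * bool, (p.1 < d)%N -> (p.2 -> sp) -> e p \in U &
        adapted form d e].
Proof.
elim/ltn_ind: {U}(\dim U) {-2}U (erefl (\dim U)) => n IHn U dimU ndU.
have [n0|n_gt0] := posnP n.
  exists 0%N, (fun=> 0); split=> //; first by rewrite dimU n0 if_same.
have [z [w [zU wU zw zzww wE]]] : exists z w, [/\ z \in U, w \in U, form z w != 0,
    sp -> form z z = 0 /\ form w w = 0 & ~~ sp -> w = z].
  by apply: exists_pair; rewrite ?dimU.
pose U' := (U :&: orthov form <[z]> :&: orthov form <[w]>)%VS.
have U'P u : (u \in U') = [&& u \in U, form u z == 0 & form u w == 0].
  by rewrite !memv_cap !mem_orthov1 andbA.
have wz : form w z != 0 by rewrite herm_eq0C.
have dimU' : \dim U' = (if sp then n.-2 else n.-1).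
  have E1 : \dim (U :&: orthov form <[z]>)%VS = n.-1.
    by rewrite -dimU; apply/esym/eq_dim_orthov1; apply/mem_orthovPn; exists w.
  have [spT|spF] := orP (orbN sp); last by rewrite ifN // /U' wE // -capvA capvv.
  have [zz _] := zzww spT.
  rewrite ifT // /U' -(@eq_dim_orthov1 _ _ _ _ form) ?E1 //; apply/mem_orthovPn; exists z => //.
  by rewrite memv_cap zU mem_orthov1 zz eqxx.
have ndU' : nondegenerate_on U'.
  move=> u; rewrite U'P => /and3P[uU /eqP uz /eqP uw] u0.
  have [v vU uv] := ndU u uU u0.
  have uE a c : form u (v - a *: z - c *: w) = form u v.
    by rewrite !linearBr !linearZr /= uz uw !mulr0 !subr0.
  have vE a c y : form (v - a *: z - c *: w) y = form v y - a * form z y - c * form w y.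
    by rewrite !linearBl !linearZl.
  have inU a c : v - a *: z - c *: w \in U by rewrite !memvB // memvZ.
  have [spT|spF] := orP (orbN sp).
    have [zz ww] := zzww spT.
    exists (v - (form v w / form z w) *: z - (form v z / form w z) *: w).
      by rewrite U'P inU !vE zz ww !mulr0 !divfK // !subr0 !subrr eqxx.
    by rewrite uE.
  exists (v - (form v w / form z w) *: z - 0 *: w); last by rewrite uE.
  have zz : form z z != 0 by rewrite -{2}(wE spF).
  by rewrite U'P inU !vE (wE spF) mul0r subr0 divfK // subrr eqxx.
have ltn' : (\dim U' < n)%N.
  by rewrite dimU'; move: n_gt0; clear; case: (sp); lia.
have [d [e [dimE eU eA]]] := IHn _ ltn' U' erefl ndU'.
pose e' (p : nat * bool) := if p.1 is i.+1 then e (i, p.2) else if p.2 then w else z.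
have eU' (i : nat) (bt : bool) : (i < d)%N -> (bt -> sp) ->
    [&& e (i, bt) \in U, form (e (i, bt)) z == 0 & form (e (i, bt)) w == 0].
  by move=> id bsp; rewrite -U'P eU.
exists d.+1, e'; split.
- have n2 : sp -> n != 1%N.
    move=> /zzww[zz ww]; apply: contraNneq zw => n1.
    have : (<[z]> == U)%VS.
      have z0 : z != 0 by apply: contraNneq wz => ->; rewrite linear0r.
      by rewrite eqEdim -memvE zU dimU n1 dim_vline z0.
    by move/eqP=> UE; move: wU; rewrite -UE => /vlineP[a ->]; rewrite linearZr /= zz mulr0.
  rewrite dimU; move: dimE; rewrite dimU'.
  by move: n2 n_gt0; clear; case: (sp) => [/(_ isT)|_]; lia.
- move=> [[|i] bt] /= id bsp; first by case: bt {bsp}.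
  by have /and3P[] := eU' i bt id bsp.
move=> [[|i] bi] [[|j] bj] /= id jd bsp bsp'; rewrite /e' /=.
- have [spT|spF] := orP (orbN sp).
    have [zz ww] := zzww spT; have -> : sp && ~~ bi = ~~ bi by rewrite spT.
    by case: bi {bsp}; case: bj {bsp'}; rewrite ?zz ?ww ?eqxx ?zw ?wz.
  have -> : sp && ~~ bi = false by rewrite (negPf spF).
  have -> : bi = false by apply: contraNF spF.
  have -> : bj = false by apply: contraNF spF.
  by rewrite eqxx -{2}(wE spF).
- have /and3P[_ ez ew] := eU' j bj jd bsp'.
  by case: bi {bsp}; rewrite herm_eq0C ?ez ?ew.
- have /and3P[_ ez ew] := eU' i bi id bsp.
  by case: bj {bsp'}; rewrite ?ez ?ew.
by rewrite eA // !xpair_eqE eqSS.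
Qed.

Hypothesis form_nondeg : nondegenerate form.

Lemma exists_adapted : exists d (e : nat * bool -> V),
  m = (if sp then d.*2 else d) /\ adapted form d e.
Proof.
have nd : nondegenerate_on fullv.
  move=> u _ u0; apply/mem_orthovPn; apply: contra u0.
  by rewrite (eqP form_nondeg) memv0.
have [d [e [dimE _ eA]]] := exists_adapted_on nd.
by exists d, e; split=> //; rewrite -dimE dimvf /dim /= mul1n.
Qed.

End AdaptedBasis.

(** * A Casimir operator on words *)

Section Words.
Variables (n m : nat).
Notation word := {ffun 'I_n -> 'I_m}.

Definition swap_letters (i j : 'I_n) (w : word) : word := [ffun x => w (tperm i j x)].
Definition put (w : word) (i : 'I_n) (c : 'I_m) : word :=
  [ffun j => if j == i then c else w j].

Lemma put_same w i c : put w i c i = c.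
Proof. by rewrite ffunE eqxx. Qed.

Lemma put_other w i c j : j != i -> put w i c j = w j.
Proof. by rewrite ffunE => /negPf ->. Qed.

Lemma put_put w i c c' : put (put w i c) i c' = put w i c'.
Proof. by apply/ffunP=> j; rewrite !ffunE; case: (j == i). Qed.

Lemma put_id w i : put w i (w i) = w.
Proof. by apply/ffunP=> j; rewrite !ffunE; case: eqP => // ->. Qed.

Lemma put_swap u i j : i != j -> put (put u i (u j)) j (u i) = swap_letters i j u.
Proof.
move=> ij; apply/ffunP=> x; rewrite !ffunE.
have [->|xj] := eqVneq x j; first by rewrite tpermR.
have [->|xi] := eqVneq x i; first by rewrite tpermL.
by rewrite tpermD // eq_sym.
Qed.

Section Ring.
Variable R : comNzRingType.
Implicit Types h : word -> R.

(** The matrix of the operator casimir below. Its entries are integers, whatever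
    the ring is. *)
Definition casimir_coef (sp : bool) (w u : word) : R :=
  n%:R * (m%:R - (-1) ^+ sp) * (u == w)%:R +
  \sum_k \sum_(i | i != k) (u == swap_letters k i w)%:R.

Definition casimir sp h (w : word) : R :=
  n%:R * (m%:R - (-1) ^+ sp) * h w + \sum_k \sum_(i | i != k) h (swap_letters k i w).

Lemma sum_delta h w : \sum_u (u == w)%:R * h u = h w.
Proof.
rewrite (bigD1 w) //= eqxx mul1r big1 ?addr0 // => u /negPf ->.
by rewrite mul0r.
Qed.

Lemma casimirE sp h w : \sum_u casimir_coef sp w u * h u = casimir sp h w.
Proof.
rewrite /casimir /casimir_coef; under eq_bigr do rewrite mulrDl.
rewrite big_split /=; congr (_ + _).
  by rewrite -[in RHS](sum_delta h w) mulr_sumr; apply: eq_bigr => u _; rewrite mulrA.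
under eq_bigr do rewrite mulr_suml.
rewrite exchange_big /=; apply: eq_bigr => k _.
under eq_bigr do rewrite mulr_suml.
by rewrite exchange_big /=; apply: eq_bigr => i _; rewrite sum_delta.
Qed.

(** The action of a matrix unit of gl_m on a tensor, in coordinates. *)
Definition replace_letter (a c : 'I_m) h (w : word) : R :=
  \sum_(i | w i == a) h (put w i c).

(** The map exchanging c with the letter at place i of w is an involution on the
    pairs (w, c). *)
Lemma sum_put i (G : word -> 'I_m -> R) :
  \sum_w \sum_c G w c = \sum_w \sum_c G (put w i c) (w i).
Proof.
rewrite !pair_bigA /=.
pose f (p : word * 'I_m) := (put p.1 i p.2, p.1 i).
have fK : involutive f by case=> w c; rewrite /f /= put_put put_same put_id.
by rewrite (reindex_inj (can_inj fK)).
Qed.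

(** In terms of the matrix units E_ac of gl_m acting on tensors, E_ac and E_ca
    are adjoint and the sum of all E_ac E_ca is n m plus the sum of all swaps. *)
Lemma sum_replace_letter_sq h :
  \sum_a \sum_c \sum_w replace_letter a c h w ^+ 2 =
    \sum_w h w * ((n * m)%:R * h w + \sum_k \sum_(i | i != k) h (swap_letters k i w)).
Proof.
transitivity (\sum_(w : word) \sum_(c : 'I_m) \sum_(i : 'I_n)
    \sum_(j | w j == w i) h (put w i c) * h (put w j c)).
  rewrite exchange_big [RHS]exchange_big /=; apply: eq_bigr => c _.
  rewrite exchange_big /=; apply: eq_bigr => w _.
  rewrite [RHS](partition_big (fun i => w i) xpredT) //=; apply: eq_bigr => a _.
  rewrite expr2 /replace_letter mulr_suml; apply: eq_bigr => i /eqP wi.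
  by rewrite mulr_sumr; apply: eq_bigl => j; rewrite wi.
transitivity (\sum_(i : 'I_n) \sum_(j : 'I_n) \sum_(w : word) \sum_(c : 'I_m)
    (w j == w i)%:R * (h (put w i c) * h (put w j c))).
  under eq_bigr do rewrite exchange_big; rewrite exchange_big /=.
  apply: eq_bigr => i _; rewrite [RHS]exchange_big; apply: eq_bigr => w _.
  rewrite [RHS]exchange_big; apply: eq_bigr => c _.
  rewrite big_mkcond; apply: eq_bigr => j _.
  by case: ifP; rewrite ?mul1r ?mul0r.
transitivity (\sum_(i : 'I_n) \sum_(j : 'I_n) \sum_(w : word) (if j == i then m%:R * h w ^+ 2
    else h w * h (swap_letters i j w))).
  apply: eq_bigr => i _; apply: eq_bigr => j _; rewrite (sum_put i) /=.
  apply: eq_bigr => w _; case: eqVneq => [->|ji].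
    under eq_bigr do rewrite eqxx mul1r put_put put_id.
    by rewrite sumr_const card_ord mulr_natl.
  rewrite (bigD1 (w j)) //= big1 ?addr0 => [|c cj].
    by rewrite put_other // put_same eqxx mul1r put_put put_id put_swap // eq_sym.
  by rewrite put_other // put_same eq_sym (negPf cj) mul0r.
under eq_bigr do rewrite exchange_big; rewrite exchange_big /=.
apply: eq_bigr => w _; rewrite mulrDr mulr_sumr.
rewrite -[n in (n * m)%:R]card_ord natrM -sum1_card natr_sum -!mulrA mulr_suml mulr_sumr.
rewrite -big_split /=; apply: eq_bigr => i _.
rewrite (bigD1 i) //= eqxx mul1r expr2 mulrCA; congr (_ + _).
by rewrite mulr_sumr; apply: eq_bigr => j /negPf ->.
Qed.

End Ring.

Section Positivity.
Variables (sp : bool) (h : word -> rat).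
Hypothesis h_ker : forall w, casimir sp h w = 0.

Let count (a : 'I_m) (w : word) := #|[pred i | w i == a]|.

(** The diagonal matrix units count letters. As the counts of all letters add up
    to n, subtracting n from the sum of their squares leaves the sum of the
    integers c (c - 1), which are nonnegative. For eps = -1, casimir exceeds its
    value for eps = 1 by 2 n. *)
Lemma casimir_squares :
  \sum_a \sum_(c | c != a) \sum_w replace_letter a c h w ^+ 2 +
  \sum_w \sum_a (count a w * (count a w).-1)%:R * h w ^+ 2 +
  sp%:R * (2 * n)%:R * \sum_w h w ^+ 2 = 0.
Proof.
have E1 : \sum_w h w * casimir sp h w = 0 by rewrite big1 // => w _; rewrite h_ker mulr0.
have E2 a w : replace_letter a a h w = (count a w)%:R * h w.
  rewrite /replace_letter (eq_bigr (fun=> h w)) ?sumr_const ?mulr_natl //.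
  by move=> i /eqP wi; rewrite -{1}wi put_id.
have E3 w : \sum_a (count a w)%:R = n%:R :> rat.
  rewrite -natr_sum; congr _%:R; rewrite -[RHS]card_ord -[RHS]sum1_card.
  rewrite (partition_big (fun i => w i) xpredT) //=.
  by apply: eq_bigr => a _; rewrite sum1_card.
have := sum_replace_letter_sq h.
have -> : \sum_a \sum_c \sum_w replace_letter a c h w ^+ 2 =
    \sum_a \sum_(c | c != a) \sum_w replace_letter a c h w ^+ 2 +
    \sum_w \sum_a (count a w)%:R ^+ 2 * h w ^+ 2.
  rewrite [X in _ + X]exchange_big -big_split; apply: eq_bigr => a _ /=.
  rewrite (bigD1 a) //= addrC; congr (_ + _).
  by apply: eq_bigr => w _; rewrite E2 exprMn.
set S := \sum_a \sum_(c | c != a) _ => E.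
have cE a w : (count a w)%:R ^+ 2 = (count a w * (count a w).-1)%:R + (count a w)%:R :> rat.
  by rewrite -natrX -natrD; congr _%:R; case: (count a w) => // q; rewrite expnS expn1 /=; lia.
have E4 : \sum_w \sum_a (count a w)%:R ^+ 2 * h w ^+ 2 =
    \sum_w \sum_a (count a w * (count a w).-1)%:R * h w ^+ 2 + n%:R * \sum_w h w ^+ 2.
  rewrite mulr_sumr -big_split; apply: eq_bigr => w _ /=.
  rewrite -(E3 w) mulr_suml -big_split; apply: eq_bigr => a _ /=.
  by rewrite cE mulrDl.
move: E; rewrite E4; set C := \sum_w \sum_a _; set N := \sum_w h w ^+ 2 => E.
have E5 : \sum_w h w * ((n * m)%:R * h w + \sum_k \sum_(i | i != k) h (swap_letters k i w)) =
    (-1) ^+ sp * n%:R * N.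
  rewrite -[LHS]subr0 -[X in _ - X]E1 -sumrB mulr_sumr; apply: eq_bigr => w _.
  rewrite -mulrBr /casimir opprD addrACA subrr addr0 -mulrBl natrM mulrBr opprB addrCA subrr addr0.
  by rewrite mulrCA expr2 (mulrC n%:R).
rewrite E5 in E; have -> : S + C = (-1) ^+ sp * n%:R * N - n%:R * N.
  by rewrite -E addrA addrK.
rewrite natrM; case: (sp); first by rewrite expr1 mul1r; ring.
by rewrite expr0 !mul0r; ring.
Qed.

Lemma casimir_ker_letters :
  [/\ forall a c w, c != a -> replace_letter a c h w = 0,
      forall w, h w != 0 -> injective w &
      sp -> (0 < n)%N -> forall w, h w = 0].
Proof.
have S0 : 0 <= \sum_a \sum_(c | c != a) \sum_w replace_letter a c h w ^+ 2.
  by do 3!apply: sumr_ge0 => ? _; rewrite sqr_ge0.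
have C0 : 0 <= \sum_w \sum_a (count a w * (count a w).-1)%:R * h w ^+ 2.
  by do 2!apply: sumr_ge0 => ? _; rewrite mulr_ge0 ?sqr_ge0 ?ler0n.
have N0 : 0 <= \sum_w h w ^+ 2 by apply: sumr_ge0 => ? _; rewrite sqr_ge0.
have P0 : 0 <= sp%:R * (2 * n)%:R * \sum_w h w ^+ 2 by rewrite !mulr_ge0 ?ler0n.
have /eqP := casimir_squares; rewrite paddr_eq0 ?addr_ge0 // paddr_eq0 //.
case/andP=> /andP[/eqP SE /eqP CE] /eqP NE; split.
- move=> a c w ca; apply/eqP; rewrite -sqrf_eq0; apply/eqP.
  have sq0 u : 0 <= replace_letter a c h u ^+ 2 by exact: sqr_ge0.
  apply: (@psumr_eq0P _ _ _ (fun u => replace_letter a c h u ^+ 2) (fun u _ => sq0 u) _ w isT).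
  apply: (@psumr_eq0P _ _ (fun c => c != a) (fun c => \sum_u replace_letter a c h u ^+ 2)
    _ _ c ca) => [? _|]; first by apply: sumr_ge0 => ? _; rewrite sqr_ge0.
  apply: (@psumr_eq0P _ _ _ _ _ SE a isT) => ? _.
  by do 2!apply: sumr_ge0 => ? _; rewrite sqr_ge0.
- move=> w hw i j wij; apply/eqP; apply: contraNT hw => ij.
  have E : (count (w i) w * (count (w i) w).-1)%:R * h w ^+ 2 = 0.
    apply: (@psumr_eq0P _ _ xpredT
      (fun a => (count a w * (count a w).-1)%:R * h w ^+ 2)) => // [? _|].
      by rewrite mulr_ge0 ?sqr_ge0 ?ler0n.
    apply: (@psumr_eq0P _ _ _ _ _ CE w isT) => ? _.
    by apply: sumr_ge0 => ? _; rewrite mulr_ge0 ?sqr_ge0 ?ler0n.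
  have c2 : (1 < count (w i) w)%N.
    rewrite /count (cardD1 i) inE eqxx (cardD1 j) !inE wij eqxx.
    by rewrite eq_sym ij.
  move/eqP: E; rewrite mulf_eq0 sqrf_eq0 pnatr_eq0 muln_eq0 => /orP[|//].
  by move: c2; clear; case: (count _ _) => [|[]].
move=> spT n_gt0 w; apply/eqP; rewrite -sqrf_eq0; apply/eqP.
apply: (@psumr_eq0P _ _ _ (fun u => h u ^+ 2) (fun u _ => sqr_ge0 (h u)) _ w isT).
move/eqP: NE; rewrite spT mul1r mulf_eq0 pnatr_eq0 muln_eq0 /=.
by move: n_gt0; rewrite lt0n => /negPf -> /eqP.
Qed.

(** Replacing letters back in a word where a letter has been duplicated produces
    the word and its swap, whence the antisymmetry. *)
Lemma casimir_ker_antisym i j w : i != j -> h (swap_letters i j w) = - h w.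
Proof.
move=> ij; have [rep0 inj_h _] := casimir_ker_letters.
have swap_inj u : injective (swap_letters i j u) -> injective u.
  move=> I x y uxy; apply: (@perm_inj _ (tperm i j)); apply: I.
  by rewrite !ffunE !tpermK.
have [inj_w|ninj] := boolP (injectiveb w); last first.
  have h0 (u : word) : ~ injective u -> h u = 0.
    by move=> nu; apply/eqP; apply: contraT => /inj_h.
  rewrite !h0 ?oppr0 //; first by move/injectiveP; apply/negP.
  by move/swap_inj/injectiveP; apply/negP.
move/injectiveP in inj_w; pose u := put w i (w j).
have wij : w i != w j by apply: contraNneq ij => /inj_w ->.
have := rep0 (w j) (w i) u wij; rewrite /replace_letter (bigD1 i) ?put_same //=.
have ji : j != i by rewrite eq_sym.
rewrite (bigD1 j) /=; last by rewrite put_other // eqxx.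
rewrite big1 ?addr0 => [|x /andP[/andP[ux xi] xj]]; last first.
  by move: ux; rewrite put_other // => /eqP/inj_w xj'; rewrite xj' eqxx in xj.
rewrite put_put put_id put_swap // => /eqP; rewrite addrC addr_eq0 => /eqP.
by [].
Qed.

End Positivity.
End Words.

(** A linear consequence of an integral system over the rational numbers is a
    rational combination of its equations; clearing denominators shows that it
    remains a consequence over every field of characteristic 0. *)
Lemma integral_consequence (K : fieldType) (charK : [pchar K] =i pred0) (I : finType)
    (A : I -> I -> int) (B : I -> int) :
    (forall h : I -> rat, (forall w, \sum_u (A w u)%:~R * h u = 0) ->
       \sum_u (B u)%:~R * h u = 0) ->
  forall h : I -> K, (forall w, \sum_u (A w u)%:~R * h u = 0) ->
    \sum_u (B u)%:~R * h u = 0.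
Proof.
move=> cons h hA.
pose q := #|I|; pose ev := @enum_val I predT.
have sum_ev (R : nzRingType) (f : I -> R) : \sum_u f u = \sum_(i < q) f (ev i).
  by rewrite (reindex ev) //; apply: onW_bij; apply: enum_val_bij.
pose MA : 'M[rat]_q := \matrix_(i, j) (A (ev j) (ev i))%:~R.
pose MB : 'cV[rat]_q := \col_i (B (ev i))%:~R.
have [N NE] : exists N : 'cV[rat]_q, MB = MA *m N.
  have : (MB^T <= MA^T)%MS.
    rewrite submxE; move: (cokermx _) (mulmx_coker MA^T) => C AC.
    apply/eqP/matrixP=> i j; pose hj u := C (enum_rank u) j.
    have hjE i' : hj (ev i') = C i' j by rewrite /hj enum_valK.
    have := cons hj; rewrite sum_ev => E; rewrite !mxE -[RHS]E.
      by apply: eq_bigr => i' _; rewrite !mxE hjE.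
    move=> w; have /matrixP/(_ (enum_rank w) j) := AC.
    rewrite !mxE => EE; rewrite -[RHS]EE sum_ev; apply: eq_bigr => i' _.
    by rewrite !mxE hjE /ev enum_rankK.
  case/submxP=> N E; exists N^T; apply: (can_inj (@trmxK _ _ _)).
  by rewrite E trmx_mul !trmxK.
pose c : int := \prod_(i < q) denq (N i 0).
pose N' j : int := numq (N j 0) * \prod_(i < q | i != j) denq (N i 0).
have N'E j : (N' j)%:~R = c%:~R * N j 0 :> rat.
  have -> : c = denq (N j 0) * \prod_(i < q | i != j) denq (N i 0) by rewrite /c (bigD1 j).
  by rewrite /N' !intrM numqE; ring.
have cB i : c * B (ev i) = \sum_j N' j * A (ev j) (ev i).
  apply: (@intr_inj rat); rewrite rmorphM rmorph_sum /=.
  have /matrixP/(_ i 0) := NE; rewrite !mxE => ->; rewrite mulr_sumr.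
  by apply: eq_bigr => j _; rewrite mxE rmorphM /= N'E; ring.
have c_neq0 : (c%:~R : K) != 0.
  have c_gt0 : 0 < c by apply: prodr_gt0 => i _; apply: denq_gt0.
  rewrite -(gtz0_abs c_gt0) -[_%:~R]/((`|c|%N)%:R).
  by move/pcharf0P: charK => ->; rewrite absz_eq0 gt_eqF.
apply: (mulfI c_neq0); rewrite mulr0 sum_ev mulr_sumr.
under eq_bigr do rewrite mulrA -rmorphM /= cB rmorph_sum /= mulr_suml.
rewrite exchange_big big1 //= => j _.
under eq_bigr do rewrite rmorphM -mulrA.
by rewrite -mulr_sumr -[X in _ * X](sum_ev _ (fun u => (A (ev j) u)%:~R * h u)) hA mulr0.
Qed.

Section CasimirKernel.
Variables (K : fieldType) (charK : [pchar K] =i pred0) (n m : nat) (sp : bool).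
Notation word := {ffun 'I_n -> 'I_m}.
Variable h : word -> K.
Hypothesis h_ker : forall w, casimir sp h w = 0.

Lemma casimir_coef_intr (R : comNzRingType) (w u : word) :
  (casimir_coef int sp w u)%:~R = casimir_coef R sp w u.
Proof.
rewrite /casimir_coef rmorphD !rmorphM rmorphB rmorphXn rmorphN1 !rmorph_nat.
congr (_ + _); rewrite rmorph_sum; apply: eq_bigr => k _ /=.
by rewrite rmorph_sum; apply: eq_bigr => i _ /=; rewrite rmorph_nat.
Qed.

Lemma casimir_kernel_antisym i j w : i != j -> h (swap_letters i j w) = - h w.
Proof.
move=> ij; apply/eqP; rewrite -addr_eq0; apply/eqP.
pose B (u : word) : int := (u == swap_letters i j w)%:R + (u == w)%:R.
have BE (R : comNzRingType) (g : word -> R) :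
    \sum_u (B u)%:~R * g u = g (swap_letters i j w) + g w.
  rewrite -[in RHS](sum_delta g (swap_letters i j w)) -[in RHS](sum_delta g w) -big_split.
  by apply: eq_bigr => u _ /=; rewrite rmorphD !rmorph_nat mulrDl.
rewrite -BE; apply: (integral_consequence charK (A := casimir_coef int sp)) => [g gA|u].
  rewrite BE (@casimir_ker_antisym _ _ sp) ?addNr // => u.
  by rewrite -casimirE -[RHS](gA u); apply: eq_bigr => v _; rewrite casimir_coef_intr.
by rewrite -[RHS](h_ker u) -casimirE; apply: eq_bigr => v _; rewrite casimir_coef_intr.
Qed.

Lemma casimir_kernel_skew w : sp -> (0 < n)%N -> h w = 0.
Proof.
move=> spT n_gt0; pose B (u : word) : int := (u == w)%:R.
have BE (R : comNzRingType) (g : word -> R) : \sum_u (B u)%:~R * g u = g w.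
  by rewrite -[in RHS](sum_delta g w); apply: eq_bigr => u _ /=; rewrite rmorph_nat.
rewrite -BE; apply: (integral_consequence charK (A := casimir_coef int sp)) => [g gA|u].
  have gker u : casimir sp g u = 0.
    by rewrite -casimirE -[RHS](gA u); apply: eq_bigr => v _; rewrite casimir_coef_intr.
  by rewrite BE; have [_ _ ->] := casimir_ker_letters gker.
by rewrite -[RHS](h_ker u) -casimirE; apply: eq_bigr => v _; rewrite casimir_coef_intr.
Qed.

End CasimirKernel.

(** * Invariance under the Lie algebra *)

Section Update.
Variables (n : nat) (W : Type).

Definition update (v : 'I_n -> W) (i : 'I_n) (x : W) : 'I_n -> W :=
  fun j => if j == i then x else v j.

End Update.

Lemma coef1_prod_affine (R : comNzRingType) (I : eqType) (r : seq I) (a c : I -> R) :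
  uniq r ->
  (\prod_(i <- r) ((a i)%:P + c i *: 'X))`_1 =
    \sum_(i <- r) c i * \prod_(j <- r | j != i) a j.
Proof.
have coef0 (s : seq I) : (\prod_(i <- s) ((a i)%:P + c i *: 'X))`_0 = \prod_(i <- s) a i.
  by rewrite coef0_prod; apply: eq_bigr => i _; rewrite !coefE mulr0 addr0.
elim: r => [_|i r IHr /= /andP[ir ur]]; first by rewrite !big_nil coef1.
have iE x : x \in r -> i != x by apply: contraTneq => <-.
rewrite !big_cons eqxx /= mulrDl coefD coefCM -scalerAl coefZ coefXM /= coef0 (IHr ur).
rewrite addrC mulr_sumr; congr (_ * _ + _).
  rewrite big_seq [RHS]big_seq_cond; apply: eq_bigl => x.
  by have [xr|] := boolP (x \in r); rewrite //= eq_sym iE.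
rewrite !big_seq; apply: eq_bigr => x xr; rewrite big_cons iE //.
by rewrite mulrCA.
Qed.

Section LieInvariance.
Variables (K : fieldType) (charK : [pchar K] =i pred0) (m : nat) (sp : bool).
Notation V := 'rV[K]_m.
Notation T r := {ffun {ffun 'I_r -> 'I_m} -> K^o}.
Variable form : {hermitian V for sp & idfun}.
Hypothesis form_nondeg : nondegenerate form.

Lemma form_eq0 (u : V) : (forall w, form u w = 0) -> u = 0.
Proof.
move=> uw; apply/eqP; rewrite -memv0 -(eqP form_nondeg).
by apply/mem_orthovP => w _; apply: uw.
Qed.

Lemma group_act_T0 (g : 'End(V)) (t : T 0) : group_act g t = t.
Proof.
rewrite [RHS]tensor_word_sum; apply: eq_bigr => w _; congr (_ *: _).
by apply: eq_pure => -[].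
Qed.

Section Equivariant.
Variables (n : nat) (phi : 'Hom(T n, T 0)).
Hypothesis phi_inv : equivariant form phi.

Lemma invariant_pure (g : 'End(V)) (v : 'I_n -> V) : isometry form form g ->
  phi (pure (fun i => g (v i))) = phi (pure v).
Proof.
move=> gI; rewrite -group_act_pure phi_inv ?group_act_T0 //; split=> //.
apply/eqP/vspaceP=> x; rewrite memv0 memv_ker; apply/eqP/eqP => [gx|->]; last exact: linear0.
by apply: form_eq0 => w; rewrite -gI gx linear0l.
Qed.

(** Cayley transform: (1 + s A) (1 - s A)^-1 is an isometry. *)
Lemma invariant_cayley (A : 'End(V)) (s : K) (v : 'I_n -> V) :
    (forall x y, form (A x) y = - form x (A y)) -> lker (\1 - s *: A)%VF == 0%VS ->
  phi (pure (fun i => v i + s *: A (v i))) = phi (pure (fun i => v i - s *: A (v i))).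
Proof.
move=> Askew ker0; pose hm := (\1 - s *: A)%VF; pose hp := (\1 + s *: A)%VF.
have hmE x : hm x = x - s *: A x.
  by rewrite /hm add_lfunE opp_lfunE scale_lfunE id_lfunE.
have hpE x : hp x = x + s *: A x by rewrite /hp add_lfunE scale_lfunE id_lfunE.
have same x y : form (hp x) (hp y) = form (hm x) (hm y).
  rewrite hpE hmE hpE hmE !linearDl !linearDr !linearNl !linearNr /=.
  by rewrite !linearZl !linearZr /= Askew; ring.
have gI : isometry form form (hp \o hm^-1)%VF.
  by move=> x y; rewrite !comp_lfunE same !lker0_lfunVK.
have := invariant_pure (fun i => hm (v i)) gI.
have -> : pure (fun i => (hp \o hm^-1)%VF (hm (v i))) = pure (fun i => v i + s *: A (v i)).
  by apply: eq_pure => i; rewrite comp_lfunE lker0_lfunK // hpE.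
by move=> ->; congr (phi _); apply: eq_pure => i; rewrite hmE.
Qed.

Definition word_coef (w : {ffun 'I_n -> 'I_m}) : K :=
  phi (word_tensor K w) [ffun i => ord0_absurd 'I_m i].

Lemma word_coefE w : phi (word_tensor K w) = word_coef w *: tensor1 K m.
Proof.
have [a E] := T0_tensor1 (phi (word_tensor K w)); rewrite /word_coef E; congr (_ *: _).
by rewrite !ffunE big_ord0 [RHS]mulr1.
Qed.

Lemma functional_pure (v : 'I_n -> V) :
  phi (pure v) = (\sum_w word_coef w * \prod_i v i 0 (w i)) *: tensor1 K m.
Proof.
rewrite [pure v]tensor_word_sum linear_sum scaler_suml; apply: eq_bigr => w _.
by rewrite linearZ /= word_coefE scalerA ffunE mulrC.
Qed.

(** Differentiating the invariance under the Cayley transforms of s A at s = 0. *)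
Lemma lie_invariance (A : 'End(V)) (v : 'I_n -> V) :
    (forall x y, form (A x) y = - form x (A y)) ->
  \sum_i phi (pure (update v i (A (v i)))) = 0.
Proof.
move=> Askew.
pose P := \sum_w (word_coef w)%:P *
  \prod_(i < n) ((v i 0 (w i))%:P + (A (v i) 0 (w i)) *: 'X).
have PE s : P.[s] *: tensor1 K m = phi (pure (fun i => v i + s *: A (v i))).
  rewrite functional_pure horner_sum; congr (_ *: _); apply: eq_bigr => w _.
  rewrite hornerM hornerC horner_prod; congr (_ * _); apply: eq_bigr => i _.
  by rewrite !mxE !hornerE mulrC.
pose MA : 'M[K]_m := lin1_mx A.
pose Q : {poly K} := \det (1%:M - 'X *: map_mx polyC MA).
have QE s : Q.[s] = \det (1%:M - s *: MA).
  rewrite -[Q.[s]]/(horner_eval s Q) /Q -det_map_mx; congr (\det _).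
  apply/matrixP=> i j; rewrite !mxE rmorphB rmorph_nat rmorphM /=.
  by rewrite /horner_eval hornerX hornerC.
have Q0 : Q != 0.
  apply: contraTneq isT => Q0; have := QE 0.
  by rewrite Q0 horner0 scale0r subr0 det1 => /eqP; rewrite eq_sym oner_eq0.
have ker0 s : Q.[s] != 0 -> lker (\1 - s *: A)%VF == 0%VS.
  rewrite QE -unitfE -/(_ \in unitmx) => /mulmxK uM.
  apply/eqP/vspaceP=> x; rewrite memv0 memv_ker add_lfunE opp_lfunE scale_lfunE id_lfunE.
  apply/eqP/eqP=> [|->]; last by rewrite linear0 scaler0 subr0.
  have -> : x - s *: A x = x *m (1%:M - s *: MA).
    by rewrite mulmxBr mulmx1 -scalemxAr mul_rV_lin1.
  by move=> x0; rewrite -[x]uM x0 mul0mx.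
have PQ : (P - (P \Po (- 'X))) * Q = 0.
  apply: (@roots_geq_poly_eq0 _ _ [seq i%:R | i <- iota 0 (size ((P - (P \Po (- 'X))) * Q)).+1]).
  - apply/allP=> s _; rewrite rootE hornerM; have [->|Qs] := eqVneq Q.[s] 0.
      by rewrite mulr0.
    rewrite hornerD hornerN horner_comp hornerN hornerX.
    rewrite (@T0_scale_inj K m P.[s] P.[- s]) ?subrr ?mul0r // !PE.
    rewrite invariant_cayley ?ker0 //; congr (phi _); apply: eq_pure => i.
    by rewrite scaleNr.
  - rewrite map_inj_uniq ?iota_uniq // => i j /eqP.
    rewrite -subr_eq0; wlog ij : i j / (i <= j)%N => [H|].
      have [/H//|/ltnW/H E] := leqP i j; rewrite -opprB oppr_eq0 => /E.
      by [].
    rewrite -opprB oppr_eq0 -natrB //; move/pcharf0P: charK => ->.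
    by rewrite subn_eq0 => ji; apply/eqP; rewrite eqn_leq ij.
  by rewrite size_map size_iota.
have {PQ} PP : P = P \Po (- 'X).
  by apply/eqP; rewrite -subr_eq0; move/eqP: PQ; rewrite mulf_eq0 (negPf Q0) orbF.
have P1 : P`_1 = 0.
  have : P`_1 = - P`_1.
    have dE (p : {poly K}) : p`_1 = p^`().[0] by rewrite horner_coef0 coef_deriv.
    rewrite dE {1}PP deriv_comp derivN derivX hornerM horner_comp hornerN hornerX oppr0.
    by rewrite hornerN hornerC mulrN1.
  exact: (@eq_opp0 _ charK K^o).
transitivity (P`_1 *: tensor1 K m); last by rewrite P1 scale0r.
rewrite coef_sum.
under eq_bigr do rewrite functional_pure.
rewrite -scaler_suml exchange_big; congr (_ *: _); apply: eq_bigr => w _.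
rewrite -mulr_sumr coefCM; congr (_ * _); rewrite coef1_prod_affine ?index_enum_uniq //.
apply: eq_bigr => i _; rewrite (bigD1 i) //= /update eqxx; congr (_ * _).
by apply: eq_bigr => j /negPf ->.
Qed.

End Equivariant.
End LieInvariance.

(** * Invariant functionals *)

Lemma lfun_of_linear (K : fieldType) (U W : vectType K) (f : U -> W) : linear f ->
  exists A : 'Hom(U, W), forall x, A x = f x.
Proof.
move=> lf; pose g : {linear U -> W} := HB.pack f (GRing.isLinear.Build K U W *:%R f lf).
by exists (linfun g) => x; rewrite lfunE.
Qed.

Lemma pure_update_linear (K : fieldType) m n (v : 'I_n -> 'rV[K]_m) i :
  linear (fun x => pure (update v i x)).
Proof.
move=> a x y; apply/ffunP=> w; rewrite !ffunE !(bigD1 (P := xpredT) i) //=.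
rewrite /update eqxx !mxE mulrDl -[_ *: _ in RHS]/(_ * _) -mulrA; congr (_ * (_ * _) + _ * _);
  by apply: eq_bigr => j /negPf ->.
Qed.

Section InvariantFunctionals.
Variables (K : fieldType) (charK : [pchar K] =i pred0) (m : nat) (sp : bool).
Notation V := 'rV[K]_m.
Notation T r := {ffun {ffun 'I_r -> 'I_m} -> K^o}.
Variable form : {hermitian V for sp & idfun}.
Hypothesis form_nondeg : nondegenerate form.
Variables (b b' : m.-tuple V).
Hypothesis b_basis : basis_of fullv b.
Hypothesis b'_dual : forall i j, form (tnth b' i) (tnth b j) = (i == j)%:R.
Variable F : forall k l : nat, {linear brauer_hom K k l -> 'Hom(T k, T l)}.
Hypothesis FF : is_brauer_functor form b b' F.
Let eps : K := (-1) ^+ sp.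

Lemma eps_sqr : eps * eps = 1.
Proof. by rewrite -expr2 sqrr_sign. Qed.

Lemma expand_basis z : z = \sum_a form (tnth b' a) z *: tnth b a.
Proof.
have zb : z \in <<b>>%VS by rewrite (span_basis b_basis) memvf.
have {1}-> := coord_span zb; apply: eq_bigr => a _; rewrite -tnth_nth; congr (_ *: _).
have {2}-> := coord_span zb; rewrite linear_sumr (bigD1 a) //= linearZr /=.
rewrite -tnth_nth b'_dual eqxx mulr1 big1 ?addr0 // => c ca.
by rewrite linearZr /= -tnth_nth b'_dual eq_sym (negPf ca) mulr0.
Qed.

Lemma expand_dual_basis z : z = \sum_a form z (tnth b a) *: tnth b' a.
Proof.
apply/eqP; rewrite -subr_eq0; apply/eqP; apply: (form_eq0 form_nondeg) => w.
rewrite [w]expand_basis linear_sumr big1 // => a _; rewrite linearZr /= linearBl linear_sumlz /=.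
rewrite (bigD1 a) //= linearZl /= b'_dual eqxx mulr1 big1 ?addr0 ?subrr ?mulr0 // => c ca.
by rewrite linearZl /= b'_dual (negPf ca) mulr0.
Qed.

Section OneFunctional.
Variables (n : nat) (phi : 'Hom(T n, T 0)).
Hypothesis phi_inv : equivariant form phi.

Definition contraction (k i : 'I_n) (v : 'I_n -> V) : T 0 :=
  \sum_a phi (pure (update (update v k (tnth b a)) i (tnth b' a))).

Lemma phi_update_linear v i : linear (fun x => phi (pure (update v i x))).
Proof. by move=> a x y; rewrite pure_update_linear linearP. Qed.

Lemma phi_update_sum v i (c : 'I_m -> K) (x : 'I_m -> V) :
  phi (pure (update v i (\sum_a c a *: x a))) =
    \sum_a c a *: phi (pure (update v i (x a))).
Proof. exact: (linear_sumZ (phi_update_linear v i)). Qed.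

Lemma phi_update2 v i (a c : K) x y :
  phi (pure (update v i (a *: x - c *: y))) =
    a *: phi (pure (update v i x)) - c *: phi (pure (update v i y)).
Proof.
pose g : {linear V -> T 0} := HB.pack (fun x => phi (pure (update v i x)))
  (GRing.isLinear.Build K V (T 0) *:%R _ (phi_update_linear v i)).
by rewrite -[LHS]/(g _) linearB !linearZ.
Qed.

(** Lie algebra invariance for the elements sending z to (y, z) x - eps (x, z) y,
    where y is the vector in slot k and x runs through the dual basis. *)
Lemma slot_identity (k : 'I_n) (v : 'I_n -> V) :
  (1 - eps * m%:R) *: phi (pure v) +
    \sum_(i | i != k) (form (v k) (v i) *: contraction k i v -
                       eps *: phi (pure (fun j => v (tperm k i j)))) = 0.
Proof.
pose f x z := form (v k) z *: x - (eps * form x z) *: v k.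
have f_lin x : linear (f x).
  move=> a z z'; rewrite /f !linearDr !linearZr /= mulrDr !scalerDl opprD addrACA.
  by rewrite scalerBr !scalerA [eps * (a * _)]mulrCA.
have f_skew x z z' : form (f x z) z' = - form z (f x z').
  rewrite /f !(linearBl, linearBr) !(linearZl, linearZr) /=.
  rewrite (form_swap form z x) (form_swap form z (v k)) -/eps.
  have -> : form (v k) z' * (eps * form x z) = eps * (form (v k) z' * form x z) by ring.
  have -> : eps * form x z' * (eps * form (v k) z) =
      (eps * eps) * (form x z' * form (v k) z) by ring.
  by rewrite eps_sqr; ring.
have lie a : \sum_i phi (pure (update (update v k (tnth b a)) i
    (f (tnth b' a) (update v k (tnth b a) i)))) = 0.
  have [A AE] := lfun_of_linear (f_lin (tnth b' a)).
  rewrite -[RHS](lie_invariance charK form_nondeg phi_inv (A := A) (update v k (tnth b a))).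
    by apply: eq_bigr => i _; rewrite AE.
  by move=> x y; rewrite !AE f_skew.
have {lie} : \sum_a \sum_i phi (pure (update (update v k (tnth b a)) i
    (f (tnth b' a) (update v k (tnth b a) i)))) = 0 by rewrite big1.
rewrite exchange_big (bigD1 k) //= => lie; rewrite -[RHS]lie; congr (_ + _).
  rewrite (eq_bigr (fun a => form (v k) (tnth b a) *: phi (pure (update v k (tnth b' a)))
      - eps *: phi (pure v))); last first.
    move=> a _; have -> : pure (update (update v k (tnth b a)) k
        (f (tnth b' a) (update v k (tnth b a) k))) = pure (update v k (f (tnth b' a) (tnth b a))).
      by apply: eq_pure => j; rewrite /update eqxx; case: (j == k).
    rewrite /f b'_dual eqxx mulr1 phi_update2; congr (_ - _ *: phi _).
    by apply: eq_pure => j; rewrite /update; case: eqP => // ->.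
  rewrite sumrB -phi_update_sum -expand_dual_basis sumr_const card_ord -scaler_nat.
  rewrite scalerA scalerBl scale1r mulrC; congr (phi _ - _).
  by apply: eq_pure => j; rewrite /update; case: eqP => // ->.
apply: eq_bigr => i ik; have ki : (k == i) = false by rewrite eq_sym (negPf ik).
rewrite /contraction scaler_sumr.
have -> : phi (pure (fun j => v (tperm k i j))) =
    \sum_a form (tnth b' a) (v i) *: phi (pure (update (update v k (tnth b a)) i (v k))).
  have swap x y : pure (update (update v k x) i y) = pure (update (update v i y) k x).
    by apply: eq_pure => j; rewrite /update; case: eqP => // ->; rewrite eq_sym ki.
  rewrite (eq_bigr _ (fun a _ => congr1 (fun t => _ *: phi t) (swap _ _))).
  rewrite -phi_update_sum -expand_basis; congr (phi _); apply: eq_pure => j.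
  rewrite /update; have [->|jk] := eqVneq j k; first by rewrite tpermL.
  have [->|ji] := eqVneq j i; first by rewrite tpermR.
  by rewrite tpermD // eq_sym.
rewrite scaler_sumr -sumrB; apply: eq_bigr => a _.
have -> : update v k (tnth b a) i = v i by rewrite /update (negPf ik).
by rewrite /f phi_update2 scalerA.
Qed.
End OneFunctional.

Lemma equivariant_comp k l p (f : 'Hom(T l, T p)) (g : 'Hom(T k, T l)) :
  equivariant form f -> equivariant form g -> equivariant form (f \o g)%VF.
Proof. by move=> fE gE h hI t; rewrite !comp_lfunE gE // fE. Qed.

Definition insert_pair n (x y : V) (u : 'I_n -> V) (i : 'I_(2 + n)) : V :=
  match split i with inl j => if j == ord0 then x else y | inr j => u j end.

Lemma pure_insert_pair n (x y : V) (u : 'I_n -> V) :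
  pure (insert_pair x y u) = tensor (tensor2 x y) (pure u).
Proof.
rewrite pure_tensor tensor2E; congr (tensor (tensor2 _ _) _).
- by rewrite /insert_pair split_lshift.
- by rewrite /insert_pair split_lshift.
by apply: eq_pure => j; rewrite /insert_pair split_rshift.
Qed.

Lemma functor_insert_cup n (u : 'I_n -> V) :
  F n (2 + n) (brauer_tensor (diag K cup_diagram) (diag K (id_diagram n))
    : brauer_hom K n (2 + n)) (pure u) =
  \sum_a pure (insert_pair (tnth b a) (tnth b' a) u).
Proof.
have -> : pure u = tensor (tensor1 K m) (pure u).
  have E : pure (fun j => u (rshift 0 j)) = pure u.
    by apply: eq_pure => j; congr u; apply: val_inj.
  by have := @pure_tensor K m 0 n u; rewrite tensor1E E.
rewrite (functor_tensor_id FF (diag K cup_diagram)) (functor_cup FF).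
rewrite /coevaluation; apply/ffunP=> w; rewrite [LHS]ffunE !sum_ffunE mulr_suml.
by apply: eq_bigr => a _; rewrite pure_insert_pair [RHS]ffunE.
Qed.

Lemma exists_perm2 n (k i : 'I_(2 + n)) : i != k ->
  exists s : 'S_(2 + n), s (lshift n ord0) = k /\ s (lshift n ord_max) = i.
Proof.
move=> ik; pose x0 : 'I_(2 + n) := lshift n ord0; pose x1 : 'I_(2 + n) := lshift n ord_max.
exists (tperm x1 (tperm x0 k i) * tperm x0 k)%g; rewrite !permM tpermL tpermK; split=> //.
rewrite [tperm x1 _ _]tpermD ?tpermL //.
by apply: contraNneq ik => E; rewrite -(tpermK x0 k i) E tpermL.
Qed.

(** Contracting slots k and i and then reinserting the form there keeps a
    functional in the image, once this is known for two slots less. *)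
Lemma contraction_in_image n (phi : 'Hom(T (2 + n), T 0)) (k i : 'I_(2 + n)) :
    (forall psi : 'Hom(T n, T 0), equivariant form psi -> exists y, F n 0 y = psi) ->
    equivariant form phi -> i != k ->
  exists y, forall v,
    F (2 + n) 0 y (pure v) = form (v k) (v i) *: contraction phi k i v.
Proof.
move=> IH phi_inv ik; have [s [sk si]] := exists_perm2 ik.
pose ins : brauer_hom K n (2 + n) :=
  brauer_tensor (diag K cup_diagram) (diag K (id_diagram n)).
pose psi := (phi \o (F _ _ (diag K (perm_diagram s)) \o F _ _ ins))%VF.
have [|y yE] := IH psi.
  by do 2!apply: equivariant_comp => //; apply: (functor_equivariant FF).
pose cy : brauer_hom K (2 + n) 0 := brauer_tensor (diag K cap_diagram) y.
exists (brauer_comp (eps * m%:R) cy (diag K (perm_diagram s^-1%g))) => v.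
rewrite (functor_comp FF) comp_lfunE (functor_perm FF) linearZ /=.
rewrite (functor_cap_tensor FF) yE invgK sk si scalerA mulrC -scalerA; congr (_ *: _).
rewrite !comp_lfunE functor_insert_cup linear_sum linear_sum scaler_sumr.
apply: eq_bigr => a _ /=; rewrite (functor_perm FF) linearZ /= scalerA odd_permV.
rewrite -exprMn -/eps eps_sqr expr1n scale1r; congr (phi _); apply: eq_pure => j.
rewrite -{2}[j](permKV s); move: (s^-1%g j) => x.
have inj_s := inj_eq (@perm_inj _ s).
rewrite /insert_pair /update; case: (split_ordP x) => u ->.
  have [->|->] : u = ord0 \/ u = ord_max.
  - by case: u => [[|[|u]] lt] //; [left | right]; apply: val_inj.
  - by rewrite sk eq_sym (negPf ik) !eqxx.
  by rewrite si !eqxx.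
by rewrite -sk -si !inj_s !eq_rlshift.
Qed.

(** * Fullness on functionals *)

Definition swap_slots n (k i : 'I_n) : 'Hom(T n, T n) :=
  eps *: F n n (diag K (perm_diagram (tperm k i))).

Lemma swap_slots_pure n (k i : 'I_n) v : k != i ->
  swap_slots k i (pure v) = pure (fun j => v (tperm k i j)).
Proof.
move=> ki; rewrite scale_lfunE (functor_perm FF) odd_tperm ki expr1 scalerA eps_sqr.
by rewrite scale1r; apply: eq_pure => j; rewrite tpermV.
Qed.

Definition casimir_functional n (phi : 'Hom(T n, T 0)) : 'Hom(T n, T 0) :=
  (n%:R * (m%:R - eps)) *: phi + \sum_k \sum_(i | i != k) (phi \o swap_slots k i)%VF.

Lemma casimir_functional_linear n : linear (@casimir_functional n).
Proof.
move=> a x y; rewrite /casimir_functional.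
have -> : \sum_(k < n) \sum_(i | i != k) ((a *: x + y) \o swap_slots k i)%VF =
    a *: \sum_(k < n) \sum_(i | i != k) (x \o swap_slots k i)%VF +
    \sum_(k < n) \sum_(i | i != k) (y \o swap_slots k i)%VF.
  rewrite scaler_sumr -big_split; apply: eq_bigr => k _ /=.
  rewrite scaler_sumr -big_split; apply: eq_bigr => i _ /=.
  by rewrite comp_lfunDl comp_lfunZl.
by rewrite scalerDr addrACA scalerDr !scalerA [a * _]mulrC.
Qed.

Lemma casimir_functional_pure n (phi : 'Hom(T n, T 0)) v :
  casimir_functional phi (pure v) = (n%:R * (m%:R - eps)) *: phi (pure v) +
    \sum_k \sum_(i | i != k) phi (pure (fun j => v (tperm k i j))).
Proof.
rewrite add_lfunE scale_lfunE sum_lfunE; congr (_ + _); apply: eq_bigr => k _.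
rewrite sum_lfunE; apply: eq_bigr => i ik.
by rewrite comp_lfunE swap_slots_pure // eq_sym.
Qed.

(** The slot identities add up to a formula for the Casimir operator. *)
Lemma casimir_functional_contraction n (phi : 'Hom(T n, T 0)) v : equivariant form phi ->
  casimir_functional phi (pure v) =
    eps *: \sum_k \sum_(i | i != k) form (v k) (v i) *: contraction phi k i v.
Proof.
move=> phi_inv; rewrite casimir_functional_pure.
have slot k : (m%:R - eps) *: phi (pure v) +
    \sum_(i | i != k) phi (pure (fun j => v (tperm k i j))) =
    eps *: \sum_(i | i != k) form (v k) (v i) *: contraction phi k i v.
  have := slot_identity phi_inv k v; rewrite sumrB -scaler_sumr.
  set S := \sum_(i | _) _ *: _; set Q := \sum_(i | _) _; set P := phi _ => E.
  have -> : S = eps *: Q - (1 - eps * m%:R) *: P.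
    by apply/eqP; rewrite -subr_eq0 -[X in _ == X]E opprB addrCA.
  rewrite scalerBr !scalerA eps_sqr scale1r mulrBr mulr1 mulrA eps_sqr mul1r.
  by rewrite addrC -[in RHS]scaleNr opprB.
rewrite scaler_sumr; under [RHS]eq_bigr do rewrite -slot.
rewrite big_split sumr_const card_ord /=; congr (_ + _).
by rewrite -scalerA scaler_nat.
Qed.

Variables (d : nat) (e : nat * bool -> V).
Hypothesis md : m = if sp then d.*2 else d.
Hypothesis e_adapted : adapted form d e.

Lemma casimir_word_coef n (phi : 'Hom(T n, T 0)) : casimir_functional phi = 0 ->
  forall w, casimir sp (word_coef phi) w = 0.
Proof.
move=> C0 w; apply: (@T0_scale_inj K m); rewrite scale0r.
transitivity ((0 : 'Hom(T n, T 0)) (word_tensor K w)); last by rewrite zero_lfunE.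
rewrite -C0 casimir_functional_pure.
rewrite word_coefE scalerA /casimir scalerDl scaler_suml; congr (_ + _).
apply: eq_bigr => k _; rewrite scaler_suml; apply: eq_bigr => i _.
by rewrite -word_coefE; congr (phi _); apply: eq_pure => j; rewrite ffunE.
Qed.

Lemma functional_eq0_words n (phi : 'Hom(T n, T 0)) :
  (forall w, word_coef phi w = 0) -> phi = 0.
Proof.
by move=> w0; apply: hom_eq_word => w; rewrite word_coefE w0 scale0r zero_lfunE.
Qed.

Section Symmetric.
Hypothesis sp_false : ~~ sp.
Let u (a : 'I_m) : V := e (nat_of_ord a, false).

Lemma orthogonal_u a c : (form (u a) (u c) != 0) = (c == a).
Proof.
have lt (x : 'I_m) : (x < d)%N by have := ltn_ord x; rewrite {2}md (negPf sp_false).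
by rewrite e_adapted ?lt //= xpair_eqE (negPf sp_false) /= andbT.
Qed.

Lemma orthogonal_u0 a c : c != a -> form (u a) (u c) = 0.
Proof. by rewrite -orthogonal_u negbK => /eqP. Qed.

(** The words in an orthogonal basis span the tensor power, being the images of
    the standard words under a bijective linear map. *)
Lemma functional_eq0_orthogonal n (phi : 'Hom(T n, T 0)) :
  (forall w : 'I_n -> 'I_m, phi (pure (fun i => u (w i))) = 0) -> phi = 0.
Proof.
move=> w0; pose f (x : V) := \sum_a x 0 a *: u a.
have f_lin : linear f.
  move=> a x y; rewrite /f scaler_sumr -big_split; apply: eq_bigr => c _ /=.
  by rewrite !mxE scalerDl scalerA.
have [g gE] := lfun_of_linear f_lin.
have gd a : g 'e_a = u a.
  rewrite gE /f (bigD1 a) //= mxE !eqxx scale1r big1 ?addr0 // => c ca.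
  by rewrite mxE eqxx (negPf ca) scale0r.
have ker0 : lker g == 0%VS.
  apply/eqP/vspaceP=> x; rewrite memv0 memv_ker; apply/eqP/eqP=> [gx|->]; last exact: linear0.
  apply/rowP=> a; rewrite mxE; have /eqP := linear0l form (u a).
  rewrite -{1}gx gE /f linear_sumlz (bigD1 a) //= linearZl /= big1 => [|c ca].
    by rewrite addr0 mulf_eq0 (negPf (_ : form (u a) (u a) != 0)) ?orthogonal_u // orbF => /eqP.
  by rewrite linearZl /= orthogonal_u0 ?mulr0 // eq_sym.
apply: hom_eq_pure => v; rewrite zero_lfunE.
have -> : pure v = group_act g (pure (fun i => (g^-1)%VF (v i))).
  by rewrite group_act_pure; apply: eq_pure => i; rewrite lker0_lfunVK.
rewrite /group_act linear_sum big1 // => w _; rewrite linearZ /=.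
have -> : pure (fun i => g 'e_(w i)) = pure (fun i => u (w i)).
  by apply: eq_pure => i; apply: gd.
by rewrite w0 scaler0.
Qed.

(** The reflection in a basis vector which occurs once in a word changes the
    sign of the functional at this word. *)
Lemma antisymmetric_invariant_eq0 n (phi : 'Hom(T n, T 0)) : (0 < n)%N ->
    equivariant form phi ->
    (forall i j v, i != j -> phi (pure (fun x => v (tperm i j x))) = - phi (pure v)) ->
  phi = 0.
Proof.
move=> n_gt0 phi_inv anti; apply: functional_eq0_orthogonal => w.
have [/injectiveP inj_w|/injectivePn[i [j ij wij]]] := boolP (injectiveb w); last first.
  apply: (eq_opp0 charK); rewrite -(anti i j) //; congr (phi _); apply: eq_pure => x.
  by case: tpermP => [->|->|]; rewrite ?wij.
pose i0 : 'I_n := Ordinal n_gt0; pose c := u (w i0).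
have cc : form c c != 0 by rewrite orthogonal_u.
pose f x := x - (2%:R * form c x / form c c) *: c.
have f_lin : linear f.
  move=> a x y; rewrite /f linearDr linearZr /= mulrDr mulrDl scalerDl opprD addrACA.
  rewrite scalerBr scalerA; congr (_ - _ + _).
  by rewrite [2%:R * (a * _)]mulrCA !mulrA.
have [r rE] := lfun_of_linear f_lin.
have eps1 : eps = 1 by rewrite /eps (negPf sp_false).
have formS x y : form x y = form y x by rewrite form_swap -/eps eps1 mul1r.
have r_iso : isometry form form r.
  move=> x y; rewrite !rE /f !(linearBl, linearBr) !(linearZl, linearZr) /=.
  by rewrite (formS x c); field.
have r_fix i : i != i0 -> r (u (w i)) = u (w i).
  move=> ii0; rewrite rE /f orthogonal_u0 ?mulr0 ?mul0r ?scale0r ?subr0 //.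
  by apply: contraNneq ii0 => /inj_w ->.
have r_neg : r c = - c.
  by rewrite rE /f mulfK // mulr2n scalerDl scale1r opprD addrA subrr add0r.
apply: (eq_opp0 charK); rewrite -{1}(invariant_pure form_nondeg phi_inv _ r_iso).
have -> : pure (fun i => r (u (w i))) = pure (update (fun i => u (w i)) i0 (- c)).
  by apply: eq_pure => i; rewrite /update; case: eqP => [->|/eqP/r_fix].
have -> : pure (fun i => u (w i)) = pure (update (fun i => u (w i)) i0 c).
  by apply: eq_pure => i; rewrite /update; case: eqP => [->|].
have -> : - c = 0 *: c - 1 *: c by rewrite scale0r scale1r sub0r.
by rewrite phi_update2 scale0r scale1r sub0r.
Qed.

End Symmetric.

(** The kernel of the Casimir operator on words is 0 or antisymmetric, and
    antisymmetric invariants vanish. *)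
Lemma casimir_functional_inj n (phi : 'Hom(T n, T 0)) : (0 < n)%N ->
  equivariant form phi -> casimir_functional phi = 0 -> phi = 0.
Proof.
move=> n_gt0 phi_inv /casimir_word_coef C0; have [spT|spF] := orP (orbN sp).
  by apply: functional_eq0_words => w; apply: (casimir_kernel_skew charK C0).
apply: antisymmetric_invariant_eq0 => // i j v ij; apply/eqP; rewrite -addr_eq0.
pose chi := (phi \o swap_slots i j + phi)%VF.
have : chi = 0.
  apply: hom_eq_word => w; rewrite add_lfunE comp_lfunE swap_slots_pure // zero_lfunE.
  have -> : pure (fun x => 'e_(w (tperm i j x))) = word_tensor K (swap_letters i j w).
    by apply: eq_pure => x; rewrite ffunE.
  rewrite !word_coefE (casimir_kernel_antisym charK C0) // scaleNr addNr.
  by [].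
move/(congr1 (fun f : 'Hom(T n, T 0) => f (pure v))).
by rewrite add_lfunE comp_lfunE swap_slots_pure // zero_lfunE => ->.
Qed.

(** The Casimir operator maps invariants into the image of the functor and is
    injective on them; as the span of the image and one more invariant consists
    of invariants, comparing dimensions puts that invariant into the image. *)
Theorem functional_full n (phi : 'Hom(T n, T 0)) : equivariant form phi ->
  exists y, F n 0 y = phi.
Proof.
elim/ltn_ind: n phi => n IHn phi phi_inv; have [n0|n_gt0] := posnP n.
  subst n; have [c cE] := T0_tensor1 (phi (tensor1 K m)).
  exists (c *: diag K (id_diagram 0)); apply: hom_eq_pure => v.
  by rewrite linearZ /= (functor_id FF) scale_lfunE id_lfunE tensor1E cE.
have [Fl FlE] := lfun_of_linear (linearP (F n 0)).
have [C CE] := lfun_of_linear (@casimir_functional_linear n).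
pose W := limg Fl; pose U := (W + <[phi]>)%VS.
have W_inv psi : psi \in W -> exists y, F n 0 y = psi.
  by case/memv_imgP=> y _ ->; exists y; rewrite FlE.
have memW y : F n 0 y \in W by rewrite -FlE memv_img ?memvf.
have U_inv psi : psi \in U -> equivariant form psi.
  case/memv_addP=> _ /W_inv[y <-] [_ /vlineP[c ->] ->] g gI t.
  rewrite add_lfunE scale_lfunE (functor_equivariant FF y gI) phi_inv //.
  by rewrite !(group_act_T0 g) add_lfunE scale_lfunE.
have CU psi : psi \in U -> C psi \in W.
  move=> /U_inv psi_inv; rewrite CE.
  have [y yE] : exists y : 'I_n -> 'I_n -> brauer_hom K n 0, forall k i, i != k ->
      forall v, F n 0 (y k i) (pure v) = form (v k) (v i) *: contraction psi k i v.
    have y1 k i : exists y : brauer_hom K n 0, i != k ->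
        forall v, F n 0 y (pure v) = form (v k) (v i) *: contraction psi k i v.
      have [->|ik] := eqVneq i k; first by exists 0.
      have [n' nE] : exists n', n = (2 + n')%N.
        exists n.-2; move: ik (ltn_ord i) (ltn_ord k); rewrite -val_eqE /=; lia.
      have {}IHn : forall chi : 'Hom(T n', T 0), equivariant form chi ->
          exists y, F n' 0 y = chi.
        by apply: IHn; rewrite nE add2n ltnW.
      move: psi psi_inv k i ik; rewrite nE => psi psi_inv k i ik.
      by have [y yE] := contraction_in_image IHn psi_inv ik; exists y.
    have y2 k := fin_all_exists (y1 k).
    by have [y yE] := fin_all_exists y2; exists y.
  rewrite (_ : casimir_functional psi =
      F n 0 (eps *: \sum_k \sum_(i | i != k) y k i)) ?memW //.
  apply: hom_eq_pure => v; rewrite casimir_functional_contraction // linearZ scale_lfunE.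
  congr (_ *: _); rewrite linear_sum sum_lfunE; apply: eq_bigr => k _.
  by rewrite linear_sum sum_lfunE; apply: eq_bigr => i ik; rewrite yE.
have kerU : (U :&: lker C)%VS = 0%VS.
  apply/eqP; rewrite -subv0; apply/subvP=> psi; rewrite memv_cap memv_ker memv0 CE.
  by case/andP=> /U_inv psi_inv /eqP /(casimir_functional_inj n_gt0 psi_inv) ->.
have WU : (W == U)%VS.
  rewrite eqEdim addvSl -(limg_dim_eq kerU) dimvS //.
  by apply/subvP=> _ /memv_imgP[psi psiU ->]; apply: CU.
by apply: W_inv; rewrite (eqP WU) (subvP (addvSr _ _)) ?memv_line.
Qed.

(** * Fullness *)

Lemma group_act_linear (g : 'End(V)) r : linear (@group_act K m g r).
Proof.
move=> a s t; rewrite /group_act scaler_sumr -big_split; apply: eq_bigr => w _ /=.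
by rewrite !ffunE scalerDl scalerA.
Qed.

Lemma tensor_ind k l (W : vectType K) (f g : T k -> T l -> W) :
    (forall t, linear (f^~ t)) -> (forall s, linear (f s)) ->
    (forall t, linear (g^~ t)) -> (forall s, linear (g s)) ->
    (forall w w', f (word_tensor K w) (word_tensor K w') =
       g (word_tensor K w) (word_tensor K w')) ->
  forall s t, f s t = g s t.
Proof.
move=> f1 f2 g1 g2 E s t; rewrite [s]tensor_word_sum [t]tensor_word_sum.
rewrite (linear_sumZ (f1 _)) (linear_sumZ (g1 _)); apply: eq_bigr => w _.
rewrite (linear_sumZ (f2 _)) (linear_sumZ (g2 _)); congr (_ *: _).
by apply: eq_bigr => w' _; rewrite E.
Qed.

Lemma linear_comp (U1 U2 U3 : lmodType K) (f : U2 -> U3) (g : U1 -> U2) :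
  linear f -> linear g -> linear (fun x => f (g x)).
Proof. by move=> lf lg a x y; rewrite lg lf. Qed.

Definition join k l (v : 'I_k -> V) (v' : 'I_l -> V) (i : 'I_(k + l)) : V :=
  match split i with inl j => v j | inr j => v' j end.

Lemma pure_join k l (v : 'I_k -> V) (v' : 'I_l -> V) :
  tensor (pure v) (pure v') = pure (join v v').
Proof.
rewrite pure_tensor; congr (tensor _ _); apply: eq_pure => i.
  by rewrite /join split_lshift.
by rewrite /join split_rshift.
Qed.

Lemma group_act_tensor (g : 'End(V)) k l (s : T k) (t : T l) :
  group_act g (tensor s t) = tensor (group_act g s) (group_act g t).
Proof.
have lk := @group_act_linear g k; have ll := @group_act_linear g l.
have lkl := @group_act_linear g (k + l).
apply: (tensor_ind (f := fun s t => group_act g (tensor s t))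
  (g := fun s t => tensor (group_act g s) (group_act g t))) => [t0|s0|t0|s0|w w'].
- exact: linear_comp lkl (tensor_linearl t0).
- exact: linear_comp lkl (tensor_linearr s0).
- exact: linear_comp (tensor_linearl _) lk.
- exact: linear_comp (tensor_linearr _) ll.
rewrite pure_join !group_act_pure pure_join; apply: eq_pure => i.
by rewrite /join; case: (split i).
Qed.

Lemma tensor_hom_id k l p (f : 'Hom(T k, T l)) :
  exists g : 'Hom(T (k + p), T (l + p)), forall s t, g (tensor s t) = tensor (f s) t.
Proof.
pose wl (w : {ffun 'I_(k + p) -> 'I_m}) : {ffun 'I_k -> 'I_m} := [ffun i => w (lshift p i)].
pose wr (w : {ffun 'I_(k + p) -> 'I_m}) : {ffun 'I_p -> 'I_m} := [ffun i => w (rshift k i)].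
pose g0 (t : T (k + p)) : T (l + p) :=
  \sum_w t w *: tensor (f (word_tensor K (wl w))) (word_tensor K (wr w)).
have g0_lin : linear g0.
  move=> a s t; rewrite /g0 scaler_sumr -big_split; apply: eq_bigr => w _ /=.
  by rewrite !ffunE scalerDl scalerA.
have [g gE] := lfun_of_linear g0_lin; exists g => s t.
apply: (tensor_ind (f := fun s t => g (tensor s t))
  (g := fun s t => tensor (f s) t)) => [t0|s0|t0|s0|w w'].
- exact: linear_comp (linearP g) (tensor_linearl t0).
- exact: linear_comp (linearP g) (tensor_linearr s0).
- exact: linear_comp (tensor_linearl t0) (linearP f).
- exact: tensor_linearr.
pose u : {ffun 'I_(k + p) -> 'I_m} :=
  [ffun i => match split i with inl j => w j | inr j => w' j end].
have uE : tensor (word_tensor K w) (word_tensor K w') = word_tensor K u.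
  rewrite pure_join; apply: eq_pure => i.
  by rewrite /join ffunE; case: (split i).
have wlE : wl u = w by apply/ffunP=> i; rewrite !ffunE split_lshift.
have wrE : wr u = w' by apply/ffunP=> i; rewrite !ffunE split_rshift.
rewrite uE gE /g0 (bigD1 u) //= word_tensorE eqxx scale1r wlE wrE big1 ?addr0 // => x xu.
by rewrite word_tensorE (negPf xu) scale0r.
Qed.

Lemma equivariant_pure k l (f : 'Hom(T k, T l)) :
  (forall g, isometry_group form g -> forall v,
     f (pure (fun i => g (v i))) = group_act g (f (pure v))) -> equivariant form f.
Proof.
move=> fE g gI t; rewrite [t]tensor_word_sum.
rewrite (linear_sumZ (@group_act_linear g k)) !(linear_sumZ (linearP f)).
rewrite (linear_sumZ (@group_act_linear g l)); apply: eq_bigr => w _.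
by congr (_ *: _); rewrite -(fE _ gI) -group_act_pure.
Qed.

Lemma pairing_value_caps l (v : 'I_(l + l) -> V) :
  pairing_value form (caps l) v = \prod_(i < l) form (v (lshift l i)) (v (rshift l i)).
Proof.
rewrite /pairing_value big_split_ord /= [X in _ * X]big_pred0 => [|j]; last first.
  rewrite /opener -(mate_caps_lshift j) mateK mate_caps_lshift /= ltnNge ltnW //.
  by rewrite (leq_trans (ltn_ord j)) ?leq_addr.
rewrite mulr1; apply: eq_big => [j|j _]; last by rewrite mate_caps_lshift.
by rewrite /opener mate_caps_lshift /= (leq_trans (ltn_ord j)) ?leq_addr.
Qed.

(** Pairing with words in the basis dual to the standard one reads off the
    coordinates of z. *)
Lemma caps_nondegenerate l (z : T l) :
  (forall v, F _ _ (diag K (caps l)) (tensor z (pure v)) = 0) -> z = 0.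
Proof.
move=> z0; apply/ffunP=> u; rewrite ffunE.
(* The coordinate a of e_c = sum_j (e_c, b_j) b'_j is (e_c, q a). *)
pose q (a : 'I_m) : V := \sum_j tnth b' j 0 a *: tnth b j.
have qE c a : form 'e_c (q a) = (a == c)%:R.
  have := congr1 (fun x : V => x 0 a) (expand_dual_basis 'e_c).
  rewrite mxE eqxx summxE => ->; rewrite linear_sumr; apply: eq_bigr => j _.
  by rewrite linearZr /= mxE mulrC.
have [c cE] := functor_matching FF (caps l).
have := z0 (fun i => q (u i)); rewrite [z in tensor z _]tensor_word_sum.
rewrite (linear_sumZ (linear_comp (linearP _) (tensor_linearl _))).
have val w : F _ _ (diag K (caps l)) (tensor (word_tensor K w) (pure (fun i => q (u i)))) =
    (eps ^+ c * (w == u)%:R) *: tensor1 K m.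
  rewrite pure_join cE pairing_value_caps; congr ((_ * _) *: _).
  under eq_bigr do rewrite /join split_lshift split_rshift qE.
  have [->|/eqP/ffunP ne] := eqVneq w u; first by rewrite big1 // => i _; rewrite eqxx.
  have [i wi] : exists i, w i != u i.
    apply/existsP; apply: contraT => /existsPn H; case: ne => i.
    by apply/eqP; have := H i; rewrite negbK.
  by rewrite (bigD1 i) //= eq_sym (negPf wi) mul0r.
rewrite (bigD1 u) //= big1 => [|w wu]; last first.
  by rewrite val (negPf wu) mulr0 scale0r scaler0.
rewrite addr0 val eqxx mulr1 !scalerA => /eqP; rewrite scaler_eq0 (negPf (tensor1_neq0 K m)).
by rewrite orbF mulf_eq0 expf_eq0 signr_eq0 andbF orbF => /eqP.
Qed.

(** Bending f by the caps gives an invariant functional, hence a morphism y. Since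
    bending is injective by caps_nondegenerate, unbending y gives f back. *)
Theorem functor_full k l (f : 'Hom(T k, T l)) : equivariant form f ->
  exists x : brauer_hom K k l, F k l x = f.
Proof.
move=> f_inv; have [g gE] := @tensor_hom_id k l l f.
pose phi := (F _ _ (diag K (caps l)) \o g)%VF.
have phi_inv : equivariant form phi.
  apply: equivariant_comp; first exact: (functor_equivariant FF).
  apply: equivariant_pure => h hI v; rewrite !pure_tensor !gE group_act_tensor.
  by rewrite -(f_inv h hI) !group_act_pure.
have [y yE] := functional_full phi_inv.
exists (unbend_hom (eps * m%:R) y); apply/lfunP=> s; apply/eqP; rewrite -subr_eq0.
apply/eqP; apply: caps_nondegenerate => v.
have lin : linear (fun z => F _ _ (diag K (caps l)) (tensor z (pure v))).
  exact: linear_comp (linearP _) (tensor_linearl _).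
have -> : F k l (unbend_hom (eps * m%:R) y) s - f s =
    -1 *: f s + F k l (unbend_hom (eps * m%:R) y) s by rewrite scaleN1r addrC.
rewrite lin -(functor_bend FF) unbend_homK yE /phi comp_lfunE gE.
by rewrite scaleN1r addNr.
Qed.

End InvariantFunctionals.

Theorem theorem4p8 (K : fieldType) (charK : [pchar K] =i pred0) (m : nat)
    (sp : bool) (form : {hermitian 'rV[K]_m for sp & idfun})
    (form_nondeg : nondegenerate form)
    (b b' : m.-tuple 'rV[K]_m) (b_basis : basis_of fullv b)
    (b'_dual : forall i j, form (tnth b' i) (tnth b j) = (i == j)%:R)
    (F : forall k l : nat,
       {linear brauer_hom K k l -> 'Hom(tensor_power K m k, tensor_power K m l)})
    (F_functor : is_brauer_functor form b b' F) :
  let eps : K := (-1) ^+ sp in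
  let d : nat := if sp then m./2 else m in
  (forall (k l : nat) (f : 'Hom(tensor_power K m k, tensor_power K m l)),
     equivariant form f -> exists x : brauer_hom K k l, F k l x = f) /\
  (forall k l : nat,
     ((k + l <= 2 * d)%N -> injective (F k l)) /\
     ((2 * d < k + l)%N -> forall x : brauer_hom K k l,
        F k l x = 0 <-> in_ideal (eps * m%:R) (Sigma eps m.+1) x)).
Proof.
move=> eps d; have [d' [e [md e_adapted]]] := exists_adapted charK form_nondeg.
have dE : d = d'.
  have : d = if sp then (if sp then d'.*2 else d')./2 else (if sp then d'.*2 else d').
    by rewrite -md.
  by move=> ->; case: (sp); rewrite ?doubleK.
split=> [k l f|k l].
  exact: (functor_full charK form_nondeg b_basis b'_dual F_functor md e_adapted).
split=> [kl|_ x]; last exact: (functor_kernel charK F_functor e_adapted md).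
by apply: (functor_inj F_functor e_adapted); rewrite -mul2n -dE.
Qed.
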